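(* Let $g$ be a Ricci-flat Beig–Schmidt metric with first-order data $(\sigma,k_{ab})$ satisfying $\square\sigma+3\sigma=0$, $(\square-3)k_{ab}=0$, $h^{(0)ab}k_{ab}=0$, $\mathcal D^bk_{ab}=0$. Consider an arbitrary variation within this class, so that $$\delta h_{ab}=\rho\,\bigl(-2\,\delta\sigma\,h^{(0)}_{ab}+\delta k_{ab}\bigr)+\mathcal O(\rho^0),\qquad h^{(0)ab}\delta k_{ab}=0,\quad \mathcal D^b\delta k_{ab}=0,$$ where $\delta k_{ab}$ is not required to vanish. Then the first variation of the Mann–Marolf action about $g$, with the boundary hypersurface $\{\rho=\text{const}\}$ taken to $\rho\to\infty$, is $$16\pi G\,\delta S=\int_{dS_3}d^3x\sqrt{-h^{(0)}}\,\bigl(\mathcal D^a\mathcal D^b\sigma+h^{(0)ab}\sigma\bigr)\delta k_{ab}=0,$$ where integrals over $dS_3$ of total divergences are taken to vanish (no boundary contributions from integrations by parts). Thus configurations with different electric and magnetic four-momenta can be varied in the action principle.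
   Context: $h^{(0)}_{ab}dx^adx^b=-d\tau^2+\cosh^2\tau(d\theta^2+\sin^2\theta\,d\phi^2)$ is the unit $dS_3$ metric with Levi-Civita connection $\mathcal D$ and $\square=\mathcal D^a\mathcal D_a$. Beig–Schmidt metric: $ds^2=(1+\sigma/\rho)^2d\rho^2+h_{ab}dx^adx^b$ as $\rho\to\infty$, with $h_{ab}=\rho^2\bigl(h^{(0)}_{ab}+\rho^{-1}h^{(1)}_{ab}+\rho^{-2}h^{(2)}_{ab}+\mathcal O(\rho^{-3})\bigr)$, where $\sigma$ and $h^{(n)}_{ab}$ are fields on $dS_3$, and $k_{ab}:=h^{(1)}_{ab}+2\sigma h^{(0)}_{ab}$. Mann–Marolf action: $$S=\frac1{16\pi G}\int_{\mathcal M}\sqrt{-g}\,R+\frac1{8\pi G}\int_{\partial\mathcal M}\sqrt{-h}\,(K-\hat K),$$ where $\partial\mathcal M$ is a hypersurface $\rho=\text{const}$ (only this boundary is considered) with induced metric $h_{ab}$, $K_{ab}$ is its extrinsic curvature, $K=h^{ab}K_{ab}$, $\hat K=h^{ab}\hat K_{ab}$. The symmetric tensor $\hat K_{ab}$ is defined by $\mathcal R_{ab}=\hat K_{ab}\hat K-\hat K_a{}^c\hat K_{cb}$, with $\mathcal R_{ab}$ the Ricci tensor of $h_{ab}$; one takes the asymptotic power-series solution $\hat K_{ab}=\rho h^{(0)}_{ab}+\mathcal O(\rho^0)$. About a Ricci-flat metric, up to total divergences on $\partial\mathcal M$, $$16\pi G\,\delta S=\int_{\partial\mathcal M}\sqrt{-h}\,(\pi^{ab}-\hat\pi^{ab}+\Delta^{ab})\,\delta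 h_{ab},$$ with $\pi^{ab}=Kh^{ab}-K^{ab}$, $\hat\pi^{ab}=\hat Kh^{ab}-\hat K^{ab}$ and $$\Delta^{ab}=\hat K^{ab}-2\tilde L^{cd}(\hat K_{cd}\hat K^{ab}-\hat K^a_c\hat K^b_d)+D^2\tilde L^{ab}+h^{ab}D_cD_d\tilde L^{cd}-2D_dD^{(a}\tilde L^{b)d}.$$ Here $D$ is the Levi-Civita connection of $h_{ab}$, indices are moved with $h_{ab}$, $\tilde L^{ab}=h^{cd}(L^{-1})_{cd}{}^{ab}$, and $L_{ab}{}^{cd}=h^{cd}\hat K_{ab}+\delta^c_{(a}\delta^d_{b)}\hat K-\delta^c_{(a}\hat K^d_{b)}-\delta^d_{(a}\hat K^c_{b)}$ is regarded as an operator on symmetric 2-tensors. Asymptotic expansions may be differentiated term by term. The electric and magnetic four-momenta are encoded in $\sigma$ and $k_{ab}$ respectively.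
   Formalization: The formal theorem additionally assumes that the integral over the hypersurface ρ=const of the varied density may be expanded term by term as ρ→∞ (limit and integral over the noncompact dS_3 interchange); integration is a linear prescription killing divergences of local currents. *)

(* Defs.v *)
From Stdlib Require Export Reals ZArith List.
From Coquelicot Require Export Coquelicot.
Export ListNotations.
Open Scope R_scope.

Definition Sum {I : Type} (en : list I) (f : I -> R) : R :=
  fold_right (fun i s => f i + s) 0 en.

(** [dS_3] is described in the global coordinates [(tau, theta, phi)]; the
    chart below misses only a null set.  The asymptotic region of spacetime has
    the coordinates [(rho, x)] with [x] in that chart; its coordinate indices
    are [None] (for [rho]) and [Some a]. *)

Inductive idx := tau | theta | phi.
Definition idxs : list idx := [tau; theta; phi].
Definition idx_eq_dec (a b : idx) : {a = b} + {a <> b}.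
Proof. decide equality. Defined.
Definition delta (a b : idx) : R := if idx_eq_dec a b then 1 else 0.
Notation sum3 := (Sum idxs).

Definition idx4 := option idx.
Definition idxs4 : list idx4 := None :: map Some idxs.
Notation sum4 := (Sum idxs4).

Definition pt := idx -> R.
Definition pt4 := (R * pt)%type.
Definition chart (x : pt) : Prop :=
  0 < x theta < PI /\ 0 < x phi < 2 * PI.

Definition upd (x : pt) (a : idx) (t : R) : pt :=
  fun b => if idx_eq_dec a b then t else x b.
Definition pd (a : idx) (f : pt -> R) (x : pt) : R :=
  Derive (fun t => f (upd x a t)) (x a).
Definition ex_pd (a : idx) (f : pt -> R) (x : pt) : Prop :=
  ex_derive (fun t => f (upd x a t)) (x a).

Definition pd4 (i : idx4) (f : pt4 -> R) (p : pt4) : R :=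
  match i with
  | None => Derive (fun r => f (r, snd p)) (fst p)
  | Some a => pd a (fun x => f (fst p, x)) (snd p)
  end.
Definition ex_pd4 (i : idx4) (f : pt4 -> R) (p : pt4) : Prop :=
  match i with
  | None => ex_derive (fun r => f (r, snd p)) (fst p)
  | Some a => ex_pd a (fun x => f (fst p, x)) (snd p)
  end.

Definition ten2 (P : Type) := idx -> idx -> P -> R.
Definition slice (r : R) (T : ten2 pt4) : ten2 pt := fun a b x => T a b (r, x).

(** Generic in the set of indices [I], enumerated by [en]; [gi] is the inverse
    of the metric [g].  A covariant tensor of any rank is a function of the list
    of its indices. *)

Section LeviCivita.
Context {P I : Type} (en : list I) (d : I -> (P -> R) -> P -> R).
Context (g gi : I -> I -> P -> R).

(* [christoffel c a b] is Gamma^c_{ab} *)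
Definition christoffel (c a b : I) (p : P) : R :=
  / 2 * Sum en (fun e => gi c e p *
          (d a (g e b) p + d b (g e a) p - d e (g a b) p)).

Definition ricci (a b : I) (p : P) : R :=
  Sum en (fun c => d c (christoffel c a b) p - d b (christoffel c a c) p) +
  Sum en (fun c => Sum en (fun e =>
    christoffel c c e p * christoffel e a b p -
    christoffel c b e p * christoffel e a c p)).

Definition tensor := list I -> P -> R.

(* sum over the positions in [l] of Gamma^e_{c a} T_{.. e ..}, [a] being the
   index at that position *)
Fixpoint connection_terms (c : I) (T : list I -> R) (p : P) (l : list I) : R :=
  match l with
  | [] => 0
  | a :: m => Sum en (fun e => christoffel e c a p * T (e :: m)) +
              connection_terms c (fun n => T (a :: n)) p m
  end.

(* the differentiation index comes first: [covd T [c; a; b]] is nabla_c T_{ab} *)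
Definition covd (T : tensor) : tensor := fun l p =>
  match l with
  | [] => 0
  | c :: m => d c (T m) p - connection_terms c (fun n => T n p) p m
  end.

End LeviCivita.

Definition ten2_tensor {P : Type} (T : ten2 P) : @tensor P idx := fun l p =>
  match l with [a; b] => T a b p | _ => 0 end.
Definition scalar_tensor {P : Type} (f : P -> R) : @tensor P idx := fun l p =>
  match l with [] => f p | _ => 0 end.

Section Algebra.
Context {P : Type}.
Implicit Types h T : ten2 P.

Definition next (a : idx) : idx :=
  match a with tau => theta | theta => phi | phi => tau end.
Definition cofactor h (a b : idx) (p : P) : R :=
  h (next a) (next b) p * h (next (next a)) (next (next b)) p -
  h (next a) (next (next b)) p * h (next (next a)) (next b) p.
Definition det h (p : P) : R := sum3 (fun b => h tau b p * cofactor h tau b p).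
Definition inv h : ten2 P := fun a b p => cofactor h b a p / det h p.

Definition vol h (p : P) : R := sqrt (- det h p).

Definition trace h T (p : P) : R :=
  sum3 (fun a => sum3 (fun b => inv h a b p * T a b p)).
Definition raise h T : ten2 P := fun a b p =>
  sum3 (fun c => sum3 (fun e => inv h a c p * inv h b e p * T c e p)).
Definition lower h T : ten2 P := fun a b p =>
  sum3 (fun c => sum3 (fun e => h a c p * h b e p * T c e p)).
(* T_a^c *)
Definition mixed h T : ten2 P := fun a c p =>
  sum3 (fun e => inv h c e p * T a e p).
(* T |-> (tr T) h^{ab} - T^{ab} *)
Definition pi_up h T : ten2 P := fun a b p =>
  trace h T p * inv h a b p - raise h T a b p.

End Algebra.

Definition h0 : ten2 pt := fun a b x =>
  match a, b with
  | tau, tau => - 1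
  | theta, theta => (cosh (x tau)) ^ 2
  | phi, phi => (cosh (x tau)) ^ 2 * (sin (x theta)) ^ 2
  | _, _ => 0
  end.

Definition cd0 : @tensor pt idx -> @tensor pt idx := covd idxs pd h0 (inv h0).

Definition hess0 (f : pt -> R) : ten2 pt := fun a b =>
  cd0 (cd0 (scalar_tensor f)) [a; b].
Definition box0 (T : @tensor pt idx) : @tensor pt idx := fun l x =>
  sum3 (fun c => sum3 (fun e => inv h0 c e x * cd0 (cd0 T) (c :: e :: l) x)).

Definition smooth (f : pt -> R) : Prop :=
  forall (l : list idx) (x : pt), chart x ->
    (forall a, ex_pd a (fold_right pd f l) x) /\
    continuous (fold_right pd f l) x.

Definition k_of (sigma : pt -> R) (h1 : ten2 pt) : ten2 pt := fun a b x =>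
  h1 a b x + 2 * sigma x * h0 a b x.

Definition first_order_data (sigma : pt -> R) (k : ten2 pt) : Prop :=
  smooth sigma /\ (forall a b, smooth (k a b)) /\
  forall x, chart x ->
    (forall a b, k a b x = k b a x) /\
    box0 (scalar_tensor sigma) [] x + 3 * sigma x = 0 /\
    (forall a b, box0 (ten2_tensor k) [a; b] x - 3 * k a b x = 0) /\
    trace h0 k x = 0 /\
    (forall a, sum3 (fun b => sum3 (fun c =>
       inv h0 b c x * cd0 (ten2_tensor k) [c; b; a] x)) = 0).

(* As rho -> oo, locally uniformly on dS_3; no uniformity towards the ends
   tau -> +-oo is assumed. *)

Definition asymptotically (Q : pt4 -> Prop) : Prop :=
  forall x0, chart x0 ->
    exists R0 : R, locally x0 (fun x => forall r, R0 < r -> Q (r, x)).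

Definition bigO (n : Z) (f : pt4 -> R) : Prop :=
  forall x0, chart x0 ->
    exists M R0 : R, locally x0 (fun x => forall r, R0 < r ->
      Rabs (f (r, x)) <= M * powerRZ r n).

Definition rho_count (l : list idx4) : nat :=
  length (filter (fun i => match i with None => true | _ => false end) l).

(* O(rho^n) that may be differentiated term by term: each d/drho lowers the
   order by one, derivatives along dS_3 preserve it *)
Definition asympO (n : Z) (f : pt4 -> R) : Prop :=
  forall l : list idx4,
    asymptotically (fun p =>
      (forall i, ex_pd4 i (fold_right pd4 f l) p) /\
      continuous (fold_right pd4 f l) p) /\
    bigO (n - Z.of_nat (rho_count l)) (fold_right pd4 f l).

Definition lapse (sigma : pt -> R) (p : pt4) : R := 1 + sigma (snd p) / fst p.

Definition g4 (sigma : pt -> R) (h : ten2 pt4) (i j : idx4) (p : pt4) : R :=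
  match i, j with
  | None, None => (lapse sigma p) ^ 2
  | Some a, Some b => h a b p
  | _, _ => 0
  end.
Definition g4_inv (sigma : pt -> R) (h : ten2 pt4) (i j : idx4) (p : pt4) : R :=
  match i, j with
  | None, None => / (lapse sigma p) ^ 2
  | Some a, Some b => inv h a b p
  | _, _ => 0
  end.

Definition ricci4 (sigma : pt -> R) (h : ten2 pt4) : idx4 -> idx4 -> pt4 -> R :=
  ricci idxs4 pd4 (g4 sigma h) (g4_inv sigma h).

Definition ricci_flat (sigma : pt -> R) (h : ten2 pt4) : Prop :=
  asymptotically (fun p => forall i j, ricci4 sigma h i j p = 0).

Definition beig_schmidt (sigma : pt -> R) (h1 : ten2 pt) (h : ten2 pt4) : Prop :=
  (forall a b p, h a b p = h b a p) /\
  exists h2 : ten2 pt, (forall a b, smooth (h2 a b)) /\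
    forall a b, asympO (-1) (fun p =>
      h a b p - (fst p) ^ 2 * (h0 a b (snd p) + h1 a b (snd p) / fst p
                               + h2 a b (snd p) / (fst p) ^ 2)).

(* sqrt(-g) R; [g4] has determinant N^2 det h *)
Definition EH_density (sigma : pt -> R) (h : ten2 pt4) (p : pt4) : R :=
  sqrt (- ((lapse sigma p) ^ 2 * det h p)) *
  sum4 (fun i => sum4 (fun j => g4_inv sigma h i j p * ricci4 sigma h i j p)).

(* unit normal n_i dx^i = N drho *)
Definition normal (sigma : pt -> R) : @tensor pt4 idx4 := fun l p =>
  match l with [None] => lapse sigma p | _ => 0 end.

(* K_{ab} = nabla_a n_b *)
Definition extrinsic (sigma : pt -> R) (h : ten2 pt4) : ten2 pt4 := fun a b =>
  covd idxs4 pd4 (g4 sigma h) (g4_inv sigma h) (normal sigma) [Some a; Some b].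

Definition ricci3 (h : ten2 pt4) : ten2 pt4 := fun a b p =>
  ricci idxs pd (slice (fst p) h) (inv (slice (fst p) h)) a b (snd p).

(* the asymptotic solution Khat = rho h0 + O(rho^0) of
   R_ab = Khat_ab Khat - Khat_a^c Khat_cb *)
Definition is_Khat (h Kh : ten2 pt4) : Prop :=
  (forall a b p, Kh a b p = Kh b a p) /\
  (forall a b, asympO 0 (fun p => Kh a b p - fst p * h0 a b (snd p))) /\
  asymptotically (fun p => forall a b,
    ricci3 h a b p =
      Kh a b p * trace h Kh p - sum3 (fun c => mixed h Kh a c p * Kh c b p)).

(* L_{ab}^{cd}, with unit-weight symmetrisations *)
Definition Lop (h Kh : ten2 pt4) (a b c d : idx) (p : pt4) : R :=
  inv h c d p * Kh a b p
  + (delta c a * delta d b + delta c b * delta d a) / 2 * trace h Kh p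
  - (delta c a * mixed h Kh b d p + delta c b * mixed h Kh a d p) / 2
  - (delta d a * mixed h Kh b c p + delta d b * mixed h Kh a c p) / 2.

(* [Li a b c d] is (L^-1)_{ab}^{cd}, the inverse on symmetric 2-tensors; like
   Khat it is a power series in 1/rho, and L is of order 1/rho *)
Definition is_Linv (h Kh : ten2 pt4) (Li : idx -> idx -> ten2 pt4) : Prop :=
  (forall a b c d, asympO 1 (Li a b c d)) /\
  asymptotically (fun p => forall a b c d,
    Li a b c d p = Li b a c d p /\ Li a b c d p = Li a b d c p /\
    sum3 (fun e => sum3 (fun f => Lop h Kh a b e f p * Li e f c d p)) =
      (delta a c * delta b d + delta a d * delta b c) / 2 /\
    sum3 (fun e => sum3 (fun f => Li a b e f p * Lop h Kh e f c d p)) =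
      (delta a c * delta b d + delta a d * delta b c) / 2).

Definition Ltilde (h : ten2 pt4) (Li : idx -> idx -> ten2 pt4) : ten2 pt4 :=
  fun a b p => sum3 (fun c => sum3 (fun d => inv h c d p * Li c d a b p)).

(* Delta^{ab}; in [DDL] the first index is that of the outer derivative *)
Definition Delta (h Kh : ten2 pt4) (Li : idx -> idx -> ten2 pt4) (r : R)
    (a b : idx) (x : pt) : R :=
  let hr := slice r h in
  let hi := inv hr in
  let K := slice r Kh in
  let Ku := raise hr K in
  let Lt := slice r (Ltilde h Li) in
  let D := covd idxs pd hr hi in
  let DDL c d e f := D (D (ten2_tensor (lower hr Lt))) [c; d; e; f] x in
  Ku a b x
  - 2 * sum3 (fun c => sum3 (fun d => Lt c d x *
          (K c d x * Ku a b x - mixed hr K c a x * mixed hr K d b x)))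
  + sum3 (fun c => sum3 (fun d => sum3 (fun e => sum3 (fun f =>
      hi c d x * hi a e x * hi b f x * DDL c d e f))))
  + hi a b x * sum3 (fun c => sum3 (fun d => sum3 (fun e => sum3 (fun f =>
      hi c e x * hi d f x * DDL c d e f))))
  - sum3 (fun d => sum3 (fun c => sum3 (fun e => sum3 (fun f =>
      hi d f x * (hi a c x * hi b e x + hi b c x * hi a e x) * DDL d c e f)))).

(* sqrt(-h) (pi^{ab} - pihat^{ab} + Delta^{ab}) delta h_{ab} on rho = r *)
Definition variation_density (sigma : pt -> R) (h Kh : ten2 pt4)
    (Li : idx -> idx -> ten2 pt4) (dh : ten2 pt4) (r : R) (x : pt) : R :=
  vol h (r, x) * sum3 (fun a => sum3 (fun b =>
    (pi_up h (extrinsic sigma h) a b (r, x) - pi_up h Kh a b (r, x)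
     + Delta h Kh Li r a b x) * dh a b (r, x))).

(** Every density on dS_3 = R x S^2 is a total divergence of some vector field,
    so "total divergences integrate to zero" must refer to currents built
    locally from the fields at hand.  [local_current F n T]: the covariant rank-n
    tensor [T] is a polynomial in the fields [F], [h0], its inverse and their
    covariant derivatives. *)

Definition swap_at {I : Type} (i : nat) (l : list I) : list I :=
  firstn i l ++ rev (firstn 2 (skipn i l)) ++ skipn (i + 2) l.

Inductive local_current (F : nat -> @tensor pt idx -> Prop) :
    nat -> @tensor pt idx -> Prop :=
| loc_field n T : F n T -> local_current F n T
| loc_metric : local_current F 2 (ten2_tensor h0)
| loc_comb n a T U : local_current F n T -> local_current F n U ->
    local_current F n (fun l x => a * T l x + U l x)
| loc_mult m n T U : local_current F m T -> local_current F n U ->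
    local_current F (m + n) (fun l x => T (firstn m l) x * U (skipn m l) x)
| loc_swap n i T : (i + 2 <= n)%nat -> local_current F n T ->
    local_current F n (fun l => T (swap_at i l))
| loc_contract n T : local_current F (S (S n)) T ->
    local_current F n (fun l x =>
      sum3 (fun a => sum3 (fun b => inv h0 a b x * T (a :: b :: l) x)))
| loc_covd n T : local_current F n T -> local_current F (S n) (cd0 T).

Inductive field_set (sigma : pt -> R) (k : ten2 pt) (dsigma : pt -> R)
    (dk : ten2 pt) : nat -> @tensor pt idx -> Prop :=
| fs_sigma : field_set sigma k dsigma dk 0 (scalar_tensor sigma)
| fs_k : field_set sigma k dsigma dk 2 (ten2_tensor k)
| fs_dsigma : field_set sigma k dsigma dk 0 (scalar_tensor dsigma)
| fs_dk : field_set sigma k dsigma dk 2 (ten2_tensor dk).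

Definition mkpt (t a b : R) : pt := fun i =>
  match i with tau => t | theta => a | phi => b end.

(* [int f] stands for the integral of f d^3x over dS_3.  It is the usual one on
   compactly supported densities; the integrals of interest need not converge
   on the noncompact dS_3, so beyond these it is only required to be linear and
   to annihilate sqrt(-h0) D^a V_a for the local currents V. *)
Definition integral_dS3 (F : nat -> @tensor pt idx -> Prop)
    (int : (pt -> R) -> R) : Prop :=
  (forall f1 f2, (forall x, chart x -> f1 x = f2 x) -> int f1 = int f2) /\
  (forall c f1 f2, int (fun x => c * f1 x + f2 x) = c * int f1 + int f2) /\
  (forall f t0 t1 a0 a1 b0 b1,
     t0 < t1 -> 0 < a0 < a1 -> a1 < PI -> 0 < b0 < b1 -> b1 < 2 * PI ->
     (forall x, continuous f x) ->
     (forall x, ~ (t0 <= x tau <= t1 /\ a0 <= x theta <= a1 /\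
                   b0 <= x phi <= b1) -> f x = 0) ->
     int f = RInt (fun t => RInt (fun a => RInt (fun b =>
               f (mkpt t a b)) b0 b1) a0 a1) t0 t1) /\
  (forall V, local_current F 1 V ->
     int (fun x => vol h0 x *
       sum3 (fun a => sum3 (fun b => inv h0 a b x * cd0 V [a; b] x))) = 0).

(* [bulk r f] stands for the integral of f d^4x over the part of spacetime inside
   rho = r.  The interior is unspecified; shells between two hypersurfaces are
   integrated slice by slice. *)
Definition integral_bulk (int : (pt -> R) -> R)
    (bulk : R -> (pt4 -> R) -> R) : Prop :=
  (forall r c f1 f2,
     bulk r (fun p => c * f1 p + f2 p) = c * bulk r f1 + bulk r f2) /\
  (forall f r1 r2, r1 < r2 ->
     ex_RInt (fun r => int (fun x => f (r, x))) r1 r2 ->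
     bulk r2 f - bulk r1 f = RInt (fun r => int (fun x => f (r, x))) r1 r2).

Definition MM_action (G : R) (bulk : R -> (pt4 -> R) -> R)
    (int : (pt -> R) -> R) (sigma : pt -> R) (h Kh : ten2 pt4) (r : R) : R :=
  / (16 * PI * G) * bulk r (EH_density sigma h)
  + / (8 * PI * G) * int (fun x =>
      vol h (r, x) * (trace h (extrinsic sigma h) (r, x) - trace h Kh (r, x))).

(** A curve s |-> (sigma_s, h1_s, h_s) of Beig-Schmidt metrics in the class,
    with its velocity (dsigma, dk, dh) at s = 0. *)

Definition class_variation (sigma : R -> pt -> R) (h1 : R -> ten2 pt)
    (h : R -> ten2 pt4) (dsigma : pt -> R) (dk : ten2 pt) (dh : ten2 pt4)
    : Prop :=
  locally 0 (fun s => beig_schmidt (sigma s) (h1 s) (h s) /\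
                      first_order_data (sigma s) (k_of (sigma s) (h1 s))) /\
  (forall x, chart x ->
     is_derive (fun s => sigma s x) 0 (dsigma x) /\
     forall a b, is_derive (fun s => k_of (sigma s) (h1 s) a b x) 0 (dk a b x)) /\
  asymptotically (fun p => forall a b,
    is_derive (fun s => h s a b p) 0 (dh a b p)) /\
  first_order_data dsigma dk /\
  (forall a b, asympO 0 (fun p =>
     dh a b p - fst p * (- 2 * dsigma (snd p) * h0 a b (snd p)
                         + dk a b (snd p)))).

(* The general formula for the variation of the action about a Ricci-flat
   metric, where total divergences on the boundary have been dropped. *)
Definition first_variation_formula (G : R) (bulk : R -> (pt4 -> R) -> R)
    (int : (pt -> R) -> R) (sigma : R -> pt -> R) (h Kh : R -> ten2 pt4)
    (Li : idx -> idx -> ten2 pt4) (dh : ten2 pt4) : Prop :=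
  exists R0, forall r, R0 < r ->
    is_derive (fun s => MM_action G bulk int (sigma s) (h s) (Kh s) r) 0
      (/ (16 * PI * G) *
       int (variation_density (sigma 0) (h 0) (Kh 0) Li dh r)).

(* The integral over rho = r of the varied density is expanded term by term. *)
Definition integrates_termwise (int : (pt -> R) -> R) (f : R -> pt -> R) : Prop :=
  forall f0 : pt -> R,
    bigO (-1) (fun p => f (fst p) (snd p) - f0 (snd p)) ->
    is_lim (fun r => int (f r)) p_infty (int f0).

Definition limit_density (sigma : pt -> R) (dk : ten2 pt) (x : pt) : R :=
  vol h0 x * sum3 (fun a => sum3 (fun b =>
    (raise h0 (hess0 sigma) a b x + inv h0 a b x * sigma x) * dk a b x)).

(* Main.v *)
Require Import Defs.
From Stdlib Require Import FunctionalExtensionality Lra Lia.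

(** Write [h = rho^2 (h0 + h1 / rho + ...)] with [h1 = k - 2 sigma h0].  The Ricci
    tensor of [h] is [2 h0 + (3/2 k + DD sigma - 3 sigma h0) / rho + ...], and
    solving the defining equation of [Khat] order by order gives
    [Khat = rho h0 + k/2 + DD sigma - sigma h0 + ...], whereas
    [K = rho h0 + k/2 - 2 sigma h0 + ...].  Hence the first term of
    [pi - pihat] is [DD sigma + sigma h0], with indices raised by [h0].
    This tensor [psi0] is Codazzi and trace-free, so it is divergence-free and
    [box psi0 = 3 psi0].  Consequently [psi = psi0 - k/2], the leading part of
    [Khat - h / rho], is a TT tensor with [box psi = 3 psi].  With indices lowered
    by [h], [Ltilde] is [rho h / 4 + rho^2 psi / 2 + ...]; as [D h = 0], the first
    term of [Delta] is [(box psi - 3 psi) / 2 = 0].  The density therefore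
    converges pointwise to the claimed one, which is the divergence of
    [D^b sigma dk_ab] because [dk] is TT. *)

(** * Functions on the asymptotic region *)

(** The orders leave no slack: [sqrt (- det h)] grows like [rho^3] and [dh] like [rho], so the
    bracket contracted with [dh] is needed up to [rho^-4], one order past its formal leading order
    [rho^-3], whose coefficient has to vanish identically. Two inputs are given only implicitly.
    [Khat] is [rho h0] plus a remainder that is bounded with its derivatives but has no prescribed
    limit; expansions therefore allow coefficients depending on [rho], and the linearised equation
    then shows that the remainder differs from the expected tensor by [O(1/rho)]. The inverse of [L]
    is only known to be [O(rho)]; it is never expanded, but applied to the defect of an approximate
    solution that is already accurate enough. Only derivatives along dS_3 are followed through
    expansions; the one radial derivative, in [K], is computed from the original asymptotics of [h].
    Concrete identities on dS_3 are reduced to rational algebra in [cosh], [sinh], [sin], [cos],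
    while second derivatives are handled by Ricci identities. *)

Definition sp (a : idx) : (pt4 -> R) -> pt4 -> R := pd4 (Some a).

Lemma upd_same (x : pt) (a : idx) : upd x a (x a) = x.
Proof.
  apply functional_extensionality; intros b; unfold upd.
  destruct (idx_eq_dec a b); congruence.
Qed.

Lemma locally_upd (x : pt) (a : idx) (Q : pt -> Prop) :
  locally x Q -> locally (x a) (fun t => Q (upd x a t)).
Proof.
  intros [e He]; exists e; intros t Ht; apply He; intros b; unfold upd.
  destruct (idx_eq_dec a b) as [<-|]; [exact Ht|apply ball_center].
Qed.

Lemma chart_open (x : pt) : chart x -> locally x chart.
Proof.
  intros [[H1 H2] [H3 H4]].
  set (e := Rmin (Rmin (x theta) (PI - x theta))
                 (Rmin (x phi) (2 * PI - x phi))).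
  assert (He : 0 < e) by (repeat apply Rmin_pos; lra).
  assert (A1 := Rmin_l (Rmin (x theta) (PI - x theta))
                 (Rmin (x phi) (2 * PI - x phi))).
  assert (A2 := Rmin_r (Rmin (x theta) (PI - x theta))
                 (Rmin (x phi) (2 * PI - x phi))).
  assert (A3 := Rmin_l (x theta) (PI - x theta)).
  assert (A4 := Rmin_r (x theta) (PI - x theta)).
  assert (A5 := Rmin_l (x phi) (2 * PI - x phi)).
  assert (A6 := Rmin_r (x phi) (2 * PI - x phi)).
  fold e in A1, A2.
  exists (mkposreal e He); intros y Hy.
  assert (B1 := Hy theta); assert (B2 := Hy phi).
  change (Rabs (y theta - x theta) < e) in B1.
  change (Rabs (y phi - x phi) < e) in B2.
  apply Rabs_lt_between in B1; apply Rabs_lt_between in B2.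
  unfold chart; lra.
Qed.

Notation ev := asymptotically.

Lemma ev_intro (Q : pt4 -> Prop) :
  (forall r x, chart x -> 1 < r -> Q (r, x)) -> ev Q.
Proof.
  intros H x0 Hx; exists 1.
  apply (filter_imp chart); [|now apply chart_open].
  intros; now apply H.
Qed.

Lemma ev_and (Q1 Q2 : pt4 -> Prop) :
  ev Q1 -> ev Q2 -> ev (fun p => Q1 p /\ Q2 p).
Proof.
  intros H1 H2 x0 Hx.
  destruct (H1 x0 Hx) as [r1 L1]; destruct (H2 x0 Hx) as [r2 L2].
  exists (Rmax r1 r2).
  generalize (filter_and _ _ L1 L2); apply filter_imp.
  intros x [A1 A2] r Hr; split.
  - apply A1; eapply Rle_lt_trans; [apply Rmax_l|eassumption].
  - apply A2; eapply Rle_lt_trans; [apply Rmax_r|eassumption].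
Qed.

(** The implication receives [chart x] and [1 < r], so pointwise arguments may divide by [rho] and
    by functions that vanish only off the chart. *)
Lemma ev_mono (Q1 Q2 : pt4 -> Prop) :
  (forall r x, chart x -> 1 < r -> Q1 (r, x) -> Q2 (r, x)) -> ev Q1 -> ev Q2.
Proof.
  intros H H1.
  assert (H0 : ev (fun p => chart (snd p) /\ 1 < fst p))
    by (apply ev_intro; simpl; tauto).
  intros x0 Hx.
  destruct (ev_and _ _ H0 H1 x0 Hx) as [R0 L]; exists R0.
  revert L; apply filter_imp; intros x A r Hr.
  destruct (A r Hr) as [[A1 A2] A3]; now apply H.
Qed.

Lemma ev_mono2 (Q1 Q2 Q3 : pt4 -> Prop) :
  (forall r x, chart x -> 1 < r -> Q1 (r, x) -> Q2 (r, x) -> Q3 (r, x)) ->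
  ev Q1 -> ev Q2 -> ev Q3.
Proof.
  intros H H1 H2; generalize (ev_and _ _ H1 H2); apply ev_mono.
  intros r x Hx Hr [A1 A2]; auto.
Qed.

(** One threshold [R0] serves a whole neighbourhood, so at fixed large [rho] the property holds near
    the point. This is what allows an eventual equation to be differentiated along dS_3. *)
Lemma ev_locally (Q : pt4 -> Prop) :
  ev Q -> ev (fun p => locally (snd p) (fun y => Q (fst p, y))).
Proof.
  intros H x0 Hx; destruct (H x0 Hx) as [R0 L]; exists R0.
  apply locally_locally in L; revert L; apply filter_imp; intros x L r Hr.
  revert L; apply filter_imp; intros y A; now apply A.
Qed.

Lemma ev_chart (Q : pt -> Prop) :
  ev (fun p => Q (snd p)) -> forall x, chart x -> Q x.
Proof.
  intros H x Hx; destruct (H x Hx) as [R0 L].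
  apply (locally_singleton _ _ L (R0 + 1)); lra.
Qed.

Lemma pd_ext_loc (a : idx) (f g : pt -> R) (x : pt) :
  locally x (fun y => f y = g y) -> pd a f x = pd a g x.
Proof.
  intros H; unfold pd; apply Derive_ext_loc.
  now apply (locally_upd x a (fun y => f y = g y)).
Qed.

Lemma ex_pd_ext_loc (a : idx) (f g : pt -> R) (x : pt) :
  locally x (fun y => f y = g y) -> ex_pd a f x -> ex_pd a g x.
Proof.
  intros H; unfold ex_pd; apply ex_derive_ext_loc.
  now apply (locally_upd x a (fun y => f y = g y)).
Qed.

Lemma pd_ext_chart (a : idx) (f g : pt -> R) (x : pt) :
  chart x -> (forall y, chart y -> f y = g y) -> pd a f x = pd a g x.
Proof.
  intros Hx H; apply pd_ext_loc.
  generalize (chart_open x Hx); now apply filter_imp.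
Qed.

Lemma pd_plus (a : idx) (f g : pt -> R) (x : pt) :
  ex_pd a f x -> ex_pd a g x ->
  pd a (fun y => f y + g y) x = pd a f x + pd a g x.
Proof. intros; unfold pd; now apply Derive_plus. Qed.

Lemma ex_pd_plus (a : idx) (f g : pt -> R) (x : pt) :
  ex_pd a f x -> ex_pd a g x -> ex_pd a (fun y => f y + g y) x.
Proof. intros Hf Hg; exact (ex_derive_plus _ _ _ Hf Hg). Qed.

Lemma pd_mult (a : idx) (f g : pt -> R) (x : pt) :
  ex_pd a f x -> ex_pd a g x ->
  pd a (fun y => f y * g y) x = pd a f x * g x + f x * pd a g x.
Proof.
  intros Hf Hg; unfold pd; rewrite Derive_mult by assumption.
  now rewrite upd_same.
Qed.

Lemma ex_pd_mult (a : idx) (f g : pt -> R) (x : pt) :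
  ex_pd a f x -> ex_pd a g x -> ex_pd a (fun y => f y * g y) x.
Proof. intros Hf Hg; exact (ex_derive_mult _ _ _ Hf Hg). Qed.

Lemma pd_scal (a : idx) (c : R) (f : pt -> R) (x : pt) :
  pd a (fun y => c * f y) x = c * pd a f x.
Proof. unfold pd; now rewrite Derive_scal. Qed.

Lemma ex_pd_const (a : idx) (c : R) (x : pt) : ex_pd a (fun _ => c) x.
Proof. exact (ex_derive_const c (x a)). Qed.

Lemma pd_const (a : idx) (c : R) (x : pt) : pd a (fun _ => c) x = 0.
Proof. unfold pd; apply Derive_const. Qed.

Lemma pd_inv (a : idx) (f : pt -> R) (x : pt) :
  ex_pd a f x -> f x <> 0 ->
  pd a (fun y => / f y) x = - (pd a f x * / f x * / f x).
Proof.
  intros Hf H; unfold pd; rewrite Derive_inv; rewrite ?upd_same; trivial.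
  field; trivial.
Qed.

Lemma ex_pd_inv (a : idx) (f : pt -> R) (x : pt) :
  ex_pd a f x -> f x <> 0 -> ex_pd a (fun y => / f y) x.
Proof. intros Hf H; apply (ex_derive_inv _ _ Hf); now rewrite upd_same. Qed.

Lemma ev_sp_ext (f g : pt4 -> R) (a : idx) :
  ev (fun p => f p = g p) -> ev (fun p => sp a f p = sp a g p).
Proof.
  intros H; generalize (ev_locally _ H); apply ev_mono.
  intros r x _ _ L; now apply pd_ext_loc.
Qed.

(** * Functions bounded together with their derivatives along dS_3 *)

Definition bounded (f : pt4 -> R) : Prop :=
  forall x0, chart x0 -> exists M R0,
    locally x0 (fun x => forall r, R0 < r -> Rabs (f (r, x)) <= M).

(** Boundedness is locally uniform on dS_3 and is asked of [N] successive derivatives along dS_3.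
    Radial derivatives are not controlled, so every bounded function of [rho] alone qualifies. *)
Fixpoint regN (N : nat) (f : pt4 -> R) : Prop :=
  bounded f /\
  ev (fun p => continuous (fun x => f (fst p, x)) (snd p)) /\
  match N with
  | O => True
  | S N => ev (fun p => forall a, ex_pd4 (Some a) f p) /\
           forall a, regN N (sp a f)
  end.

Definition reg (f : pt4 -> R) : Prop := forall N, regN N f.

Lemma bounded_combine (f g k : pt4 -> R) (F : R -> R -> R) :
  ev (fun p => forall M1 M2, Rabs (f p) <= M1 -> Rabs (g p) <= M2 ->
    Rabs (k p) <= F M1 M2) ->
  bounded f -> bounded g -> bounded k.
Proof.
  intros H H1 H2 x0 Hx.
  destruct (H1 x0 Hx) as [M1 [r1 L1]]; destruct (H2 x0 Hx) as [M2 [r2 L2]].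
  destruct (H x0 Hx) as [r3 L3].
  exists (F M1 M2), (Rmax r1 (Rmax r2 r3)).
  generalize (filter_and _ _ L1 (filter_and _ _ L2 L3)); apply filter_imp.
  intros x [A1 [A2 A3]] r Hr.
  assert (E1 := Rmax_l r1 (Rmax r2 r3)); assert (E2 := Rmax_r r1 (Rmax r2 r3)).
  assert (E3 := Rmax_l r2 r3); assert (E4 := Rmax_r r2 r3).
  apply A3; [lra| |]; [apply A1|apply A2]; lra.
Qed.

Lemma regN_ext (N : nat) (f g : pt4 -> R) :
  ev (fun p => f p = g p) -> regN N f -> regN N g.
Proof.
  revert f g; induction N as [|N IH]; intros f g E; simpl;
    intros [H1 [H2 H3]].
  all: assert (Hb : bounded g) by
   (apply (bounded_combine f f g (fun M _ => M)); trivial;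
    revert E; apply ev_mono; intros r x _ _ <-; auto).
  all: assert (Hc : ev (fun p => continuous (fun x => g (fst p, x)) (snd p))) by
   (generalize (ev_locally _ E) H2; apply ev_mono2; simpl; intros r x _ _ L;
    apply continuous_ext_loc; assumption).
  - auto.
  - destruct H3 as [H3 H4]; repeat split; trivial.
    + generalize (ev_locally _ E) H3; apply ev_mono2; intros r x _ _ L A a.
      generalize (A a); now apply ex_pd_ext_loc.
    + intros a; apply (IH (sp a f)); [now apply ev_sp_ext|apply H4].
Qed.

Lemma reg_ext (f g : pt4 -> R) : ev (fun p => f p = g p) -> reg f -> reg g.
Proof. intros E H N; apply (regN_ext N f); auto. Qed.

Lemma regN_S (N : nat) (f : pt4 -> R) : regN (S N) f -> regN N f.
Proof.
  revert f; induction N as [|N IH]; intros f [H1 [H2 [H3 H4]]].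
  - simpl; auto.
  - simpl; repeat split; trivial; intros a; apply IH, H4.
Qed.

Lemma reg_sp (f : pt4 -> R) (a : idx) : reg f -> reg (sp a f).
Proof. intros H N; apply (H (S N)). Qed.

Lemma reg_ex (f : pt4 -> R) :
  reg f -> ev (fun p => forall a, ex_pd4 (Some a) f p).
Proof. intros H; apply (H 1%nat). Qed.

Lemma reg_cont (f : pt4 -> R) :
  reg f -> ev (fun p => continuous (fun x => f (fst p, x)) (snd p)).
Proof. intros H; apply (H 0%nat). Qed.

Lemma reg_bounded (f : pt4 -> R) : reg f -> bounded f.
Proof. intros H; apply (H 0%nat). Qed.

Lemma regN_plus (N : nat) (f g : pt4 -> R) :
  regN N f -> regN N g -> regN N (fun p => f p + g p).
Proof.
  revert f g; induction N as [|N IH]; intros f g; simpl;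
    intros [H1 [H2 H3]] [G1 [G2 G3]].
  all: assert (Hb : bounded (fun p => f p + g p)) by
   (apply (bounded_combine f g _ Rplus); trivial;
    apply ev_intro; intros; eapply Rle_trans; [apply Rabs_triang|lra]).
  all: assert (Hc : ev (fun p =>
     continuous (fun x => f (fst p, x) + g (fst p, x)) (snd p))) by
   (generalize H2 G2; apply ev_mono2; simpl; intros r x _ _ A1 A2;
    apply (continuous_plus (fun x => f (r, x)) (fun x => g (r, x))); assumption).
  - auto.
  - destruct H3 as [H3 H4], G3 as [G3 G4]; repeat split; trivial.
    + generalize H3 G3; apply ev_mono2; intros r x _ _ A1 A2 a.
      apply ex_pd_plus; [apply A1|apply A2].
    + intros a; apply (regN_ext N (fun p => sp a f p + sp a g p)).
      * generalize H3 G3; apply ev_mono2; intros r x _ _ A1 A2; symmetry.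
        apply pd_plus; [apply A1|apply A2].
      * apply IH; auto.
Qed.

Lemma regN_mult (N : nat) (f g : pt4 -> R) :
  regN N f -> regN N g -> regN N (fun p => f p * g p).
Proof.
  revert f g; induction N as [|N IH]; intros f g Hf Hg;
    generalize Hf Hg; simpl; intros [H1 [H2 H3]] [G1 [G2 G3]].
  all: assert (Hb : bounded (fun p => f p * g p)) by
   (apply (bounded_combine f g _ Rmult); trivial;
    apply ev_intro; intros; rewrite Rabs_mult;
    apply Rmult_le_compat; trivial; apply Rabs_pos).
  all: assert (Hc : ev (fun p =>
     continuous (fun x => f (fst p, x) * g (fst p, x)) (snd p))) by
   (generalize H2 G2; apply ev_mono2; simpl; intros r x _ _ A1 A2;
    apply (continuous_mult (fun x => f (r, x)) (fun x => g (r, x))); assumption).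
  - auto.
  - destruct H3 as [H3 H4], G3 as [G3 G4]; repeat split; trivial.
    + generalize H3 G3; apply ev_mono2; intros r x _ _ A1 A2 a.
      apply ex_pd_mult; [apply A1|apply A2].
    + intros a; apply (regN_ext N (fun p => sp a f p * g p + f p * sp a g p)).
      * generalize H3 G3; apply ev_mono2; intros r x _ _ A1 A2; symmetry.
        apply (pd_mult a (fun y => f (r, y)) (fun y => g (r, y)));
          [apply A1|apply A2].
      (* Each product pairs a derivative with an undifferentiated factor, which is regular to order
         [S N] and is lowered to order [N]. *)
      * apply regN_plus; apply IH; auto using regN_S.
Qed.

Lemma reg_plus (f g : pt4 -> R) : reg f -> reg g -> reg (fun p => f p + g p).
Proof. intros Hf Hg N; apply regN_plus; auto. Qed.

Lemma reg_mult (f g : pt4 -> R) : reg f -> reg g -> reg (fun p => f p * g p).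
Proof. intros Hf Hg N; apply regN_mult; auto. Qed.

Lemma reg_radial (u : R -> R) (M : R) :
  (forall r, 1 < r -> Rabs (u r) <= M) -> reg (fun p => u (fst p)).
Proof.
  intros H N; revert u M H; induction N as [|N IH]; intros u M H; simpl.
  all: assert (Hb : bounded (fun p => u (fst p))) by
   (intros x0 Hx; exists M, 1; apply filter_forall; intros x r Hr;
    now apply H).
  all: assert (Hc : ev (fun p => continuous (fun _ : pt => u (fst p)) (snd p))) by
   (apply ev_intro; intros; apply continuous_const).
  - auto.
  - repeat split; trivial.
    + apply ev_intro; intros r x _ _ a; apply ex_pd_const.
    + intros a; apply (regN_ext N (fun p => (fun _ => 0) (fst p))).
      * apply ev_intro; intros r x _ _; symmetry; exact (pd_const a (u r) x).
      * apply (IH (fun _ => 0) 0); intros; rewrite Rabs_R0; lra.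
Qed.

Lemma reg_const (c : R) : reg (fun _ => c).
Proof. apply (reg_radial (fun _ => c) (Rabs c)); intros; lra. Qed.

Lemma reg_scal (c : R) (f : pt4 -> R) : reg f -> reg (fun p => c * f p).
Proof. apply (reg_mult (fun _ => c)), reg_const. Qed.

Lemma reg_opp (f : pt4 -> R) : reg f -> reg (fun p => - f p).
Proof.
  intros H; apply (reg_ext (fun p => -1 * f p)); [|now apply reg_scal].
  apply ev_intro; intros; ring.
Qed.

Lemma reg_minus (f g : pt4 -> R) : reg f -> reg g -> reg (fun p => f p - g p).
Proof. intros Hf Hg; apply (reg_plus f); [|apply reg_opp]; assumption. Qed.

Lemma reg_inv_radius : reg (fun p => / fst p).
Proof.
  apply (reg_radial Rinv 1); intros r Hr.
  rewrite Rabs_pos_eq by (left; apply Rinv_0_lt_compat; lra).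
  rewrite <- Rinv_1; apply Rinv_le_contravar; lra.
Qed.

Lemma reg_sum (F : idx -> pt4 -> R) :
  (forall i, reg (F i)) -> reg (fun p => sum3 (fun i => F i p)).
Proof.
  intros H; unfold Sum; simpl.
  repeat apply (reg_plus (F _)); trivial; apply reg_const.
Qed.

(** Nonvanishing alone would not keep [/ f] bounded as [rho] grows; a locally uniform lower bound
    does. *)
Definition bounded_below (f : pt4 -> R) : Prop :=
  forall x0, chart x0 -> exists c R0, 0 < c /\
    locally x0 (fun x => forall r, R0 < r -> c <= Rabs (f (r, x))).

Lemma bounded_below_neq (f : pt4 -> R) :
  bounded_below f -> ev (fun p => f p <> 0).
Proof.
  intros H x0 Hx; destruct (H x0 Hx) as [c [R0 [Hc L]]]; exists R0.
  revert L; apply filter_imp; intros x A r Hr E.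
  specialize (A r Hr); rewrite E, Rabs_R0 in A; lra.
Qed.

Lemma reg_inv (f : pt4 -> R) :
  bounded_below f -> reg f -> reg (fun p => / f p).
Proof.
  intros Hd Hf N; assert (Hn := bounded_below_neq f Hd).
  assert (Hb : bounded (fun p => / f p)).
  { intros x0 Hx; destruct (Hd x0 Hx) as [c [R0 [Hc L]]].
    exists (/ c), R0; revert L; apply filter_imp; intros x A r Hr.
    rewrite Rabs_inv; apply Rinv_le_contravar; auto. }
  assert (Hc : ev (fun p => continuous (fun x => / f (fst p, x)) (snd p))).
  { generalize (reg_cont f Hf) Hn; apply ev_mono2; simpl; intros r x _ _ C A.
    apply (continuous_comp (fun x => f (r, x)) Rinv); trivial.
    now apply continuous_Rinv. }
  induction N as [|N IH]; simpl; auto.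
  repeat split; trivial.
  - generalize (reg_ex f Hf) Hn; apply ev_mono2; intros r x _ _ E A a.
    apply ex_pd_inv; [apply E|assumption].
  (* The derivative of [/ f] is built from [sp a f] and two copies of [/ f], which the induction
     hypothesis makes regular to order [N]. *)
  - intros a; apply (regN_ext N (fun p => -1 * (sp a f p * / f p * / f p))).
    + generalize (reg_ex f Hf) Hn; apply ev_mono2; intros r x _ _ E A.
      unfold sp; simpl; rewrite pd_inv; [ring|apply E|assumption].
    + apply regN_mult; [apply reg_const|].
      repeat apply regN_mult; trivial; now apply reg_sp.
Qed.

(** Functions on dS_3 are pulled back to the asymptotic region and so inherit every closure property
    of [reg]; evaluation at one large [rho] gives back differentiability and continuity on the
    chart. *)
Definition reg0 (f : pt -> R) : Prop := reg (fun p => f (snd p)).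

Lemma smooth_pd (f : pt -> R) (a : idx) : smooth f -> smooth (pd a f).
Proof.
  intros H l x Hx; specialize (H (l ++ [a]) x Hx).
  now rewrite fold_right_app in H.
Qed.

Lemma continuous_locally_bounded (f : pt -> R) (x0 : pt) :
  continuous f x0 -> locally x0 (fun x => Rabs (f x - f x0) < 1).
Proof.
  intros H.
  apply (H (fun y => Rabs (y - f x0) < 1)).
  exists (mkposreal 1 Rlt_0_1); intros y Hy; exact Hy.
Qed.

Lemma smooth_reg0 (f : pt -> R) : smooth f -> reg0 f.
Proof.
  intros H N; revert f H; induction N as [|N IH]; intros f H; simpl.
  all: assert (Hb : bounded (fun p => f (snd p))) by
   (intros x0 Hx; exists (Rabs (f x0) + 1), 0;
    generalize (continuous_locally_bounded f x0 (proj2 (H [] x0 Hx)));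
    apply filter_imp; intros x A r _; simpl;
    replace (f x) with ((f x - f x0) + f x0) by ring;
    eapply Rle_trans; [apply Rabs_triang|lra]).
  all: assert (Hc : ev (fun p => continuous f (snd p))) by
   (apply ev_intro; intros r x Hx _; apply (H [] x Hx)).
  - auto.
  - repeat split; trivial.
    + apply ev_intro; intros r x Hx _ a; apply (H [] x Hx).
    + intros a; apply (IH (pd a f)); now apply smooth_pd.
Qed.

Lemma reg0_pd (f : pt -> R) (a : idx) : reg0 f -> reg0 (pd a f).
Proof. apply (reg_sp (fun p => f (snd p))). Qed.

Lemma reg0_ex (f : pt -> R) (a : idx) (x : pt) :
  reg0 f -> chart x -> ex_pd a f x.
Proof.
  intros H Hx; apply (ev_chart (fun x => forall a, ex_pd a f x)); trivial.
  apply (reg_ex _ H).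
Qed.

Lemma reg0_cont (f : pt -> R) (x : pt) : reg0 f -> chart x -> continuous f x.
Proof. intros H; apply (ev_chart (continuous f)), (reg_cont _ H). Qed.

Lemma reg0_ext (f g : pt -> R) :
  (forall x, chart x -> f x = g x) -> reg0 f -> reg0 g.
Proof. intros H; apply reg_ext, ev_intro; intros; now apply H. Qed.

Lemma reg0_const (c : R) : reg0 (fun _ => c).
Proof. exact (reg_const c). Qed.

Lemma reg0_plus (f g : pt -> R) :
  reg0 f -> reg0 g -> reg0 (fun x => f x + g x).
Proof. exact (reg_plus (fun p => f (snd p)) (fun p => g (snd p))). Qed.

Lemma reg0_mult (f g : pt -> R) :
  reg0 f -> reg0 g -> reg0 (fun x => f x * g x).
Proof. exact (reg_mult (fun p => f (snd p)) (fun p => g (snd p))). Qed.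

Lemma reg0_opp (f : pt -> R) : reg0 f -> reg0 (fun x => - f x).
Proof. apply (reg_opp (fun p => f (snd p))). Qed.

Lemma reg0_minus (f g : pt -> R) :
  reg0 f -> reg0 g -> reg0 (fun x => f x - g x).
Proof. exact (reg_minus (fun p => f (snd p)) (fun p => g (snd p))). Qed.

Lemma reg0_sum (F : idx -> pt -> R) :
  (forall i, reg0 (F i)) -> reg0 (fun x => sum3 (fun i => F i x)).
Proof. apply (reg_sum (fun i p => F i (snd p))). Qed.

Lemma bounded_below_reg0 (f : pt -> R) :
  reg0 f -> (forall x, chart x -> f x <> 0) ->
  bounded_below (fun p => f (snd p)).
Proof.
  intros Hf Hn x0 Hx.
  assert (P : 0 < Rabs (f x0)) by (apply Rabs_pos_lt; auto).
  exists (Rabs (f x0) / 2), 0; split; [lra|].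
  assert (L : locally x0 (fun x => Rabs (f x - f x0) < Rabs (f x0) / 2)).
  { apply (reg0_cont f x0 Hf Hx (fun y => Rabs (y - f x0) < Rabs (f x0) / 2)).
    assert (P2 : 0 < Rabs (f x0) / 2) by lra.
    exists (mkposreal _ P2); intros y Hy; exact Hy. }
  revert L; apply filter_imp; intros x A r _; simpl.
  assert (T := Rabs_triang (f x) (f x0 - f x)).
  replace (f x + (f x0 - f x)) with (f x0) in T by ring.
  rewrite (Rabs_minus_sym (f x0)) in T; lra.
Qed.

Lemma reg0_inv (f : pt -> R) :
  reg0 f -> (forall x, chart x -> f x <> 0) -> reg0 (fun x => / f x).
Proof.
  intros Hf Hn; apply (reg_inv (fun p => f (snd p))); trivial.
  now apply bounded_below_reg0.
Qed.

Lemma continuous_upd2 (f : pt -> R) (x : pt) (a b : idx) :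
  continuous f x ->
  continuity_2d_pt (fun s t => f (upd (upd x a s) b t)) (x a) (x b).
Proof.
  intros H e.
  assert (L : locally x (fun y => Rabs (f y - f x) < e)).
  { apply (H (fun y => Rabs (y - f x) < e)).
    exists e; intros y Hy; exact Hy. }
  destruct L as [d L]; exists d; intros u v Hu Hv.
  assert (E : upd (upd x a (x a)) b (x b) = x) by now rewrite !upd_same.
  rewrite E; apply L.
  intros c; unfold upd; destruct (idx_eq_dec b c) as [<-|]; [exact Hv|].
  destruct (idx_eq_dec a c) as [<-|]; [exact Hu|apply ball_center].
Qed.

Lemma locally_2d_upd2 (Q : pt -> Prop) (x : pt) (a b : idx) :
  locally x Q -> locally_2d (fun s t => Q (upd (upd x a s) b t)) (x a) (x b).
Proof.
  intros [d L]; exists d; intros u v Hu Hv; apply L.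
  intros c; unfold upd; destruct (idx_eq_dec b c) as [<-|]; [exact Hv|].
  destruct (idx_eq_dec a c) as [<-|]; [exact Hu|apply ball_center].
Qed.

Lemma locally_2d_imp (P Q : R -> R -> Prop) (x y : R) :
  (forall u v, P u v -> Q u v) -> locally_2d P x y -> locally_2d Q x y.
Proof. intros H [d L]; exists d; auto. Qed.

Lemma upd_comm (x : pt) (a b : idx) (s t : R) :
  a <> b -> upd (upd x a s) b t = upd (upd x b t) a s.
Proof.
  intros N; apply functional_extensionality; intros c; unfold upd.
  destruct (idx_eq_dec b c), (idx_eq_dec a c); congruence.
Qed.

Lemma upd_upd (x : pt) (a : idx) (s t : R) : upd (upd x a s) a t = upd x a t.
Proof.
  apply functional_extensionality; intros c; unfold upd.
  destruct (idx_eq_dec a c); congruence.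
Qed.

Lemma upd_at (x : pt) (a : idx) (s : R) : upd x a s a = s.
Proof. unfold upd; destruct (idx_eq_dec a a); congruence. Qed.

Lemma upd_other (x : pt) (a b : idx) (s : R) : a <> b -> upd x a s b = x b.
Proof. unfold upd; destruct (idx_eq_dec a b); congruence. Qed.

(** Restriction to the coordinate plane through [x] in the directions [a] and [b] reduces this to
    the theorem of Schwarz for the function [F] of two real variables. *)
Lemma pd_comm (f : pt -> R) (a b : idx) (x : pt) :
  reg0 f -> chart x -> pd a (pd b f) x = pd b (pd a f) x.
Proof.
  intros Hf Hx; destruct (idx_eq_dec a b) as [<-|N]; trivial.
  set (F := fun s t => f (upd (upd x a s) b t)).
  assert (Eb : forall u v, pd b f (upd (upd x a u) b v) = Derive (F u) v).
  { intros u v; unfold pd, F; rewrite upd_at; apply Derive_ext; intros t.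
    now rewrite upd_upd. }
  assert (Ea : forall u v,
    pd a f (upd (upd x a u) b v) = Derive (fun z => F z v) u).
  { intros u v; unfold pd, F.
    rewrite (upd_other _ b a) by congruence; rewrite upd_at.
    apply Derive_ext; intros t; now rewrite upd_comm, upd_upd by congruence. }
  assert (Eab : forall u v, pd a (pd b f) (upd (upd x a u) b v) =
            Derive (fun z => Derive (F z) v) u).
  { intros u v; unfold pd at 1; rewrite (upd_other _ b a) by congruence.
    rewrite upd_at; apply Derive_ext; intros t.
    now rewrite <- Eb, upd_comm, upd_upd by congruence. }
  assert (Eba : forall u v, pd b (pd a f) (upd (upd x a u) b v) =
            Derive (fun z => Derive (fun t => F t z) u) v).
  { intros u v; unfold pd at 1; rewrite upd_at; apply Derive_ext; intros t.
    now rewrite <- Ea, upd_upd. }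
  assert (X : upd (upd x a (x a)) b (x b) = x) by now rewrite !upd_same.
  rewrite <- X, Eab, Eba; apply Schwarz.
  - apply (locally_2d_imp (fun s t => chart (upd (upd x a s) b t))).
    2: now apply locally_2d_upd2, chart_open.
    intros u v Hc.
    assert (G1 := reg0_ex f a _ Hf Hc); assert (G2 := reg0_ex f b _ Hf Hc).
    assert (G3 := reg0_ex _ a _ (reg0_pd f b Hf) Hc).
    assert (G4 := reg0_ex _ b _ (reg0_pd f a Hf) Hc).
    unfold ex_pd in G1, G2, G3, G4.
    rewrite (upd_other _ b a) in G1, G3 by congruence.
    rewrite upd_at in G1, G2, G3, G4.
    repeat split.
    + revert G1; apply ex_derive_ext; intros t; unfold F.
      now rewrite upd_comm, upd_upd by congruence.
    + revert G2; apply ex_derive_ext; intros t; unfold F; now rewrite upd_upd.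
    + revert G3; apply ex_derive_ext; intros t; rewrite <- Eb.
      now rewrite upd_comm, upd_upd by congruence.
    + revert G4; apply ex_derive_ext; intros t; rewrite <- Ea.
      now rewrite upd_upd.
  - apply (continuity_2d_pt_ext
      (fun u v => pd a (pd b f) (upd (upd x a u) b v))); [exact Eab|].
    apply continuous_upd2, reg0_cont; trivial; now apply reg0_pd, reg0_pd.
  - apply (continuity_2d_pt_ext
      (fun u v => pd b (pd a f) (upd (upd x a u) b v))); [exact Eba|].
    apply continuous_upd2, reg0_cont; trivial; now apply reg0_pd, reg0_pd.
Qed.

(* [f0] and [f1] may depend on rho: the first-order part of Khat has to be
   carried along before it is known to have a limit. *)
Definition expands (n : Z) (F f0 f1 : pt4 -> R) : Prop :=
  reg f0 /\ reg f1 /\ exists e, reg e /\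
    ev (fun p => F p = powerRZ (fst p) n *
                       (f0 p + f1 p * / fst p + e p * / fst p * / fst p)).

Lemma expands_ext (n m : Z) (F G f0 f1 g0 g1 : pt4 -> R) :
  expands n F f0 f1 -> n = m -> ev (fun p => F p = G p) ->
  ev (fun p => f0 p = g0 p) -> ev (fun p => f1 p = g1 p) ->
  expands m G g0 g1.
Proof.
  intros [H0 [H1 [e [He E]]]] <- EF E0 E1.
  split; [now apply (reg_ext f0)|split; [now apply (reg_ext f1)|]].
  exists e; split; trivial.
  generalize (ev_and _ _ E EF) (ev_and _ _ E0 E1); apply ev_mono2.
  intros r x _ _ [A1 <-] [<- <-]; assumption.
Qed.

Lemma expands_coef (n m : Z) (F f0 f1 g0 g1 : pt4 -> R) :
  expands n F f0 f1 -> n = m ->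
  ev (fun p => f0 p = g0 p) -> ev (fun p => f1 p = g1 p) -> expands m F g0 g1.
Proof.
  intros H E; apply (expands_ext n m F); trivial.
  apply ev_intro; reflexivity.
Qed.

Lemma expands_reg (f : pt4 -> R) : reg f -> expands 0 f f (fun _ => 0).
Proof.
  intros H; split; trivial; split; [apply reg_const|].
  exists (fun _ => 0); split; [apply reg_const|].
  apply ev_intro; intros; simpl; ring.
Qed.

Lemma expands_const (c : R) : expands 0 (fun _ => c) (fun _ => c) (fun _ => 0).
Proof. apply expands_reg, reg_const. Qed.

Lemma expands_radius (n : Z) :
  expands n (fun p => powerRZ (fst p) n) (fun _ => 1) (fun _ => 0).
Proof.
  split; [apply reg_const|split; [apply reg_const|]].
  exists (fun _ => 0); split; [apply reg_const|].
  apply ev_intro; intros; simpl; ring.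
Qed.

Lemma expands_plus (n n1 n2 : Z) (F G f0 f1 g0 g1 : pt4 -> R) :
  expands n1 F f0 f1 -> expands n2 G g0 g1 -> n1 = n -> n2 = n ->
  expands n (fun p => F p + G p) (fun p => f0 p + g0 p) (fun p => f1 p + g1 p).
Proof.
  intros [H0 [H1 [e [He E]]]] [G0 [G1 [e' [He' E']]]] -> ->.
  split; [now apply reg_plus|split; [now apply reg_plus|]].
  exists (fun p => e p + e' p); split; [now apply reg_plus|].
  generalize E E'; apply ev_mono2; intros r x _ _ -> ->; ring.
Qed.

Lemma expands_opp (n : Z) (F f0 f1 : pt4 -> R) :
  expands n F f0 f1 ->
  expands n (fun p => - F p) (fun p => - f0 p) (fun p => - f1 p).
Proof.
  intros [H0 [H1 [e [He E]]]].
  split; [now apply reg_opp|split; [now apply reg_opp|]].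
  exists (fun p => - e p); split; [now apply reg_opp|].
  revert E; apply ev_mono; intros r x _ _ ->; ring.
Qed.

Lemma expands_minus (n n1 n2 : Z) (F G f0 f1 g0 g1 : pt4 -> R) :
  expands n1 F f0 f1 -> expands n2 G g0 g1 -> n1 = n -> n2 = n ->
  expands n (fun p => F p - G p) (fun p => f0 p - g0 p) (fun p => f1 p - g1 p).
Proof.
  intros HF HG E1 E2.
  exact (expands_plus n n1 n2 _ _ _ _ _ _ HF (expands_opp _ _ _ _ HG) E1 E2).
Qed.

Lemma expands_mult (n1 n2 : Z) (F G f0 f1 g0 g1 : pt4 -> R) :
  expands n1 F f0 f1 -> expands n2 G g0 g1 ->
  expands (n1 + n2) (fun p => F p * G p) (fun p => f0 p * g0 p)
    (fun p => f0 p * g1 p + f1 p * g0 p).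
Proof.
  intros [H0 [H1 [e [He E]]]] [G0 [G1 [e' [He' E']]]].
  split; [now apply reg_mult|].
  split; [apply reg_plus; now apply reg_mult|].
  (* The products of relative order [rho^-2] and beyond; excess powers of [/ rho] stay as bounded
     factors. *)
  exists (fun p => f0 p * e' p + f1 p * g1 p + e p * g0 p +
    (f1 p * e' p + e p * g1 p) * / fst p + e p * e' p * / fst p * / fst p).
  split.
  { assert (I := reg_inv_radius).
    repeat first [assumption|apply reg_plus|apply reg_mult]. }
  generalize E E'; apply ev_mono2; intros r x _ Hr -> ->.
  rewrite powerRZ_add by (simpl; lra); simpl fst; ring.
Qed.

Lemma expands_sum (n : Z) (F f0 f1 : idx -> pt4 -> R) :
  (forall i, expands n (F i) (f0 i) (f1 i)) ->
  expands n (fun p => sum3 (fun i => F i p)) (fun p => sum3 (fun i => f0 i p))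
    (fun p => sum3 (fun i => f1 i p)).
Proof.
  intros H; unfold Sum; simpl.
  assert (Z0 : expands n (fun _ => 0) (fun _ => 0) (fun _ => 0)).
  { split; [apply reg_const|split; [apply reg_const|]].
    exists (fun _ => 0); split; [apply reg_const|].
    apply ev_intro; intros; ring. }
  repeat (eapply expands_plus; [apply H| |reflexivity|reflexivity]); exact Z0.
Qed.

Lemma expands_sp (n : Z) (F f0 f1 : pt4 -> R) (a : idx) :
  expands n F f0 f1 -> expands n (sp a F) (sp a f0) (sp a f1).
Proof.
  intros [H0 [H1 [e [He E]]]].
  split; [now apply reg_sp|split; [now apply reg_sp|]].
  exists (sp a e); split; [now apply reg_sp|].
  generalize (ev_sp_ext _ _ a E)
    (ev_and _ _ (reg_ex _ He) (ev_and _ _ (reg_ex _ H0) (reg_ex _ H1))).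
  apply ev_mono2; intros r x _ _ -> [A [A0 A1]].
  specialize (A a); specialize (A0 a); specialize (A1 a).
  unfold sp, pd4 in *; simpl in *.
  assert (A1' : ex_pd a (fun y => f1 (r, y) * / r) x)
    by (apply ex_pd_mult; [assumption|apply ex_pd_const]).
  assert (A' : ex_pd a (fun y => e (r, y) * / r) x)
    by (apply ex_pd_mult; [assumption|apply ex_pd_const]).
  assert (A'' : ex_pd a (fun y => e (r, y) * / r * / r) x)
    by (apply ex_pd_mult; [assumption|apply ex_pd_const]).
  rewrite pd_scal; f_equal.
  rewrite (pd_plus a (fun y => f0 (r, y) + f1 (r, y) * / r));
    [|now apply ex_pd_plus|assumption].
  rewrite pd_plus by assumption.
  rewrite (pd_mult a (fun y => e (r, y) * / r)) by (trivial; apply ex_pd_const).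
  rewrite 2!pd_mult by (trivial; apply ex_pd_const).
  rewrite pd_const; ring.
Qed.

Lemma bounded_below_expands (F f0 f1 : pt4 -> R) :
  expands 0 F f0 f1 -> bounded_below f0 -> bounded_below F.
Proof.
  intros [H0 [H1 [e [He E]]]] Hb x0 Hx.
  destruct (Hb x0 Hx) as [c [r1 [Hc L1]]].
  destruct (reg_bounded _ H1 x0 Hx) as [M1 [r2 L2]].
  destruct (reg_bounded _ He x0 Hx) as [M2 [r3 L3]].
  destruct (E x0 Hx) as [r4 L4].
  set (m := Rabs M1 + Rabs M2 + 1).
  assert (P1 := Rabs_pos M1); assert (P2 := Rabs_pos M2).
  (* Beyond [2 * m / c] the corrections, at most [m / r], do not exceed half of the lower bound [c]
     for [f0]. *)
  exists (c / 2), (Rmax (Rmax r1 r2) (Rmax (Rmax r3 r4) (Rmax 1 (2 * m / c)))).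
  split; [lra|].
  generalize (filter_and _ _ (filter_and _ _ L1 L2) (filter_and _ _ L3 L4)).
  apply filter_imp; intros x [[A1 A2] [A3 A4]] r Hr.
  apply Rmax_Rlt in Hr as [Hr Hr']; apply Rmax_Rlt in Hr as [Hr1 Hr2].
  apply Rmax_Rlt in Hr' as [Hr Hr']; apply Rmax_Rlt in Hr as [Hr3 Hr4].
  apply Rmax_Rlt in Hr' as [Hr5 Hr6].
  specialize (A1 r Hr1); specialize (A2 r Hr2); specialize (A3 r Hr3).
  rewrite (A4 r Hr4); simpl fst; rewrite powerRZ_O, Rmult_1_l.
  set (u := f1 (r, x) * / r + e (r, x) * / r * / r).
  assert (Hi : 0 < / r) by (apply Rinv_0_lt_compat; lra).
  assert (Hi1 : / r <= 1)
    by (rewrite <- Rinv_1; apply Rinv_le_contravar; lra).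
  assert (Hu : Rabs u <= m * / r).
  { unfold u; eapply Rle_trans; [apply Rabs_triang|].
    rewrite !Rabs_mult, (Rabs_pos_eq (/ r)) by lra.
    assert (B1 := Rle_abs M1); assert (B2 := Rle_abs M2).
    assert (C1 := Rabs_pos (f1 (r, x))); assert (C2 := Rabs_pos (e (r, x))).
    assert (Rabs (e (r, x)) * / r <= Rabs M2) by nra.
    unfold m; nra. }
  assert (Hm : m * / r <= c / 2).
  { apply (Rmult_le_reg_r r); [lra|].
    rewrite Rmult_assoc, Rinv_l, Rmult_1_r by lra.
    apply (Rmult_lt_compat_r (c / 2)) in Hr6; [|lra].
    replace (2 * m / c * (c / 2)) with m in Hr6 by (field; lra); lra. }
  replace (f0 (r, x) + f1 (r, x) * / r + e (r, x) * / r * / r)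
    with (f0 (r, x) + u) by (unfold u; ring).
  assert (T := Rabs_triang (f0 (r, x) + u) (- u)).
  replace (f0 (r, x) + u + - u) with (f0 (r, x)) in T by ring.
  rewrite Rabs_Ropp in T; lra.
Qed.

Lemma expands_shift (n m k : Z) (F f0 f1 : pt4 -> R) :
  expands n F f0 f1 -> m = (n + k)%Z ->
  expands m (fun p => F p * powerRZ (fst p) k) f0 f1.
Proof.
  intros H ->; apply (expands_ext _ _ _ _ _ _ _ _
    (expands_mult _ _ _ _ _ _ _ _ H (expands_radius k))); trivial;
    apply ev_intro; intros; ring.
Qed.

Lemma expands_inv0 (F f0 f1 : pt4 -> R) :
  expands 0 F f0 f1 -> bounded_below f0 ->
  expands 0 (fun p => / F p) (fun p => / f0 p)
    (fun p => - (f1 p * / f0 p * / f0 p)).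
Proof.
  intros H Hb; assert (HbF := bounded_below_expands _ _ _ H Hb).
  destruct H as [H0 [H1 [e [He E]]]].
  assert (I0 := reg_inv _ Hb H0).
  assert (HF : reg F).
  { assert (I := reg_inv_radius).
    apply (reg_ext (fun p => f0 p + f1 p * / fst p + e p * / fst p * / fst p)).
    - revert E; apply ev_mono; intros r x _ _ ->; simpl; ring.
    - repeat first [assumption|apply reg_plus|apply reg_mult]. }
  assert (IF := reg_inv _ HbF HF).
  split; trivial.
  split; [apply reg_opp; repeat apply reg_mult; trivial|].
  (* The exact remainder. Since [/ F] is kept as a factor, no geometric series is needed; the lower
     bound for [F] makes it regular. *)
  exists (fun p => (-1 * (f0 p * e p) + f1 p * f1 p + f1 p * e p * / fst p)
    * / F p * / f0 p * / f0 p).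
  split.
  { assert (I := reg_inv_radius); assert (C := reg_const (-1)).
    repeat first [assumption|apply reg_plus|apply reg_mult]. }
  generalize (ev_and _ _ (bounded_below_neq _ HbF) (bounded_below_neq _ Hb)) E.
  apply ev_mono2; intros r x _ Hr [N1 N2] EF; simpl fst in *.
  rewrite powerRZ_O, Rmult_1_l in EF |- *.
  assert (Hf : F (r, x) * r * r = f0 (r, x) * r * r + f1 (r, x) * r + e (r, x))
    by (rewrite EF; field; lra).
  assert (He' : e (r, x) = F (r, x) * r * r - f0 (r, x) * r * r - f1 (r, x) * r)
    by lra.
  rewrite He'; field; lra.
Qed.

Lemma expands_inv (n m : Z) (F f0 f1 : pt4 -> R) :
  expands n F f0 f1 -> bounded_below f0 -> m = (- n)%Z ->
  expands m (fun p => / F p) (fun p => / f0 p)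
    (fun p => - (f1 p * / f0 p * / f0 p)).
Proof.
  intros H Hb ->.
  assert (H' : expands 0 (fun p => F p * powerRZ (fst p) (- n)) f0 f1)
    by (apply (expands_shift n); [assumption|lia]).
  apply expands_inv0 in H'; trivial.
  apply (expands_shift 0 (- n) (- n)) in H'; [|lia].
  apply (expands_ext _ _ _ _ _ _ _ _ H'); trivial;
    apply ev_intro; trivial; intros r x _ Hr; simpl fst.
  rewrite Rinv_mult, Rmult_assoc, Rinv_l, Rmult_1_r; trivial.
  apply powerRZ_NOR; lra.
Qed.

(** Since coefficients may depend on [rho], the first-order ones are determined only up to
    [O(1/rho)], even when the leading ones agree. *)
Lemma expands_unique (n : Z) (F f0 f1 g1 : pt4 -> R) :
  expands n F f0 f1 -> expands n F f0 g1 ->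
  reg (fun p => (f1 p - g1 p) * fst p).
Proof.
  intros [H0 [H1 [e [He E]]]] [_ [G1 [e' [He' E']]]].
  apply (reg_ext (fun p => e' p - e p)); [|now apply reg_minus].
  generalize E E'; apply ev_mono2; intros r x _ Hr -> A; simpl fst in *.
  apply Rmult_eq_reg_l in A; [|apply powerRZ_NOR; lra].
  assert (P : / r <> 0) by (apply Rinv_neq_0_compat; lra).
  apply (Rmult_eq_reg_r (/ r)); trivial.
  apply (Rmult_eq_reg_r (/ r)); trivial.
  replace ((f1 (r, x) - g1 (r, x)) * r * / r * / r)
    with ((f1 (r, x) - g1 (r, x)) * / r) by (field; lra).
  lra.
Qed.

(** A change of [f1] by [O(1/rho)] can be absorbed in the remainder. With [expands_unique] this
    replaces a [rho]-dependent coefficient by its limit. *)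
Lemma expands_next (n : Z) (F f0 f1 g1 : pt4 -> R) :
  expands n F f0 f1 -> reg g1 -> reg (fun p => (f1 p - g1 p) * fst p) ->
  expands n F f0 g1.
Proof.
  intros [H0 [H1 [e [He E]]]] Hg Hd; split; trivial; split; trivial.
  exists (fun p => (f1 p - g1 p) * fst p + e p); split; [now apply reg_plus|].
  revert E; apply ev_mono; intros r x _ Hr ->; simpl fst; field; lra.
Qed.

Lemma expands_ex (n : Z) (F f0 f1 : pt4 -> R) :
  expands n F f0 f1 -> ev (fun p => forall a, ex_pd4 (Some a) F p).
Proof.
  intros [H0 [H1 [e [He E]]]].
  assert (HR : reg (fun p => f0 p + f1 p * / fst p + e p * / fst p * / fst p)).
  { assert (I := reg_inv_radius).
    repeat first [assumption|apply reg_plus|apply reg_mult]. }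
  generalize (ev_locally _ E) (reg_ex _ HR); apply ev_mono2.
  intros r x _ _ L A a; specialize (A a); unfold ex_pd4 in *; cbn [fst snd] in *.
  apply (ex_pd_ext_loc a (fun y => powerRZ r n * (f0 (r, y)
    + f1 (r, y) * / r + e (r, y) * / r * / r))).
  - revert L; apply filter_imp; intros y Hy; symmetry; exact Hy.
  - apply ex_pd_mult; [apply ex_pd_const|exact A].
Qed.

Lemma expands_poly (f0 f1 : pt4 -> R) :
  reg f0 -> reg f1 ->
  expands (-1) (fun p => / fst p * (f0 p + f1 p * / fst p)) f0 f1.
Proof.
  intros H0 H1; split; trivial; split; trivial.
  exists (fun _ => 0); split; [apply reg_const|].
  apply ev_intro; intros r x _ Hr; simpl; field; lra.
Qed.

(** * From differentiable O-estimates to regular functions *)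

Lemma asympO_pd4 (n : Z) (f : pt4 -> R) (i : idx4) :
  asympO n f ->
  asympO (match i with None => n - 1 | _ => n end) (pd4 i f).
Proof.
  (* The last entry of the list is differentiated first, so [pd4 i] is absorbed by appending [i]. *)
  intros H l; destruct (H (l ++ [i])) as [H1 H2].
  rewrite fold_right_app in H1, H2; simpl in H1, H2; split; trivial.
  assert (E : rho_count (l ++ [i]) = (rho_count l + rho_count [i])%nat)
    by (unfold rho_count; now rewrite filter_app, length_app).
  rewrite E in H2; revert H2; destruct i; cbn [rho_count filter length];
    [replace (n - _)%Z with (n - Z.of_nat (rho_count l))%Z by lia
    |replace (n - _)%Z with (n - 1 - Z.of_nat (rho_count l))%Z by lia]; trivial.
Qed.

Lemma asympO_reg (n : Z) (f : pt4 -> R) :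
  asympO n f -> reg (fun p => powerRZ (fst p) (- n) * f p).
Proof.
  intros H N; revert f H; induction N as [|N IH]; intros f H; simpl;
    destruct (H []) as [H1 H2]; simpl in H1, H2.
  all: assert (Hb : bounded (fun p => powerRZ (fst p) (- n) * f p)) by
   (intros x0 Hx; destruct (H2 x0 Hx) as [M [R0 L]]; exists M, (Rmax R0 1);
    revert L; apply filter_imp; intros x A r Hr; simpl;
    apply Rmax_Rlt in Hr as [Hr1 Hr2]; specialize (A r Hr1);
    rewrite Z.sub_0_r in A;
    assert (P : 0 < powerRZ r (- n)) by (apply powerRZ_lt; lra);
    rewrite Rabs_mult, (Rabs_pos_eq (powerRZ _ _)) by lra;
    apply (Rmult_le_compat_l (powerRZ r (- n))) in A; [|lra];
    replace (powerRZ r (- n) * (M * powerRZ r n)) with M in A; trivial;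
    rewrite (Rmult_comm M), <- Rmult_assoc, <- powerRZ_add by lra;
    rewrite Z.add_opp_diag_l; simpl; ring).
  all: assert (Hc : ev (fun p => continuous
    (fun x => powerRZ (fst p) (- n) * f (fst p, x)) (snd p))) by
   (revert H1; apply ev_mono; simpl; intros r x _ _ [_ A];
    apply (continuous_mult (fun _ => powerRZ r (- n)) (fun x => f (r, x)));
    [apply continuous_const|];
    apply (continuous_comp_2 (fun _ => r) (fun x => x) (fun r x => f (r, x)));
    [apply continuous_const|apply continuous_id|];
    revert A; apply continuous_ext; intros [? ?]; reflexivity).
  - auto.
  - repeat split; trivial.
    + revert H1; apply ev_mono; intros r x _ _ [A _] a.
      apply ex_pd_mult; [apply ex_pd_const|apply (A (Some a))].
    + intros a; apply (regN_ext N (fun p => powerRZ (fst p) (- n) * sp a f p)).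
      * apply ev_intro; intros r x _ _; symmetry.
        exact (pd_scal a (powerRZ r (- n)) (fun y => f (r, y)) x).
      * apply IH, (asympO_pd4 n f (Some a) H).
Qed.

(** * The unit de Sitter metric *)

Lemma continuous_coordinate (a : idx) (x : pt) :
  continuous (fun y : pt => y a) x.
Proof. intros P [e He]; exists e; intros y Hy; apply He, (Hy a). Qed.

(** [K] indexes a family of functions closed under differentiation, with [nxt] the action of the
    derivative on indices, so one induction covers all orders. It is applied to coefficient pairs
    for the spans of [cosh], [sinh] and of [cos], [sin]. *)
Lemma reg0_coordinate (K : Type) (u : K -> R -> R) (nxt : K -> K) (a : idx)
    (k : K) :
  (forall k t, is_derive (u k) t (u (nxt k) t)) -> reg0 (fun x => u k (x a)).
Proof.
  intros H N; revert k; induction N as [|N IH]; intros k; simpl.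
  all: assert (C : forall x : pt, continuous (fun x => u k (x a)) x) by
   (intros x; apply (continuous_comp (fun x : pt => x a) (u k));
    [apply continuous_coordinate
    |apply (ex_derive_continuous (u k)); eexists; apply H]).
  all: assert (Hb : bounded (fun p => u k (snd p a))) by
   (intros x0 Hx; exists (Rabs (u k (x0 a)) + 1), 0;
    generalize (continuous_locally_bounded _ x0 (C x0));
    apply filter_imp; intros x A r _; simpl;
    replace (u k (x a)) with ((u k (x a) - u k (x0 a)) + u k (x0 a)) by ring;
    eapply Rle_trans; [apply Rabs_triang|lra]).
  all: assert (Hc : ev (fun p => continuous (fun x : pt => u k (x a)) (snd p)))
    by (apply ev_intro; intros; apply C).
  - auto.
  - repeat split; trivial.
    + apply ev_intro; intros r x _ _ b; unfold ex_pd4, ex_pd; simpl.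
      destruct (idx_eq_dec b a) as [<-|n].
      * apply (ex_derive_ext (u k)); [intros t; now rewrite upd_at|].
        eexists; apply H.
      * apply (ex_derive_ext (fun _ => u k (x a))).
        -- intros t; now rewrite upd_other.
        -- apply ex_derive_const.
    + intros b; destruct (idx_eq_dec b a) as [<-|n].
      * apply (regN_ext N (fun p => u (nxt k) (snd p b))); [|apply IH].
        apply ev_intro; intros r x _ _; unfold sp, pd4, pd; simpl.
        symmetry; apply is_derive_unique.
        apply (is_derive_ext (u k)); [intros t; now rewrite upd_at|apply H].
      * apply (regN_ext N (fun _ => 0)); [|apply reg_const].
        apply ev_intro; intros r x _ _; unfold sp, pd4, pd; simpl.
        symmetry; rewrite <- (Derive_const (u k (x a)) (x b)).
        apply Derive_ext; intros t; now rewrite upd_other.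
Qed.

Lemma is_derive_cosh (t : R) : is_derive cosh t (sinh t).
Proof. apply is_derive_Reals, derivable_pt_lim_cosh. Qed.

Lemma is_derive_sinh (t : R) : is_derive sinh t (cosh t).
Proof. apply is_derive_Reals, derivable_pt_lim_sinh. Qed.

Lemma reg0_cosh_sinh (a : idx) (u v : R) :
  reg0 (fun x => u * cosh (x a) + v * sinh (x a)).
Proof.
  apply (reg0_coordinate (R * R) (fun k t => fst k * cosh t + snd k * sinh t)
    (fun k => (snd k, fst k)) a (u, v)); intros [k l] t; simpl.
  apply (is_derive_ext (fun t => k * cosh t + l * sinh t)); trivial.
  replace (l * cosh t + k * sinh t) with (k * sinh t + l * cosh t) by ring.
  apply (is_derive_plus (fun t => k * cosh t) (fun t => l * sinh t)).
  - apply is_derive_scal, is_derive_cosh.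
  - apply is_derive_scal, is_derive_sinh.
Qed.

Lemma reg0_cos_sin (a : idx) (u v : R) :
  reg0 (fun x => u * cos (x a) + v * sin (x a)).
Proof.
  apply (reg0_coordinate (R * R) (fun k t => fst k * cos t + snd k * sin t)
    (fun k => (snd k, - fst k)) a (u, v)); intros [k l] t; simpl.
  auto_derive; trivial; ring.
Qed.

Lemma reg0_cosh (a : idx) : reg0 (fun x => cosh (x a)).
Proof. apply (reg0_ext (fun x => 1 * cosh (x a) + 0 * sinh (x a)));
  [intros; ring|apply reg0_cosh_sinh]. Qed.
Lemma reg0_sinh (a : idx) : reg0 (fun x => sinh (x a)).
Proof. apply (reg0_ext (fun x => 0 * cosh (x a) + 1 * sinh (x a)));
  [intros; ring|apply reg0_cosh_sinh]. Qed.
Lemma reg0_cos (a : idx) : reg0 (fun x => cos (x a)).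
Proof. apply (reg0_ext (fun x => 1 * cos (x a) + 0 * sin (x a)));
  [intros; ring|apply reg0_cos_sin]. Qed.
Lemma reg0_sin (a : idx) : reg0 (fun x => sin (x a)).
Proof. apply (reg0_ext (fun x => 0 * cos (x a) + 1 * sin (x a)));
  [intros; ring|apply reg0_cos_sin]. Qed.

Lemma cosh_neq (t : R) : cosh t <> 0.
Proof. unfold cosh; generalize (exp_pos t) (exp_pos (- t)); lra. Qed.

Lemma cosh_sqr (t : R) : cosh t * cosh t = 1 + sinh t * sinh t.
Proof.
  unfold cosh, sinh; assert (E := exp_plus t (- t)).
  rewrite Rplus_opp_r, exp_0 in E; nra.
Qed.

Lemma chart_sin_neq (x : pt) : chart x -> sin (x theta) <> 0.
Proof. intros [[H1 H2] _]; generalize (sin_gt_0 _ H1 H2); lra. Qed.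

(** Closed form of [inv h0], as [Gam] is of the Christoffel symbols. Reciprocals appear as products
    of [/ cosh] and [/ sin], the shape on which [smooth0] and [pd_calc] act. *)
Definition ginv : ten2 pt := fun a b x =>
  match a, b with
  | tau, tau => - 1
  | theta, theta => / cosh (x tau) * / cosh (x tau)
  | phi, phi => / cosh (x tau) * / cosh (x tau) *
                (/ sin (x theta) * / sin (x theta))
  | _, _ => 0
  end.

Definition Gam (c a b : idx) (x : pt) : R :=
  match c, a, b with
  | tau, theta, theta => cosh (x tau) * sinh (x tau)
  | tau, phi, phi =>
      cosh (x tau) * sinh (x tau) * (sin (x theta) * sin (x theta))
  | theta, tau, theta | theta, theta, tau
  | phi, tau, phi | phi, phi, tau => sinh (x tau) * / cosh (x tau)
  | theta, phi, phi => - (sin (x theta) * cos (x theta))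
  | phi, theta, phi | phi, phi, theta => cos (x theta) * / sin (x theta)
  | _, _, _ => 0
  end.

Lemma det_h0 (x : pt) : det h0 x = - cosh (x tau) ^ 4 * sin (x theta) ^ 2.
Proof. unfold det, cofactor, Sum; simpl; ring. Qed.

Lemma inv_h0 (a b : idx) (x : pt) : chart x -> inv h0 a b x = ginv a b x.
Proof.
  intros Hx; assert (H1 := cosh_neq (x tau)); assert (H2 := chart_sin_neq x Hx).
  unfold inv; rewrite det_h0; unfold cofactor, ginv.
  destruct a, b; simpl; field; auto.
Qed.

Ltac smooth0 :=
  repeat match goal with
  | H : reg0 ?f |- reg0 ?f => exact H
  | H : forall _, reg0 _ |- reg0 _ => apply H
  | |- reg0 (fun _ => _ + _) => apply reg0_plus
  | |- reg0 (fun _ => _ - _) => apply reg0_minus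
  | |- reg0 (fun _ => _ * _) => apply reg0_mult
  | |- reg0 (fun _ => - _) => apply reg0_opp
  | |- reg0 (fun _ => cosh _) => apply reg0_cosh
  | |- reg0 (fun _ => sinh _) => apply reg0_sinh
  | |- reg0 (fun _ => cos _) => apply reg0_cos
  | |- reg0 (fun _ => sin _) => apply reg0_sin
  | |- reg0 (fun _ => / cosh _) =>
      apply (reg0_inv (fun x => cosh (x _))); [|intros; apply cosh_neq]
  | |- reg0 (fun _ => / sin _) =>
      apply (reg0_inv (fun x => sin (x _))); [|intros; now apply chart_sin_neq]
  | |- reg0 (fun _ => ?c) => apply (reg0_const c)
  end.

Lemma reg0_h0 (a b : idx) : reg0 (h0 a b).
Proof.
  destruct a, b; unfold h0; simpl; smooth0.
Qed.

Lemma reg0_ginv (a b : idx) : reg0 (ginv a b).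
Proof. destruct a, b; unfold ginv; smooth0. Qed.

Lemma reg0_Gam (c a b : idx) : reg0 (Gam c a b).
Proof. destruct c, a, b; unfold Gam; smooth0. Qed.

Lemma Gam_sym (c a b : idx) (x : pt) : Gam c a b x = Gam c b a x.
Proof. destruct c, a, b; reflexivity. Qed.

Lemma h0_sym (a b : idx) (x : pt) : h0 a b x = h0 b a x.
Proof. destruct a, b; reflexivity. Qed.

Lemma ginv_sym (a b : idx) (x : pt) : ginv a b x = ginv b a x.
Proof. destruct a, b; reflexivity. Qed.

Lemma pd_coordinate (a b : idx) (u : R -> R) (l : R) (x : pt) :
  is_derive u (x b) l ->
  pd a (fun y => u (y b)) x = if idx_eq_dec a b then l else 0.
Proof.
  intros H; unfold pd; destruct (idx_eq_dec a b) as [->|n].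
  - apply is_derive_unique, (is_derive_ext u); trivial.
    intros t; now rewrite upd_at.
  - rewrite <- (Derive_const (u (x b)) (x a)).
    apply Derive_ext; intros t; now rewrite upd_other.
Qed.

Lemma pd_cosh (a b : idx) (x : pt) :
  pd a (fun y => cosh (y b)) x = if idx_eq_dec a b then sinh (x b) else 0.
Proof. apply pd_coordinate, is_derive_cosh. Qed.
Lemma pd_sinh (a b : idx) (x : pt) :
  pd a (fun y => sinh (y b)) x = if idx_eq_dec a b then cosh (x b) else 0.
Proof. apply pd_coordinate, is_derive_sinh. Qed.
Lemma pd_cos (a b : idx) (x : pt) :
  pd a (fun y => cos (y b)) x = if idx_eq_dec a b then - sin (x b) else 0.
Proof. apply pd_coordinate, is_derive_Reals, derivable_pt_lim_cos. Qed.
Lemma pd_sin (a b : idx) (x : pt) :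
  pd a (fun y => sin (y b)) x = if idx_eq_dec a b then cos (x b) else 0.
Proof. apply pd_coordinate, is_derive_Reals, derivable_pt_lim_sin. Qed.

Lemma pd_opp (a : idx) (f : pt -> R) (x : pt) :
  pd a (fun y => - f y) x = - pd a f x.
Proof. unfold pd; apply Derive_opp. Qed.

Lemma pd_minus (a : idx) (f g : pt -> R) (x : pt) :
  ex_pd a f x -> ex_pd a g x ->
  pd a (fun y => f y - g y) x = pd a f x - pd a g x.
Proof. intros; unfold pd; now apply Derive_minus. Qed.

Lemma pd_inv_cosh (a : idx) (x : pt) : chart x ->
  pd a (fun y => / cosh (y tau)) x =
  - ((if idx_eq_dec a tau then sinh (x tau) else 0)
     * / cosh (x tau) * / cosh (x tau)).
Proof.
  intros Hx; rewrite pd_inv, pd_cosh; trivial; [|apply cosh_neq].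
  apply reg0_ex; trivial; apply reg0_cosh.
Qed.

Lemma pd_inv_sin (a : idx) (x : pt) : chart x ->
  pd a (fun y => / sin (y theta)) x =
  - ((if idx_eq_dec a theta then cos (x theta) else 0)
     * / sin (x theta) * / sin (x theta)).
Proof.
  intros Hx; rewrite pd_inv, pd_sin; trivial; [|now apply chart_sin_neq].
  apply reg0_ex; trivial; apply reg0_sin.
Qed.

Ltac expd := match goal with H : chart ?x |- ex_pd ?a ?f ?x =>
  apply (reg0_ex f a x); [smooth0|exact H] end.

Ltac pd_calc Hx :=
  repeat first
    [ rewrite (pd_const _ _ _)
    | rewrite pd_plus by expd | rewrite pd_minus by expd
    | rewrite pd_mult by expd | rewrite pd_opp
    | rewrite (pd_inv_cosh _ _ Hx) | rewrite (pd_inv_sin _ _ Hx)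
    | rewrite pd_cosh | rewrite pd_sinh | rewrite pd_cos | rewrite pd_sin ].

(** The four functions become indeterminates subject to the two Pythagorean relations, solved for
    the squares of [cosh] and [cos]; [field] then decides modulo these. *)
Ltac trig_field x Hx :=
  let H1 := fresh in let H2 := fresh in let H3 := fresh in let H4 := fresh in
  assert (H1 := cosh_neq (x tau)); assert (H2 := chart_sin_neq x Hx);
  assert (H3 := cosh_sqr (x tau)); assert (H4 := sin2_cos2 (x theta));
  unfold Rsqr in H4;
  assert (cos (x theta) * cos (x theta) = 1 - sin (x theta) * sin (x theta))
    by lra; clear H4;
  revert H1 H2 H3; 
  match goal with H4 : _ = 1 - _ |- _ => revert H4 end;
  generalize (cosh (x tau)) (sinh (x tau)) (sin (x theta)) (cos (x theta));
  let C := fresh in let S := fresh in let s := fresh in let c := fresh in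
  let E1 := fresh in let E2 := fresh in
  intros C S s c E1 ? ? E2; field [E1 E2]; auto.

(** Metric compatibility, read as a rule that trades coordinate derivatives of the metric for
    Christoffel symbols. *)
Lemma pd_h0 (c a b : idx) (x : pt) : chart x ->
  pd c (h0 a b) x =
  sum3 (fun e => Gam e c a x * h0 e b x + Gam e c b x * h0 a e x).
Proof.
  intros Hx; unfold Sum; simpl fold_right; unfold h0; destruct a, b; simpl pow;
    pd_calc Hx; destruct c; cbn -[cosh sinh sin cos]; trig_field x Hx.
Qed.

Lemma pd_ginv (c a b : idx) (x : pt) : chart x ->
  pd c (ginv a b) x =
  - sum3 (fun e => Gam a c e x * ginv e b x + Gam b c e x * ginv a e x).
Proof.
  intros Hx; unfold Sum; simpl fold_right; unfold ginv; destruct a, b;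
    pd_calc Hx; destruct c; cbn -[cosh sinh sin cos]; trig_field x Hx.
Qed.

Lemma christoffel_h0 (c a b : idx) (x : pt) : chart x ->
  christoffel idxs pd h0 (inv h0) c a b x = Gam c a b x.
Proof.
  intros Hx; unfold christoffel, Sum; simpl fold_right.
  rewrite !inv_h0, !pd_h0 by trivial; unfold Sum; simpl fold_right.
  destruct c, a, b; cbn -[cosh sinh sin cos]; trig_field x Hx.
Qed.

(** Constant curvature one, [R^e_{cab} = delta^e_a h_bc - delta^e_b h_ac], solved for one derivative
    of [Gam] so that commutators of covariant derivatives can be simplified by rewriting. *)
Lemma riemann_h0 (e c a b : idx) (x : pt) : chart x ->
  pd a (Gam e b c) x = pd b (Gam e a c) x
    - sum3 (fun f => Gam e a f x * Gam f b c x - Gam e b f x * Gam f a c x)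
    + delta e a * h0 b c x - delta e b * h0 a c x.
Proof.
  intros Hx; unfold Sum; simpl fold_right; unfold delta; destruct e, c, a, b;
    unfold Gam at 1 2; pd_calc Hx; cbn -[cosh sinh sin cos]; trig_field x Hx.
Qed.

(** * Covariant derivatives on dS_3 *)

Definition regT (T : @tensor pt idx) : Prop := forall l, reg0 (T l).

Lemma sum3E (f : idx -> R) : sum3 f = f tau + f theta + f phi.
Proof. unfold Sum; simpl; ring. Qed.

Lemma Sum_ext {I : Type} (en : list I) (f g : I -> R) :
  (forall i, f i = g i) -> Sum en f = Sum en g.
Proof. intros H; induction en; simpl; congruence. Qed.

Lemma Sum_plus {I : Type} (en : list I) (f g : I -> R) :
  Sum en (fun i => f i + g i) = Sum en f + Sum en g.
Proof. induction en as [|i en IH]; simpl; [|rewrite IH]; ring. Qed.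

Lemma Sum_scal {I : Type} (en : list I) (c : R) (f : I -> R) :
  Sum en (fun i => c * f i) = c * Sum en f.
Proof. induction en as [|i en IH]; simpl; [|rewrite IH]; ring. Qed.

Lemma Sum_comm {I J : Type} (en : list I) (em : list J) (f : I -> J -> R) :
  Sum en (fun i => Sum em (f i)) = Sum em (fun j => Sum en (fun i => f i j)).
Proof.
  induction en as [|i en IH]; simpl; [|now rewrite Sum_plus, IH].
  induction em; simpl; lra.
Qed.

Lemma cd0_1 (T : @tensor pt idx) (c a : idx) (x : pt) : chart x ->
  cd0 T [c; a] x = pd c (T [a]) x - sum3 (fun e => Gam e c a x * T [e] x).
Proof.
  intros Hx; unfold cd0, covd, connection_terms; rewrite Rplus_0_r.
  f_equal; apply Sum_ext; intros e; now rewrite christoffel_h0.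
Qed.

Lemma cd0_2 (T : @tensor pt idx) (c a b : idx) (x : pt) : chart x ->
  cd0 T [c; a; b] x = pd c (T [a; b]) x
    - sum3 (fun e => Gam e c a x * T [e; b] x)
    - sum3 (fun e => Gam e c b x * T [a; e] x).
Proof.
  intros Hx; unfold cd0, covd, connection_terms; rewrite Rplus_0_r.
  rewrite ?sum3E; rewrite !christoffel_h0 by trivial; ring.
Qed.

Lemma cd0_3 (T : @tensor pt idx) (c a b d : idx) (x : pt) : chart x ->
  cd0 T [c; a; b; d] x = pd c (T [a; b; d]) x
    - sum3 (fun e => Gam e c a x * T [e; b; d] x)
    - sum3 (fun e => Gam e c b x * T [a; e; d] x)
    - sum3 (fun e => Gam e c d x * T [a; b; e] x).
Proof.
  intros Hx; unfold cd0, covd, connection_terms; rewrite Rplus_0_r.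
  rewrite ?sum3E; rewrite !christoffel_h0 by trivial; ring.
Qed.

Lemma cd0_scalar (T : @tensor pt idx) (c : idx) (x : pt) :
  cd0 T [c] x = pd c (T []) x.
Proof. unfold cd0, covd; simpl; ring. Qed.

Lemma reg0_connection_terms (c : idx) (T : list idx -> pt -> R) (l : list idx) :
  (forall m, reg0 (T m)) ->
  reg0 (fun x => connection_terms idxs pd h0 (inv h0) c (fun n => T n x) x l).
Proof.
  revert T; induction l as [|a l IH]; intros T H; cbn [connection_terms].
  - apply reg0_const.
  - apply reg0_plus; [|apply (IH (fun n => T (a :: n))); auto].
    apply reg0_sum; intros e; apply reg0_mult; trivial.
    apply (reg0_ext (Gam e c a)); [|apply reg0_Gam].
    intros; now rewrite christoffel_h0.
Qed.

Lemma regT_cd0 (T : @tensor pt idx) : regT T -> regT (cd0 T).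
Proof.
  intros H [|c m]; [apply reg0_const|].
  apply (reg0_minus (pd c (T m)) (fun x =>
    connection_terms idxs pd h0 (inv h0) c (fun n => T n x) x m)).
  - apply reg0_pd, H.
  - now apply reg0_connection_terms.
Qed.

Ltac exr := match goal with H : chart ?x |- ex_pd ?a ?f ?x =>
  apply (reg0_ex f a x); [|exact H];
  repeat first
  [ assumption
  | match goal with H : regT ?T |- reg0 (?T _) => apply H end
  | match goal with |- reg0 (pd ?c (?f ?y)) => apply (reg0_pd (f y) c) end
  | match goal with |- reg0 (fun y => pd _ _ y) => apply reg0_pd end
  | match goal with |- reg0 (fun y => cd0 _ _ y) => apply regT_cd0 end
  | apply reg0_Gam | apply reg0_ginv | apply reg0_h0
  | apply reg0_plus | apply reg0_minus | apply reg0_mult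
  | apply reg0_opp | apply reg0_const ] end.

Lemma pd_cd0_1 (T : @tensor pt idx) (d c a : idx) (x : pt) :
  regT T -> chart x ->
  pd d (cd0 T [c; a]) x = pd d (pd c (T [a])) x
    - sum3 (fun e => pd d (Gam e c a) x * T [e] x + Gam e c a x * pd d (T [e]) x).
Proof.
  intros HT Hx.
  assert (E : forall y, chart y -> cd0 T [c; a] y = pd c (T [a]) y
    - (Gam tau c a y * T [tau] y + Gam theta c a y * T [theta] y
       + Gam phi c a y * T [phi] y))
    by (intros; now rewrite cd0_1, sum3E).
  rewrite (pd_ext_chart d _ _ x Hx E), sum3E.
  repeat (first [rewrite pd_minus by exr | rewrite pd_plus by exr
    | rewrite pd_mult by exr | rewrite pd_const]); ring.
Qed.

Lemma pd_cd0_2 (T : @tensor pt idx) (d c a b : idx) (x : pt) :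
  regT T -> chart x ->
  pd d (cd0 T [c; a; b]) x = pd d (pd c (T [a; b])) x
    - sum3 (fun e => pd d (Gam e c a) x * T [e; b] x
                     + Gam e c a x * pd d (T [e; b]) x)
    - sum3 (fun e => pd d (Gam e c b) x * T [a; e] x
                     + Gam e c b x * pd d (T [a; e]) x).
Proof.
  intros HT Hx.
  assert (E : forall y, chart y -> cd0 T [c; a; b] y = pd c (T [a; b]) y
    - (Gam tau c a y * T [tau; b] y + Gam theta c a y * T [theta; b] y
       + Gam phi c a y * T [phi; b] y)
    - (Gam tau c b y * T [a; tau] y + Gam theta c b y * T [a; theta] y
       + Gam phi c b y * T [a; phi] y))
    by (intros; now rewrite cd0_2, !sum3E).
  rewrite (pd_ext_chart d _ _ x Hx E), !sum3E.
  repeat (first [rewrite pd_minus by exr | rewrite pd_plus by exr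
    | rewrite pd_mult by exr | rewrite pd_const]); ring.
Qed.

Lemma cd0_commute_1 (T : @tensor pt idx) (d c a : idx) (x : pt) :
  regT T -> chart x ->
  cd0 (cd0 T) [d; c; a] x = cd0 (cd0 T) [c; d; a] x
    + h0 d a x * T [c] x - h0 c a x * T [d] x.
Proof.
  intros HT Hx.
  rewrite !cd0_2, !pd_cd0_1 by trivial.
  rewrite (pd_comm _ d c) by (trivial; apply HT).
  rewrite ?sum3E.
  rewrite !cd0_1 by trivial.
  rewrite !(riemann_h0 _ a d c) by trivial; rewrite ?sum3E.
  rewrite !(Gam_sym _ d c), (h0_sym c a), (h0_sym d a).
  unfold delta; destruct d, c; simpl; ring.
Qed.

(** The Ricci identity: each of the two tensor slots contributes a pair of curvature terms, which
    constant curvature reduces to products with [h0]. *)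
Lemma cd0_commute_2 (T : @tensor pt idx) (d c a b : idx) (x : pt) :
  regT T -> chart x ->
  cd0 (cd0 T) [d; c; a; b] x = cd0 (cd0 T) [c; d; a; b] x
    + h0 d a x * T [c; b] x - h0 c a x * T [d; b] x
    + h0 d b x * T [a; c] x - h0 c b x * T [a; d] x.
Proof.
  intros HT Hx.
  rewrite !cd0_3, !pd_cd0_2 by trivial.
  rewrite (pd_comm _ d c) by (trivial; apply HT).
  rewrite ?sum3E.
  rewrite !cd0_2 by trivial.
  rewrite !(riemann_h0 _ a d c), !(riemann_h0 _ b d c) by trivial.
  rewrite ?sum3E.
  rewrite !(Gam_sym _ d c), (h0_sym c a), (h0_sym d a), (h0_sym c b), (h0_sym d b).
  unfold delta; destruct d, c; simpl; ring.
Qed.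


Lemma pd_sum3 (c : idx) (F : idx -> pt -> R) (x : pt) :
  (forall i, reg0 (F i)) -> chart x ->
  pd c (fun y => sum3 (fun i => F i y)) x = sum3 (fun i => pd c (F i) x).
Proof.
  intros H Hx; unfold Sum, idxs; simpl.
  rewrite (pd_plus c (F tau) (fun y => F theta y + (F phi y + 0))).
  rewrite (pd_plus c (F theta) (fun y => F phi y + 0)).
  rewrite (pd_plus c (F phi) (fun y => 0)), pd_const; trivial.
  all: apply reg0_ex; trivial;
    repeat first [apply H | apply reg0_const | apply reg0_plus].
Qed.

(** The derivatives of [ginv] supply exactly the connection terms of the contracted slots. *)
Lemma cd0_contract_0 (T : @tensor pt idx) (c : idx) (x : pt) :
  regT T -> chart x ->
  pd c (fun y => sum3 (fun a => sum3 (fun b => ginv a b y * T [a; b] y))) x =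
  sum3 (fun a => sum3 (fun b => ginv a b x * cd0 T [c; a; b] x)).
Proof.
  intros HT Hx.
  assert (HR : forall a b, reg0 (fun y => ginv a b y * T [a; b] y)).
  { intros; apply reg0_mult; [apply reg0_ginv|apply HT]. }
  rewrite (pd_sum3 c (fun a y => sum3 (fun b => ginv a b y * T [a; b] y)));
    trivial; [|intros; now apply reg0_sum].
  assert (E : forall a, pd c (fun y => sum3 (fun b => ginv a b y * T [a; b] y)) x
    = sum3 (fun b => - sum3 (fun e => Gam a c e x * ginv e b x
         + Gam b c e x * ginv a e x) * T [a; b] x
         + ginv a b x * pd c (T [a; b]) x)).
  { intros a; rewrite (pd_sum3 c (fun b y => ginv a b y * T [a; b] y)) by auto.
    apply Sum_ext; intros b; rewrite pd_mult by exr; now rewrite pd_ginv. }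
  rewrite !sum3E, !E, !cd0_2, !sum3E by trivial; ring.
Qed.

Lemma ten2_tensor_at {P : Type} (k : ten2 P) (a b : idx) :
  ten2_tensor k [a; b] = k a b.
Proof. reflexivity. Qed.

Lemma scalar_tensor_at {P : Type} (f : P -> R) : scalar_tensor f [] = f.
Proof. reflexivity. Qed.

Ltac unten := rewrite ?sum3E, ?ten2_tensor_at, ?scalar_tensor_at; cbv beta.

Lemma cd0_contract_1 (T : @tensor pt idx) (c d : idx) (x : pt) :
  regT T -> chart x ->
  sum3 (fun a => sum3 (fun b => ginv a b x * cd0 T [c; a; b; d] x)) =
  pd c (fun y => sum3 (fun a => sum3 (fun b => ginv a b y * T [a; b; d] y))) x
  - sum3 (fun e => Gam e c d x *
      sum3 (fun a => sum3 (fun b => ginv a b x * T [a; b; e] x))).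
Proof.
  intros HT Hx.
  assert (HR : forall a b, reg0 (fun y => ginv a b y * T [a; b; d] y)).
  { intros; apply reg0_mult; [apply reg0_ginv|apply HT]. }
  rewrite (pd_sum3 c (fun a y => sum3 (fun b => ginv a b y * T [a; b; d] y)));
    trivial; [|intros; now apply reg0_sum].
  assert (E : forall a,
    pd c (fun y => sum3 (fun b => ginv a b y * T [a; b; d] y)) x
    = sum3 (fun b => - sum3 (fun e => Gam a c e x * ginv e b x
         + Gam b c e x * ginv a e x) * T [a; b; d] x
         + ginv a b x * pd c (T [a; b; d]) x)).
  { intros a.
    rewrite (pd_sum3 c (fun b y => ginv a b y * T [a; b; d] y)) by auto.
    apply Sum_ext; intros b; rewrite pd_mult by exr; now rewrite pd_ginv. }
  rewrite !sum3E, !E, !cd0_3, !sum3E by trivial; ring.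
Qed.

Lemma cd0_ext_2 (T U : @tensor pt idx) (c a b : idx) (x : pt) :
  (forall a b y, chart y -> T [a; b] y = U [a; b] y) -> chart x ->
  cd0 T [c; a; b] x = cd0 U [c; a; b] x.
Proof.
  intros H Hx; rewrite !cd0_2, !sum3E, !H by trivial.
  now rewrite (pd_ext_chart c _ _ x Hx (H a b)).
Qed.

Lemma cd0_ext_3 (T U : @tensor pt idx) (c a b d : idx) (x : pt) :
  (forall a b d y, chart y -> T [a; b; d] y = U [a; b; d] y) -> chart x ->
  cd0 T [c; a; b; d] x = cd0 U [c; a; b; d] x.
Proof.
  intros H Hx; rewrite !cd0_3, !sum3E, !H by trivial.
  now rewrite (pd_ext_chart c _ _ x Hx (H a b d)).
Qed.

Lemma regT_ten2 (k : ten2 pt) : (forall a b, reg0 (k a b)) -> regT (ten2_tensor k).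
Proof.
  intros H [|a [|b [|c l]]]; unfold ten2_tensor; try apply (reg0_const 0).
  apply (H a b).
Qed.

Lemma regT_scalar (f : pt -> R) : reg0 f -> regT (scalar_tensor f).
Proof. intros H [|a l]; [exact H|apply (reg0_const 0)]. Qed.

Definition trace_free (k : ten2 pt) : Prop := forall x, chart x ->
  sum3 (fun a => sum3 (fun b => ginv a b x * k a b x)) = 0.

Definition div_free (k : ten2 pt) : Prop := forall x d, chart x ->
  sum3 (fun a => sum3 (fun b =>
    ginv a b x * cd0 (ten2_tensor k) [a; b; d] x)) = 0.

Definition symmetric (k : ten2 pt) : Prop := forall a b x, chart x ->
  k a b x = k b a x.

(** [X] stands for the second derivatives and stays abstract, so that only algebra in the metric and
    [k] remains. In dimension three the trace of the curvature terms is [3 k - h0 tr k]. *)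
Lemma contract_curvature (k : ten2 pt) (a b : idx) (x : pt) (X : idx -> idx -> R) :
  symmetric k -> chart x ->
  sum3 (fun c => sum3 (fun d => ginv c d x *
    (X c d + h0 c d x * k a b x - h0 a d x * k c b x
     + h0 c b x * k d a x - h0 a b x * k d c x))) =
  sum3 (fun c => sum3 (fun d => ginv c d x * X c d)) + 3 * k a b x
  - h0 a b x * sum3 (fun c => sum3 (fun d => ginv c d x * k c d x)).
Proof.
  intros Hs Hx; rewrite !sum3E.
  rewrite !(Hs theta tau x Hx), !(Hs phi tau x Hx), !(Hs phi theta x Hx).
  unfold ginv, h0; destruct a, b; rewrite ?(Hs theta tau x Hx),
    ?(Hs phi tau x Hx), ?(Hs phi theta x Hx); trig_field x Hx.
Qed.

(** Commuting the two derivatives produces the gradient of the divergence, which vanishes, and a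
    curvature contribution; with vanishing trace the latter is [3 k]. *)
Lemma div_cd0_swapped (k : ten2 pt) (a b : idx) (x : pt) :
  (forall a b, reg0 (k a b)) -> symmetric k -> trace_free k -> div_free k ->
  chart x ->
  sum3 (fun c => sum3 (fun d =>
    ginv c d x * cd0 (cd0 (ten2_tensor k)) [c; a; d; b] x)) = 3 * k a b x.
Proof.
  intros Hk Hs Ht Hd Hx; assert (HT := regT_ten2 k Hk).
  rewrite (Sum_ext _ _ (fun c => sum3 (fun d => ginv c d x *
    (cd0 (cd0 (ten2_tensor k)) [a; c; d; b] x + h0 c d x * k a b x
     - h0 a d x * k c b x + h0 c b x * k d a x - h0 a b x * k d c x)))).
  2:{ intros c; apply Sum_ext; intros d; now rewrite cd0_commute_2. }
  rewrite contract_curvature by trivial.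
  rewrite cd0_contract_1 by (trivial; now apply regT_cd0).
  rewrite (pd_ext_chart a _ (fun _ => 0) x Hx) by (intros; now apply Hd).
  rewrite pd_const, Ht by trivial.
  rewrite (Sum_ext idxs (fun e => Gam e a b x * _) (fun _ => 0)).
  - rewrite sum3E; ring.
  - intros e; rewrite Hd by trivial; ring.
Qed.

Lemma cd0_cd0_trace (k : ten2 pt) (a b : idx) (x : pt) :
  (forall a b, reg0 (k a b)) -> trace_free k -> chart x ->
  sum3 (fun c => sum3 (fun d =>
    ginv c d x * cd0 (cd0 (ten2_tensor k)) [b; a; c; d] x)) = 0.
Proof.
  intros Hk Ht Hx; assert (HT := regT_ten2 k Hk).
  assert (HU := regT_cd0 _ HT).
  set (U := cd0 (ten2_tensor k)) in *.
  (* [U'] moves the contracted pair to the two front slots, where [cd0_contract_1] expects it. *)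
  set (U' := fun l : list idx => match l with
             | [c; d; a] => U [a; c; d] | _ => fun _ => 0 end).
  assert (HU' : regT U').
  { intros [|c [|d [|e [|f l]]]]; try apply (reg0_const 0); apply HU. }
  rewrite (Sum_ext _ _ (fun c => sum3 (fun d =>
    ginv c d x * cd0 U' [b; c; d; a] x))).
  2:{ intros c; apply Sum_ext; intros d; f_equal.
      rewrite !cd0_3 by trivial; unfold U'; ring. }
  rewrite cd0_contract_1 by trivial.
  assert (E : forall e y, chart y ->
    sum3 (fun a => sum3 (fun b => ginv a b y * U' [a; b; e] y)) = 0).
  { intros e y Hy; unfold U', U; rewrite <- cd0_contract_0 by trivial.
    rewrite (pd_ext_chart e _ (fun _ => 0) y Hy); [apply pd_const|apply Ht]. }
  rewrite (pd_ext_chart b _ (fun _ => 0) x Hx) by (intros; now apply E).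
  rewrite pd_const, (Sum_ext idxs (fun e => Gam e b a x * _) (fun _ => 0)).
  - rewrite sum3E; ring.
  - intros e; rewrite E by trivial; ring.
Qed.

(** * The Codazzi tensor built from [sigma] *)

Section Hessian.
Variable sigma : pt -> R.
Hypothesis sigma_reg : reg0 sigma.
Hypothesis sigma_eq : forall x, chart x ->
  box0 (scalar_tensor sigma) [] x + 3 * sigma x = 0.

Notation V := (cd0 (scalar_tensor sigma)).

Lemma hess0_sym : symmetric (hess0 sigma).
Proof.
  intros a b x Hx; unfold hess0; rewrite !cd0_1 by trivial.
  assert (E : forall a b, pd a (V [b]) x = pd a (pd b sigma) x).
  { intros; apply pd_ext_chart; trivial; intros; apply cd0_scalar. }
  rewrite !E, (pd_comm _ a b), !sum3E by trivial.
  rewrite !(Gam_sym _ a b); ring.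
Qed.

Lemma hess0_reg (a b : idx) : reg0 (hess0 sigma a b).
Proof. apply regT_cd0, regT_cd0, regT_scalar, sigma_reg. Qed.

Definition psi0 : ten2 pt := fun a b x =>
  hess0 sigma a b x + sigma x * h0 a b x.

Lemma psi0_reg (a b : idx) : reg0 (psi0 a b).
Proof.
  apply reg0_plus; [apply hess0_reg|apply reg0_mult; trivial; apply reg0_h0].
Qed.

Lemma psi0_sym : symmetric psi0.
Proof.
  intros a b x Hx; unfold psi0; now rewrite hess0_sym, h0_sym.
Qed.

Lemma hess0_trace (x : pt) : chart x ->
  sum3 (fun a => sum3 (fun b => ginv a b x * hess0 sigma a b x)) = - 3 * sigma x.
Proof.
  intros Hx; generalize (sigma_eq x Hx); unfold box0, hess0; rewrite !sum3E.
  rewrite !inv_h0 by trivial; lra.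
Qed.

Lemma psi0_trace_free : trace_free psi0.
Proof.
  intros x Hx.
  assert (E : sum3 (fun a => sum3 (fun b => ginv a b x * psi0 a b x)) =
    sum3 (fun a => sum3 (fun b => ginv a b x * hess0 sigma a b x))
    + 3 * sigma x).
  { unfold psi0; rewrite !sum3E; unfold ginv, h0; trig_field x Hx. }
  rewrite E, hess0_trace by trivial; ring.
Qed.

Lemma cd0_mult_h0 (f : pt -> R) (c a b : idx) (x : pt) :
  reg0 f -> chart x ->
  cd0 (ten2_tensor (fun a b x => f x * h0 a b x)) [c; a; b] x =
  cd0 (scalar_tensor f) [c] x * h0 a b x.
Proof.
  intros Hf Hx; rewrite cd0_2, cd0_scalar by trivial.
  unten.
  rewrite pd_mult by exr; rewrite pd_h0, !sum3E by trivial; ring.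
Qed.

Lemma cd0_plus_2 (k l : ten2 pt) (u : R) (c a b : idx) (x : pt) :
  (forall a b, reg0 (k a b)) -> (forall a b, reg0 (l a b)) -> chart x ->
  cd0 (ten2_tensor (fun a b x => k a b x + u * l a b x)) [c; a; b] x =
  cd0 (ten2_tensor k) [c; a; b] x + u * cd0 (ten2_tensor l) [c; a; b] x.
Proof.
  intros Hk Hl Hx; rewrite !cd0_2, !sum3E by trivial; unten.
  rewrite (pd_plus c (k a b) (fun y => u * l a b y)), (pd_scal c u (l a b)); [ring| |].
  - now apply reg0_ex.
  - apply reg0_ex; trivial; apply reg0_mult; trivial; apply reg0_const.
Qed.

(* psi0 is a Codazzi tensor, so its divergence and Laplacian reduce to
   contractions with the trace and with the curvature *)
Lemma psi0_codazzi (c a b : idx) (x : pt) : chart x ->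
  cd0 (ten2_tensor psi0) [c; a; b] x = cd0 (ten2_tensor psi0) [a; c; b] x.
Proof.
  assert (E : forall c a b x, chart x ->
    cd0 (ten2_tensor psi0) [c; a; b] x = cd0 (cd0 V) [c; a; b] x + V [c] x * h0 a b x).
  { clear c a b x; intros c a b x Hx.
    rewrite (cd0_ext_2 _ (ten2_tensor (fun a b x =>
      hess0 sigma a b x + 1 * (sigma x * h0 a b x)))); trivial.
    2:{ intros; simpl; unfold psi0; ring. }
    rewrite (cd0_plus_2 (hess0 sigma) (fun a b x => sigma x * h0 a b x));
      trivial; [|apply hess0_reg|intros; apply reg0_mult; trivial; apply reg0_h0].
    rewrite cd0_mult_h0 by trivial.
    rewrite (cd0_ext_2 (ten2_tensor (hess0 sigma)) (cd0 V)); trivial.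
    ring. }
  intros Hx; rewrite !E by trivial.
  rewrite (cd0_commute_1 V c a b) by (trivial; apply regT_cd0, regT_scalar, sigma_reg).
  ring.
Qed.

Lemma cd0_sym_2 (k : ten2 pt) (c a b : idx) (x : pt) :
  symmetric k -> chart x ->
  cd0 (ten2_tensor k) [c; a; b] x = cd0 (ten2_tensor k) [c; b; a] x.
Proof.
  intros Hs Hx; rewrite !cd0_2, !sum3E by trivial; unten.
  rewrite (pd_ext_chart c (k a b) (k b a) x Hx) by (intros; now apply Hs).
  rewrite (Hs tau b), (Hs theta b), (Hs phi b), (Hs a tau), (Hs a theta),
    (Hs a phi) by trivial; ring.
Qed.

(** Symmetry and the Codazzi property exchange the derivative index with a free one, so the
    divergence becomes the gradient of the trace. *)
Lemma psi0_div_free : div_free psi0.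
Proof.
  intros x d Hx.
  transitivity (pd d (fun y => sum3 (fun a => sum3 (fun b =>
    ginv a b y * ten2_tensor psi0 [a; b] y))) x).
  - rewrite cd0_contract_0 by (trivial; apply regT_ten2, psi0_reg).
    apply Sum_ext; intros a; apply Sum_ext; intros b.
    rewrite (cd0_sym_2 _ a b d), psi0_codazzi; trivial.
    apply psi0_sym.
  - rewrite (pd_ext_chart d _ (fun _ => 0) x Hx); [apply pd_const|].
    apply psi0_trace_free.
Qed.

(** The Codazzi property, applied under the outer derivative, turns the Laplacian into the
    contraction of [div_cd0_swapped]; the eigenvalue 3 is thus pure curvature. *)
Lemma psi0_box (a b : idx) (x : pt) : chart x ->
  sum3 (fun c => sum3 (fun d =>
    ginv c d x * cd0 (cd0 (ten2_tensor psi0)) [c; d; a; b] x)) = 3 * psi0 a b x.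
Proof.
  intros Hx; rewrite <- (div_cd0_swapped psi0 a b x); trivial.
  2: apply psi0_reg. 2: apply psi0_sym. 2: apply psi0_trace_free.
  2: apply psi0_div_free.
  set (U' := fun l : list idx => match l with
      | [d; a; b] => cd0 (ten2_tensor psi0) [a; d; b] | _ => fun _ => 0 end).
  apply Sum_ext; intros c; apply Sum_ext; intros d; f_equal.
  transitivity (cd0 U' [c; d; a; b] x).
  - apply cd0_ext_3; trivial; intros; now apply psi0_codazzi.
  - rewrite !cd0_3 by trivial; unfold U'; ring.
Qed.

End Hessian.

(** * The linearised connection *)

Definition gam1 (h1 : ten2 pt) (c a b : idx) (x : pt) : R :=
  let D := cd0 (ten2_tensor h1) in
  / 2 * sum3 (fun d => ginv c d x *
    (D [a; d; b] x + D [b; d; a] x - D [d; a; b] x)).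

(** The left side is the first-order change of the Christoffel formula, the second product coming
    from the perturbed inverse metric. Its non-tensorial pieces cancel. *)
Lemma gam1_coordinates (h1 : ten2 pt) (c a b : idx) (x : pt) :
  symmetric h1 -> chart x ->
  / 2 * sum3 (fun e =>
    ginv c e x * (pd a (h1 e b) x + pd b (h1 e a) x - pd e (h1 a b) x)
    - sum3 (fun u => sum3 (fun v => ginv c u x * ginv e v x * h1 u v x)) *
      (pd a (h0 e b) x + pd b (h0 e a) x - pd e (h0 a b) x))
  = gam1 h1 c a b x.
Proof.
  intros Hs Hx; unfold gam1; rewrite !sum3E, !cd0_2, !sum3E by trivial.
  unten; rewrite !pd_h0, !sum3E by trivial.
  rewrite !(Hs theta tau x Hx), !(Hs phi tau x Hx), !(Hs phi theta x Hx).
  destruct a, b; rewrite ?(Hs theta tau x Hx), ?(Hs phi tau x Hx),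
    ?(Hs phi theta x Hx); destruct c; unfold ginv, h0, Gam; trig_field x Hx.
Qed.

(** The first-order part of the coordinate formula [ricci], in the form in which an expansion of
    that formula delivers it; [palatini] makes it covariant. *)
Definition ric1 (h1 : ten2 pt) (a b : idx) (x : pt) : R :=
  let C := gam1 h1 in
  sum3 (fun c => pd c (C c a b) x - pd b (C c a c) x)
  + sum3 (fun c => sum3 (fun e =>
      (Gam c c e x * C e a b x + C c c e x * Gam e a b x)
      - (Gam c b e x * C e a c x + C c b e x * Gam e a c x))).

(** * The linearised Ricci tensor *)

Lemma ricci_h0 (a b : idx) (x : pt) : chart x ->
  sum3 (fun c => pd c (Gam c a b) x - pd b (Gam c a c) x)
  + sum3 (fun c => sum3 (fun e =>
      Gam c c e x * Gam e a b x - Gam c b e x * Gam e a c x)) = 2 * h0 a b x.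
Proof.
  intros Hx; rewrite !sum3E; destruct a, b; unfold Gam; pd_calc Hx;
    cbn -[cosh sinh sin cos]; trig_field x Hx.
Qed.

(** [gam1] with its upper index lowered, because [covd] differentiates covariant tensors only. *)
Definition gam1_low (h1 : ten2 pt) : @tensor pt idx := fun l x =>
  match l with
  | [d; a; b] => let D := cd0 (ten2_tensor h1) in
      / 2 * (D [a; d; b] x + D [b; d; a] x - D [d; a; b] x)
  | _ => 0
  end.

Lemma gam1_low_reg (h1 : ten2 pt) :
  (forall a b, reg0 (h1 a b)) -> regT (gam1_low h1).
Proof.
  intros H; assert (H' := regT_cd0 _ (regT_ten2 _ H)).
  intros [|d [|a [|b [|e l]]]]; unfold gam1_low; try apply (reg0_const 0).
  apply reg0_mult; [apply reg0_const|].
  apply reg0_minus; [apply reg0_plus|]; apply H'.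
Qed.

Lemma cd0_gam1_low (h1 : ten2 pt) (c d a b : idx) (x : pt) :
  (forall a b, reg0 (h1 a b)) -> chart x ->
  cd0 (gam1_low h1) [c; d; a; b] x =
  let DD := cd0 (cd0 (ten2_tensor h1)) in
  / 2 * (DD [c; a; d; b] x + DD [c; b; d; a] x - DD [c; d; a; b] x).
Proof.
  intros H Hx; assert (H' := regT_cd0 _ (regT_ten2 _ H)).
  cbv zeta; rewrite !cd0_3 by trivial; unfold gam1_low; cbv zeta beta.
  assert (E : pd c (fun y => / 2 *
     (cd0 (ten2_tensor h1) [a; d; b] y + cd0 (ten2_tensor h1) [b; d; a] y
      - cd0 (ten2_tensor h1) [d; a; b] y)) x = / 2 *
     (pd c (cd0 (ten2_tensor h1) [a; d; b]) x
      + pd c (cd0 (ten2_tensor h1) [b; d; a]) x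
      - pd c (cd0 (ten2_tensor h1) [d; a; b]) x)).
  { rewrite pd_scal; f_equal.
    rewrite pd_minus; [rewrite pd_plus; [reflexivity| |]| |];
      apply reg0_ex; trivial; try apply reg0_plus; apply H'. }
  rewrite E, !sum3E; ring.
Qed.

Lemma pd_gam1 (h1 : ten2 pt) (e c a b : idx) (x : pt) :
  (forall a b, reg0 (h1 a b)) -> chart x ->
  pd e (gam1 h1 c a b) x =
  sum3 (fun d => ginv c d x * cd0 (gam1_low h1) [e; d; a; b] x)
  - sum3 (fun f => Gam c e f x * gam1 h1 f a b x)
  + sum3 (fun f => Gam f e a x * gam1 h1 c f b x)
  + sum3 (fun f => Gam f e b x * gam1 h1 c a f x).
Proof.
  intros H Hx; assert (H' := gam1_low_reg h1 H).
  assert (E : forall c a b y, gam1 h1 c a b y =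
    sum3 (fun d => ginv c d y * gam1_low h1 [d; a; b] y)).
  { intros; unfold gam1; cbv zeta; rewrite <- Sum_scal; apply Sum_ext.
    intros d; simpl; ring. }
  rewrite (pd_ext_chart e _ _ x Hx (fun y _ => E c a b y)).
  rewrite (pd_sum3 e (fun d y => ginv c d y * gam1_low h1 [d; a; b] y)); trivial.
  2:{ intros; apply reg0_mult; [apply reg0_ginv|apply H']. }
  rewrite (Sum_ext idxs _ (fun d =>
    - sum3 (fun f => Gam c e f x * ginv f d x + Gam d e f x * ginv c f x)
      * gam1_low h1 [d; a; b] x
    + ginv c d x * pd e (gam1_low h1 [d; a; b]) x)).
  2:{ intros d; rewrite <- pd_ginv by trivial; apply pd_mult;
      (apply reg0_ex; [|exact Hx]); [apply reg0_ginv|apply H']. }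
  rewrite !sum3E, !E, !cd0_3, !sum3E by trivial; ring.
Qed.

Lemma gam1_sym (h1 : ten2 pt) (c a b : idx) (x : pt) :
  symmetric h1 -> chart x -> gam1 h1 c a b x = gam1 h1 c b a x.
Proof.
  intros Hs Hx; unfold gam1; cbv zeta; f_equal; apply Sum_ext; intros d.
  rewrite (cd0_sym_2 h1 d a b); trivial; ring.
Qed.

(** The Palatini identity [nabla_c C^c_ab - nabla_b C^c_ac]: the products of [Gam] with [gam1] in
    [ric1] are precisely its connection terms. The rewrites only bring symmetric index pairs to a
    common order. *)
Lemma palatini (h1 : ten2 pt) (a b : idx) (x : pt) :
  (forall a b, reg0 (h1 a b)) -> symmetric h1 -> chart x ->
  ric1 h1 a b x = sum3 (fun c => sum3 (fun d => ginv c d x *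
    (cd0 (gam1_low h1) [c; d; a; b] x - cd0 (gam1_low h1) [b; d; a; c] x))).
Proof.
  intros H Hs Hx; unfold ric1; cbv zeta.
  rewrite !sum3E, !pd_gam1, !sum3E by trivial.
  rewrite !(Gam_sym _ _ b).
  rewrite !(Gam_sym _ theta tau), !(Gam_sym _ phi tau), !(Gam_sym _ phi theta).
  rewrite !(gam1_sym h1 _ _ b) by trivial.
  rewrite !(Gam_sym _ _ a), !(Gam_sym _ a b).
  rewrite ?(gam1_sym h1 _ theta tau), ?(gam1_sym h1 _ phi tau),
    ?(gam1_sym h1 _ phi theta) by trivial.
  ring.
Qed.

Lemma ginv_contract_h0 (a b : idx) (x : pt) (u : R) (X Y Z : idx -> idx -> R) :
  chart x ->
  sum3 (fun c => sum3 (fun d => ginv c d x *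
    (X c a * h0 d b x + Y c b * h0 d a x - Z c d * h0 a b x
     - u * h0 d c x))) =
  X b a + Y a b - sum3 (fun c => sum3 (fun d => ginv c d x * Z c d)) * h0 a b x
  - 3 * u.
Proof.
  intros Hx; rewrite !sum3E; destruct a, b; unfold ginv, h0; trig_field x Hx.
Qed.

Section LinearisedRicci.
Variables (sigma : pt -> R) (k h1 : ten2 pt).
Hypothesis sigma_reg : reg0 sigma.
Hypothesis sigma_eq : forall x, chart x ->
  box0 (scalar_tensor sigma) [] x + 3 * sigma x = 0.
Hypothesis k_reg : forall a b, reg0 (k a b).
Hypothesis k_sym : symmetric k.
Hypothesis k_trace : trace_free k.
Hypothesis k_div : div_free k.
Hypothesis k_eq : forall a b x, chart x ->
  box0 (ten2_tensor k) [a; b] x - 3 * k a b x = 0.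
Hypothesis h1_eq : forall a b x, chart x ->
  h1 a b x = k a b x + (-2) * (sigma x * h0 a b x).

Lemma h1_reg (a b : idx) : reg0 (h1 a b).
Proof.
  apply (reg0_ext (fun x => k a b x + (-2) * (sigma x * h0 a b x))).
  - intros; now rewrite h1_eq.
  - repeat first [apply reg0_plus|apply reg0_mult|apply reg0_const
      |apply reg0_h0|trivial].
Qed.

Lemma h1_sym : symmetric h1.
Proof.
  intros a b x Hx; rewrite !h1_eq, k_sym, (h0_sym a b) by trivial; reflexivity.
Qed.

Lemma cd0_h1 (c a b : idx) (x : pt) : chart x ->
  cd0 (ten2_tensor h1) [c; a; b] x =
  cd0 (ten2_tensor k) [c; a; b] x
  + (-2) * (cd0 (scalar_tensor sigma) [c] x * h0 a b x).
Proof.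
  intros Hx.
  rewrite (cd0_ext_2 _ (ten2_tensor (fun a b x =>
    k a b x + (-2) * (sigma x * h0 a b x)))) by (trivial; exact h1_eq).
  rewrite (cd0_plus_2 k (fun a b x => sigma x * h0 a b x)); trivial.
  - now rewrite cd0_mult_h0.
  - intros; apply reg0_mult; trivial; apply reg0_h0.
Qed.

Lemma cd0_cd0_h1 (d c a b : idx) (x : pt) : chart x ->
  cd0 (cd0 (ten2_tensor h1)) [d; c; a; b] x =
  cd0 (cd0 (ten2_tensor k)) [d; c; a; b] x
  + (-2) * (hess0 sigma d c x * h0 a b x).
Proof.
  intros Hx.
  assert (HV := regT_cd0 _ (regT_scalar _ sigma_reg)).
  assert (HK := regT_cd0 _ (regT_ten2 _ k_reg)).
  unfold hess0; rewrite !cd0_3, cd0_1 by trivial.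
  rewrite (pd_ext_chart d _ _ x Hx (fun y => cd0_h1 c a b y)).
  rewrite (pd_plus d (cd0 (ten2_tensor k) [c; a; b])
    (fun y => (-2) * (cd0 (scalar_tensor sigma) [c] y * h0 a b y))).
  2: apply reg0_ex; trivial; apply HK.
  2: apply reg0_ex; trivial; apply reg0_mult; [apply reg0_const|];
     apply reg0_mult; [apply HV|apply reg0_h0].
  rewrite pd_scal, (pd_mult d (cd0 (scalar_tensor sigma) [c]) (h0 a b)).
  2: apply reg0_ex; trivial; apply HV.
  2: apply reg0_ex; trivial; apply reg0_h0.
  rewrite pd_h0, !sum3E, !cd0_h1 by trivial; ring.
Qed.

Lemma k_box (a b : idx) (x : pt) : chart x ->
  sum3 (fun c => sum3 (fun d =>
    ginv c d x * cd0 (cd0 (ten2_tensor k)) [c; d; a; b] x)) = 3 * k a b x.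
Proof.
  intros Hx; generalize (k_eq a b x Hx); unfold box0.
  rewrite !sum3E, !inv_h0 by trivial; lra.
Qed.

(** The [k]-part is half of [3 + 3 - 3 - 0] times [k]: two swapped divergences, the Laplacian, the
    Hessian of the trace. With [H] the Hessian of [sigma], the conformal part is
    [- (2 H - h0 tr H - 3 H)], and [tr H = - 3 sigma]. *)
Lemma linearised_ricci (a b : idx) (x : pt) : chart x ->
  ric1 h1 a b x =
  3 / 2 * k a b x + hess0 sigma a b x - 3 * sigma x * h0 a b x.
Proof.
  intros Hx; rewrite palatini by (apply h1_reg || apply h1_sym || trivial).
  set (DK := cd0 (cd0 (ten2_tensor k))); set (H := hess0 sigma).
  transitivity (/ 2 * (
    sum3 (fun c => sum3 (fun d => ginv c d x * DK [c; a; d; b] x))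
    + sum3 (fun c => sum3 (fun d => ginv c d x * DK [c; b; d; a] x))
    - sum3 (fun c => sum3 (fun d => ginv c d x * DK [c; d; a; b] x))
    - sum3 (fun c => sum3 (fun d => ginv c d x * DK [b; a; c; d] x)))
    - sum3 (fun c => sum3 (fun d => ginv c d x *
       (H c a x * h0 d b x + H c b x * h0 d a x - H c d x * h0 a b x
        - H b a x * h0 d c x)))).
  { assert (S2 : forall c d, cd0 (cd0 (ten2_tensor h1)) [b; c; d; a] x =
      cd0 (cd0 (ten2_tensor h1)) [b; c; a; d] x).
    { intros c d.
      set (U' := fun l : list idx => match l with
        | [c; d; a] => cd0 (ten2_tensor h1) [c; a; d] | _ => fun _ => 0 end).
      transitivity (cd0 U' [b; c; d; a] x).
      - apply cd0_ext_3; trivial; intros.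
        now apply cd0_sym_2; [apply h1_sym|].
      - rewrite !cd0_3 by trivial; unfold U'; ring. }
    assert (S3 : forall d c, DK [b; a; d; c] x = DK [b; a; c; d] x).
    { intros d c; unfold DK.
      set (U' := fun l : list idx => match l with
        | [a; c; d] => cd0 (ten2_tensor k) [a; d; c] | _ => fun _ => 0 end).
      symmetry; transitivity (cd0 U' [b; a; c; d] x).
      - apply cd0_ext_3; trivial; intros; now apply cd0_sym_2.
      - rewrite !cd0_3 by trivial; unfold U'; ring. }
    rewrite !sum3E, !cd0_gam1_low by (apply h1_reg || trivial); cbv zeta.
    rewrite !S2, !cd0_cd0_h1 by trivial.
    fold DK H; rewrite !(S3 theta tau), !(S3 phi tau), !(S3 phi theta).
    rewrite (ginv_sym theta tau), (ginv_sym phi tau), (ginv_sym phi theta).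
    rewrite !(h0_sym theta tau), !(h0_sym phi tau), !(h0_sym phi theta).
    field. }
  unfold DK; rewrite !div_cd0_swapped, k_box, cd0_cd0_trace by trivial.
  rewrite (ginv_contract_h0 a b x (H b a x) (fun c d => H c d x)
    (fun c d => H c d x) (fun c d => H c d x)) by trivial.
  unfold H; rewrite hess0_trace, (hess0_sym sigma sigma_reg b a),
    (k_sym b a) by trivial.
  field.
Qed.

End LinearisedRicci.

(** * Expansions of the boundary geometry *)

Definition lift (f : pt -> R) : pt4 -> R := fun p => f (snd p).

Lemma sp_lift (a : idx) (f : pt -> R) (r : R) (x : pt) :
  sp a (lift f) (r, x) = pd a f x.
Proof. reflexivity. Qed.

Definition raise0 (k : ten2 pt) : ten2 pt := fun a b x =>
  sum3 (fun u => sum3 (fun v => ginv a u x * ginv b v x * k u v x)).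

Lemma raise0_reg (k : ten2 pt) (a b : idx) :
  (forall a b, reg0 (k a b)) -> reg0 (raise0 k a b).
Proof.
  intros H; apply reg0_sum; intros u; apply reg0_sum; intros v.
  repeat apply reg0_mult; trivial; apply reg0_ginv.
Qed.

(** Laplace expansion: with the cyclic [next], cofactors carry their own signs, and off the diagonal
    the sum is a determinant with a repeated row. *)
Lemma inv_mult_metric (h : ten2 pt4) (e b : idx) (p : pt4) :
  (forall a b, h a b p = h b a p) -> det h p <> 0 ->
  sum3 (fun f => h b f p * inv h f e p) = delta b e.
Proof.
  intros Hs Hd; rewrite sum3E; unfold inv.
  assert (E : h b tau p * cofactor h e tau p + h b theta p * cofactor h e theta p
    + h b phi p * cofactor h e phi p = delta b e * det h p).
  { unfold det, cofactor; rewrite sum3E; unfold cofactor.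
    destruct b, e; simpl next; unfold delta; simpl;
    rewrite ?(Hs theta tau), ?(Hs phi tau), ?(Hs phi theta); ring. }
  unfold Rdiv; rewrite <- !Rmult_assoc, <- !Rmult_plus_distr_r, E.
  field; trivial.
Qed.

Lemma covd_2 {P I : Type} (en : list I) (d : I -> (P -> R) -> P -> R)
    (g gi : I -> I -> P -> R) (T : @tensor P I) (c a b : I) (p : P) :
  covd en d g gi T [c; a; b] p = d c (T [a; b]) p
    - Sum en (fun e => christoffel en d g gi e c a p * T [e; b] p)
    - Sum en (fun e => christoffel en d g gi e c b p * T [a; e] p).
Proof. unfold covd; simpl; ring. Qed.

Lemma covd_3 {P I : Type} (en : list I) (d : I -> (P -> R) -> P -> R)
    (g gi : I -> I -> P -> R) (T : @tensor P I) (c a b f : I) (p : P) :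
  covd en d g gi T [c; a; b; f] p = d c (T [a; b; f]) p
    - Sum en (fun e => christoffel en d g gi e c a p * T [e; b; f] p)
    - Sum en (fun e => christoffel en d g gi e c b p * T [a; e; f] p)
    - Sum en (fun e => christoffel en d g gi e c f p * T [a; b; e] p).
Proof. unfold covd; simpl; ring. Qed.

Lemma covd_metric (h : ten2 pt4) (c a b : idx) (p : pt4) :
  (forall a b p, h a b p = h b a p) -> det h p <> 0 ->
  covd idxs sp h (inv h) (ten2_tensor h) [c; a; b] p = 0.
Proof.
  intros Hs Hd; rewrite covd_2, ten2_tensor_at.
  assert (S : forall c a b, sp c (h a b) p = sp c (h b a) p).
  { intros; unfold sp, pd4, pd; apply Derive_ext; intros; apply Hs. }
  assert (L : forall a b, sum3 (fun e => christoffel idxs sp h (inv h) e c a p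
     * h e b p) = / 2 * (sp c (h b a) p + sp a (h b c) p - sp b (h c a) p)).
  { clear a b; intros a b; unfold christoffel.
    set (X := fun f => sp c (h f a) p + sp a (h f c) p - sp f (h c a) p).
    transitivity (/ 2 * sum3 (fun f => delta b f * X f)).
    - rewrite (sum3E (fun f => delta b f * X f)).
      rewrite <- !(inv_mult_metric h _ b p) by (trivial; intros; apply Hs).
      rewrite !sum3E, (Hs tau b), (Hs theta b), (Hs phi b).
      fold (X tau) (X theta) (X phi); ring.
    - rewrite sum3E; unfold X, delta; destruct b; simpl; ring. }
  change (sp c (h a b) p
    - sum3 (fun e => christoffel idxs sp h (inv h) e c a p * h e b p)
    - sum3 (fun e => christoffel idxs sp h (inv h) e c b p * h a e p) = 0).
  rewrite (Sum_ext idxs (fun e => christoffel idxs sp h (inv h) e c b p *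
    h a e p) (fun e => christoffel idxs sp h (inv h) e c b p * h e a p))
    by (intros; now rewrite (Hs a)).
  rewrite !L.
  rewrite (S c b a), (S b a c), (S a c b); field.
Qed.

(** Reads both coefficients off the syntax of the expression, using [leaf] for atoms, and leaves
    them as existential variables; [expands_coef] then compares them with the intended ones. *)
Ltac exps leaf :=
  cbv beta;
  first
  [ leaf
  | eapply expands_const
  | lazymatch goal with
    | |- expands _ (fun _ => Sum _ _) _ _ =>
        eapply expands_sum; intros ?; exps leaf
    | |- expands _ (fun _ => _ + _) _ _ =>
        eapply expands_plus; [exps leaf|exps leaf|reflexivity|reflexivity]
    | |- expands _ (fun _ => _ - _) _ _ =>
        eapply expands_minus; [exps leaf|exps leaf|reflexivity|reflexivity]
    | |- expands _ (fun _ => _ * _) _ _ =>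
        eapply expands_mult; [exps leaf|exps leaf]
    | |- expands _ (fun _ => - _) _ _ => eapply expands_opp; exps leaf
    | |- expands _ (fun _ => sp _ _ _) _ _ => eapply expands_sp; exps leaf
    | |- expands _ (sp _ _) _ _ => eapply expands_sp; exps leaf
    end ].

Ltac evx r x Hx Hr := apply ev_intro; intros r x Hx Hr;
  rewrite ?sum3E, ?sp_lift; unfold lift; cbn [fst snd].

Section Asymptotics.
Variables (sigma : pt -> R) (h1 : ten2 pt) (h : ten2 pt4).
Hypothesis h_asymptotics : beig_schmidt sigma h1 h.
Hypothesis h1_reg' : forall a b, reg0 (h1 a b).
Hypothesis h1_sym' : symmetric h1.

Lemma h_sym (a b : idx) (p : pt4) : h a b p = h b a p.
Proof. apply h_asymptotics. Qed.

Lemma expands_h (a b : idx) :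
  expands 2 (h a b) (lift (h0 a b)) (lift (h1 a b)).
Proof.
  destruct h_asymptotics as [_ [h2 [Hh2 HO]]].
  split; [apply reg0_h0|split; [apply h1_reg'|]].
  specialize (HO a b); apply asympO_reg in HO.
  match type of HO with reg ?f => exists (fun p => h2 a b (snd p) + f p * / fst p)
  end.
  split.
  - apply reg_plus; [now apply smooth_reg0|].
    apply reg_mult; [exact HO|apply reg_inv_radius].
  - evx r x Hx Hr; simpl powerRZ; field; lra.
Qed.

(** [expands] cannot be differentiated in [rho], so the polynomial part is differentiated by hand.
    The [h2] term of [h] is constant in [rho] and drops out, and the remainder gains one order by
    [asympO]. *)
Lemma expands_radial_derivative_h (a b : idx) :
  expands 1 (pd4 None (h a b)) (lift (fun x => 2 * h0 a b x)) (lift (h1 a b)).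
Proof.
  destruct h_asymptotics as [_ [h2 [Hh2 HO]]]; specialize (HO a b).
  split; [apply (reg0_mult (fun _ => 2)); [apply reg0_const|apply reg0_h0]|].
  split; [apply h1_reg'|].
  set (rem := fun p => h a b p - fst p ^ 2 * (h0 a b (snd p) +
    h1 a b (snd p) / fst p + h2 a b (snd p) / fst p ^ 2)) in HO.
  assert (HO' := asympO_reg _ _ (asympO_pd4 _ _ None HO)).
  exists (fun p => powerRZ (fst p) (- (-1 - 1)) * pd4 None rem p * / fst p).
  split; [apply reg_mult; [exact HO'|apply reg_inv_radius]|].
  destruct (HO []) as [HE _]; revert HE; apply ev_mono.
  intros r x Hx Hr [HE _]; specialize (HE None).
  unfold lift; cbn [pd4 ex_pd4 fst snd fold_right] in *.
  set (q := fun r : R => r ^ 2 * (h0 a b x + h1 a b x / r + h2 a b x / r ^ 2)).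
  rewrite (Derive_ext (fun r => h a b (r, x)) (fun r => rem (r, x) + q r)).
  2:{ intros t; unfold rem, q; simpl; ring. }
  assert (HP : is_derive q r (2 * r * h0 a b x + h1 a b x)).
  { unfold q; auto_derive; [repeat split; try lra; apply Rgt_not_eq; nra|field; lra]. }
  rewrite Derive_plus; [|exact HE|eexists; exact HP].
  rewrite (is_derive_unique _ _ _ HP); simpl powerRZ; field; lra.
Qed.

Lemma expands_det :
  expands 6 (det h) (lift (det h0)) (lift (fun x =>
    det h0 x * sum3 (fun a => sum3 (fun b => ginv a b x * h1 a b x)))).
Proof.
  unfold det, cofactor.
  eapply expands_coef; [exps ltac:(apply expands_h)|reflexivity
    |evx r x Hx Hr; now rewrite sum3E|].
  evx r x Hx Hr; rewrite !sum3E; simpl next; unfold ginv, h0.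
  rewrite !(h1_sym' theta tau x Hx), !(h1_sym' phi tau x Hx),
    !(h1_sym' phi theta x Hx); trig_field x Hx.
Qed.

(** Regularity of the leading coefficient is a component of [expands]. *)
Lemma reg0_det_h0 : reg0 (det h0).
Proof.
  apply expands_det.
Qed.

Lemma det_h0_neq (x : pt) : chart x -> det h0 x <> 0.
Proof.
  intros Hx; rewrite det_h0; apply Rlt_not_eq.
  assert (H1 := cosh_neq (x tau)); assert (H2 := chart_sin_neq x Hx).
  assert (P1 : 0 < cosh (x tau) ^ 4).
  { replace (cosh (x tau) ^ 4) with (Rsqr (cosh (x tau) * cosh (x tau)))
      by (unfold Rsqr; ring).
    apply Rsqr_pos_lt; now apply Rmult_integral_contrapositive_currified. }
  assert (P2 : 0 < sin (x theta) ^ 2).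
  { rewrite <- Rsqr_pow2; now apply Rsqr_pos_lt. }
  nra.
Qed.

(** [rho^-6 det h] is a small perturbation of [det h0], which is nonzero on the chart. *)
Lemma det_h_neq : ev (fun p => det h p <> 0).
Proof.
  assert (H := expands_det).
  assert (B : bounded_below (lift (det h0)))
    by (apply bounded_below_reg0; [exact reg0_det_h0|exact det_h0_neq]).
  apply (expands_shift 6 0 (-6)) in H; [|reflexivity].
  generalize (bounded_below_neq _ (bounded_below_expands _ _ _ H B)).
  apply ev_mono; intros r x _ _ N E; apply N; rewrite E; ring.
Qed.

Lemma expands_inv_h (a b : idx) :
  expands (-2) (inv h a b) (lift (ginv a b)) (lift (fun x => - raise0 h1 a b x)).
Proof.
  assert (HI : expands (-6) (fun p => / det h p) (fun p => / lift (det h0) p)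
   _) by (apply (expands_inv 6); [exact expands_det| |reflexivity];
     apply bounded_below_reg0; [exact reg0_det_h0|exact det_h0_neq]).
  unfold inv, cofactor, Rdiv.
  eapply expands_coef; [exps ltac:(first [apply expands_h|apply HI])|reflexivity
     | |].
  - evx r x Hx Hr; rewrite <- inv_h0 by trivial; reflexivity.
  - evx r x Hx Hr; unfold raise0; rewrite !sum3E, det_h0.
    unfold ginv, h0; destruct a, b; simpl next;
    rewrite ?(h1_sym' theta tau x Hx), ?(h1_sym' phi tau x Hx),
      ?(h1_sym' phi theta x Hx); trig_field x Hx.
Qed.

Lemma expands_christoffel (c a b : idx) :
  expands 0 (christoffel idxs sp h (inv h) c a b) (lift (Gam c a b))
    (lift (gam1 h1 c a b)).
Proof.
  unfold christoffel.
  eapply expands_coef; [exps ltac:(first [apply expands_h|apply expands_inv_h])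
    |reflexivity| |].
  - evx r x Hx Hr; rewrite <- christoffel_h0 by trivial; unfold christoffel.
    rewrite sum3E, !inv_h0 by trivial; reflexivity.
  - evx r x Hx Hr; rewrite <- gam1_coordinates by trivial.
    unfold raise0; rewrite !sum3E; ring.
Qed.

Lemma expands_ricci (a b : idx) :
  expands 0 (ricci idxs sp h (inv h) a b) (lift (fun x => 2 * h0 a b x))
    (lift (ric1 h1 a b)).
Proof.
  unfold ricci.
  eapply expands_coef; [exps ltac:(apply expands_christoffel)
    |reflexivity| |].
  - evx r x Hx Hr; rewrite <- ricci_h0, !sum3E by trivial; ring.
  - evx r x Hx Hr; unfold ric1; cbv zeta; rewrite !sum3E; ring.
Qed.

Lemma expands_lapse : reg0 sigma ->
  expands 0 (lapse sigma) (fun _ => 1) (lift sigma).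
Proof.
  intros Hs; split; [apply reg_const|split; [exact Hs|]].
  exists (fun _ => 0); split; [apply reg_const|].
  evx r x Hx Hr; unfold lapse; simpl; field; lra.
Qed.

(** There is no shift, so of all Christoffel symbols only the radial one with two tangential lower
    indices meets the normal, and it reduces to the radial derivative of [h]. *)
Lemma extrinsic_radial (a b : idx) (p : pt4) : lapse sigma p <> 0 ->
  extrinsic sigma h a b p = / 2 * (/ lapse sigma p * pd4 None (h a b) p).
Proof.
  intros HN; unfold extrinsic, covd; cbn [connection_terms].
  unfold christoffel, Sum, idxs4, idxs, normal; cbn [map fold_right g4 g4_inv].
  assert (Z : forall i, pd4 i (fun _ : pt4 => 0) p = 0).
  { intros [i|]; [exact (pd_const i 0 (snd p))|exact (Derive_const 0 (fst p))]. }
  change (g4 sigma h None (Some b)) with (fun _ : pt4 => 0).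
  change (g4 sigma h None (Some a)) with (fun _ : pt4 => 0).
  rewrite !Z.
  change (g4 sigma h (Some a) (Some b)) with (fun p => h a b p).
  change (fun p : pt4 => h a b p) with (h a b).
  field; trivial.
Qed.

Lemma expands_extrinsic (a b : idx) : reg0 sigma ->
  expands 1 (extrinsic sigma h a b) (lift (h0 a b))
    (lift (fun x => / 2 * h1 a b x - sigma x * h0 a b x)).
Proof.
  intros Hs; assert (HN := expands_lapse Hs).
  assert (B : bounded_below (fun _ => 1)).
  { intros x0 Hx; exists 1, 0; split; [lra|].
    apply filter_forall; intros x r _; rewrite Rabs_R1; lra. }
  assert (HI := expands_inv 0 0 _ _ _ HN B eq_refl).
  eapply expands_ext with (F := fun p =>
     / 2 * (/ lapse sigma p * pd4 None (h a b) p));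
    [exps ltac:(first [apply expands_radial_derivative_h|apply HI])
    |reflexivity| | |].
  - generalize (bounded_below_neq _ (bounded_below_expands _ _ _ HN B)).
    apply ev_mono; intros r x _ _ N; symmetry; now apply extrinsic_radial.
  - evx r x Hx Hr; field.
  - evx r x Hx Hr; field.
Qed.

(** With vanishing leading coefficient, the first-order correction [gam1] of the connection meets
    only zeros, so the unit dS_3 derivative of [m] is the whole first-order coefficient. *)
Lemma expands_covd_2 (n : Z) (T : @tensor pt4 idx) (m : @tensor pt idx)
    (c a b : idx) :
  (forall a b, expands n (T [a; b]) (fun _ => 0) (lift (m [a; b]))) ->
  expands n (covd idxs sp h (inv h) T [c; a; b]) (fun _ => 0)
    (lift (cd0 m [c; a; b])).
Proof.
  intros HT; eapply expands_ext with (F := fun p => sp c (T [a; b]) p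
    - sum3 (fun e => christoffel idxs sp h (inv h) e c a p * T [e; b] p)
    - sum3 (fun e => christoffel idxs sp h (inv h) e c b p * T [a; e] p)).
  - exps ltac:(first [apply expands_christoffel|apply HT]).
  - reflexivity.
  - evx r x Hx Hr; now rewrite covd_2, !sum3E.
  - evx r x Hx Hr.
    replace (sp c (fun _ => 0) (r, x)) with 0 by (symmetry; exact (pd_const c 0 x)).
    ring.
  - evx r x Hx Hr; rewrite cd0_2, !sum3E by trivial; ring.
Qed.

Lemma expands_covd_3 (n : Z) (T : @tensor pt4 idx) (m : @tensor pt idx)
    (c a b d : idx) :
  (forall a b d, expands n (T [a; b; d]) (fun _ => 0) (lift (m [a; b; d]))) ->
  expands n (covd idxs sp h (inv h) T [c; a; b; d]) (fun _ => 0)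
    (lift (cd0 m [c; a; b; d])).
Proof.
  intros HT; eapply expands_ext with (F := fun p => sp c (T [a; b; d]) p
    - sum3 (fun e => christoffel idxs sp h (inv h) e c a p * T [e; b; d] p)
    - sum3 (fun e => christoffel idxs sp h (inv h) e c b p * T [a; e; d] p)
    - sum3 (fun e => christoffel idxs sp h (inv h) e c d p * T [a; b; e] p)).
  - exps ltac:(first [apply expands_christoffel|apply HT]).
  - reflexivity.
  - evx r x Hx Hr; now rewrite covd_3, !sum3E.
  - evx r x Hx Hr.
    replace (sp c (fun _ => 0) (r, x)) with 0 by (symmetry; exact (pd_const c 0 x)).
    ring.
  - evx r x Hx Hr; rewrite cd0_3, !sum3E by trivial; ring.
Qed.

End Asymptotics.

(** Linearity is stated through components of rank two on the chart, so that [V] need not be a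
    syntactic combination of [T] and [U]. *)
Lemma cd0_lin_2 (T U V : @tensor pt idx) (u v : R) (c a b : idx) (x : pt) :
  regT T -> regT U -> chart x ->
  (forall a b x, chart x -> V [a; b] x = u * T [a; b] x + v * U [a; b] x) ->
  cd0 V [c; a; b] x = u * cd0 T [c; a; b] x + v * cd0 U [c; a; b] x.
Proof.
  intros HT HU Hx E; rewrite !cd0_2, !sum3E, !E by trivial.
  rewrite (pd_ext_chart c _ (fun y => u * T [a; b] y + v * U [a; b] y) x Hx)
    by (intros; now apply E).
  rewrite pd_plus, !pd_scal; [ring| |]; apply reg0_ex; trivial;
    (apply reg0_mult; [apply reg0_const|]); [apply HT|apply HU].
Qed.

Lemma cd0_lin_3 (T U V : @tensor pt idx) (u v : R) (c a b d : idx) (x : pt) :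
  regT T -> regT U -> chart x ->
  (forall a b d x, chart x ->
    V [a; b; d] x = u * T [a; b; d] x + v * U [a; b; d] x) ->
  cd0 V [c; a; b; d] x = u * cd0 T [c; a; b; d] x + v * cd0 U [c; a; b; d] x.
Proof.
  intros HT HU Hx E; rewrite !cd0_3, !sum3E, !E by trivial.
  rewrite (pd_ext_chart c _ (fun y => u * T [a; b; d] y + v * U [a; b; d] y) x Hx)
    by (intros; now apply E).
  rewrite pd_plus, !pd_scal; [ring| |]; apply reg0_ex; trivial;
    (apply reg0_mult; [apply reg0_const|]); [apply HT|apply HU].
Qed.

(** * TT tensors with Laplace eigenvalue 3 *)

Definition tt_eigentensor (k : ten2 pt) : Prop :=
  (forall a b, reg0 (k a b)) /\ symmetric k /\ trace_free k /\ div_free k /\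
  forall a b x, chart x -> sum3 (fun c => sum3 (fun d =>
    ginv c d x * cd0 (cd0 (ten2_tensor k)) [c; d; a; b] x)) = 3 * k a b x.

Lemma tt_lin (k l : ten2 pt) (u v : R) :
  tt_eigentensor k -> tt_eigentensor l ->
  tt_eigentensor (fun a b x => u * k a b x + v * l a b x).
Proof.
  intros [Rk [Sk [Tk [Dk Bk]]]] [Rl [Sl [Tl [Dl Bl]]]].
  assert (HK := regT_ten2 k Rk); assert (HL := regT_ten2 l Rl).
  set (m := fun a b x => u * k a b x + v * l a b x).
  assert (E : forall c a b x, chart x -> cd0 (ten2_tensor m) [c; a; b] x =
    u * cd0 (ten2_tensor k) [c; a; b] x + v * cd0 (ten2_tensor l) [c; a; b] x)
    by (intros; now apply cd0_lin_2).
  split; [|split; [|split; [|split]]].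
  - intros a b; apply reg0_plus; apply reg0_mult; trivial; apply reg0_const.
  - intros a b x Hx; unfold m; now rewrite (Sk a b), (Sl a b).
  - intros x Hx; generalize (Tk x Hx) (Tl x Hx); unfold m; rewrite !sum3E.
    intros A B; transitivity (u * 0 + v * 0); [|ring].
    rewrite <- A at 1; rewrite <- B; ring.
  - intros x d Hx; generalize (Dk x d Hx) (Dl x d Hx); rewrite !sum3E, !E by trivial.
    intros A B; transitivity (u * 0 + v * 0); [|ring].
    rewrite <- A at 1; rewrite <- B; ring.
  - intros a b x Hx; unfold m at 2.
    transitivity (u * (3 * k a b x) + v * (3 * l a b x)); [|ring].
    rewrite <- Bk, <- Bl, !sum3E by trivial.
    rewrite !(fun c d => cd0_lin_3 _ _ (cd0 (ten2_tensor m)) u v c d a b x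
      (regT_cd0 _ HK) (regT_cd0 _ HL) Hx E); ring.
Qed.

Lemma cd0_cd0_sym (k : ten2 pt) (c d a b : idx) (x : pt) :
  symmetric k -> chart x ->
  cd0 (cd0 (ten2_tensor k)) [c; d; a; b] x =
  cd0 (cd0 (ten2_tensor k)) [c; d; b; a] x.
Proof.
  intros Hs Hx.
  set (U' := fun l : list idx => match l with
    | [d; a; b] => cd0 (ten2_tensor k) [d; b; a] | _ => fun _ => 0 end).
  transitivity (cd0 U' [c; d; a; b] x).
  - apply cd0_ext_3; trivial; intros; now apply cd0_sym_2.
  - rewrite !cd0_3 by trivial; unfold U'; ring.
Qed.

Lemma cd0_div (k : ten2 pt) (c e : idx) (x : pt) :
  (forall a b, reg0 (k a b)) -> div_free k -> chart x ->
  sum3 (fun d => sum3 (fun f =>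
    ginv d f x * cd0 (cd0 (ten2_tensor k)) [c; d; f; e] x)) = 0.
Proof.
  intros Hk Hd Hx.
  rewrite cd0_contract_1 by (trivial; apply regT_cd0; now apply regT_ten2).
  rewrite (pd_ext_chart c _ (fun _ => 0) x Hx) by (intros; now apply Hd).
  rewrite pd_const.
  rewrite (Sum_ext idxs (fun f => Gam f c e x * _) (fun _ => 0)).
  - rewrite sum3E; ring.
  - intros f; rewrite Hd by trivial; ring.
Qed.

(** The Laplacian contributes [3 k] and the double divergence 0. In the last term derivatives have
    to be commuted before the divergence appears, and each half of the symmetrisation gives [3 k];
    hence [3 - 6 = -3]. *)
Lemma delta_derivative_terms (k : ten2 pt) (a b : idx) (x : pt) :
  tt_eigentensor k -> chart x ->
  let DD c d e f := cd0 (cd0 (ten2_tensor k)) [c; d; e; f] x in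
  sum3 (fun c => sum3 (fun d => sum3 (fun e => sum3 (fun f =>
      ginv c d x * ginv a e x * ginv b f x * DD c d e f))))
  + ginv a b x * sum3 (fun c => sum3 (fun d => sum3 (fun e => sum3 (fun f =>
      ginv c e x * ginv d f x * DD c d e f))))
  - sum3 (fun d => sum3 (fun c => sum3 (fun e => sum3 (fun f =>
      ginv d f x * (ginv a c x * ginv b e x + ginv b c x * ginv a e x)
      * DD d c e f)))) = - 3 * raise0 k a b x.
Proof.
  intros [Rk [Sk [Tk [Dk Bk]]]] Hx DD.
  assert (S1 : forall c d e f, DD c d e f = DD c d f e)
    by (intros; now apply cd0_cd0_sym).
  transitivity (
    sum3 (fun e => sum3 (fun f => ginv a e x * ginv b f x *
      sum3 (fun c => sum3 (fun d => ginv c d x * DD c d e f))))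
    + ginv a b x * sum3 (fun c => sum3 (fun e => ginv c e x *
      sum3 (fun d => sum3 (fun f => ginv d f x * DD c d f e))))
    - sum3 (fun c => sum3 (fun e =>
       (ginv a c x * ginv b e x + ginv b c x * ginv a e x) *
       sum3 (fun d => sum3 (fun f => ginv d f x * DD d c f e))))).
  { f_equal; [f_equal|].
    - rewrite !sum3E; ring.
    - rewrite !sum3E.
      rewrite !(fun c d => S1 c d theta tau), !(fun c d => S1 c d phi tau),
        !(fun c d => S1 c d phi theta); ring.
    - rewrite !sum3E.
      rewrite !(fun c d => S1 c d theta tau), !(fun c d => S1 c d phi tau),
        !(fun c d => S1 c d phi theta); ring. }
  assert (F1 : forall e f, sum3 (fun c => sum3 (fun d =>
    ginv c d x * DD c d e f)) = 3 * k e f x) by (intros; now apply Bk).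
  assert (F2 : forall c e, sum3 (fun d => sum3 (fun f =>
    ginv d f x * DD c d f e)) = 0) by (intros; now apply cd0_div).
  assert (F3 : forall c e, sum3 (fun d => sum3 (fun f =>
    ginv d f x * DD d c f e)) = 3 * k c e x)
    by (intros; now apply div_cd0_swapped).
  transitivity (
    sum3 (fun e => sum3 (fun f => ginv a e x * ginv b f x * (3 * k e f x)))
    + ginv a b x * sum3 (fun c => sum3 (fun e => ginv c e x * 0))
    - sum3 (fun c => sum3 (fun e =>
       (ginv a c x * ginv b e x + ginv b c x * ginv a e x) * (3 * k c e x)))).
  { f_equal; [f_equal; [|f_equal]|]; apply Sum_ext; intros; apply Sum_ext;
      intros; now rewrite ?F1, ?F2, ?F3. }
  unfold raise0; rewrite !sum3E.
  rewrite !(Sk theta tau), !(Sk phi tau), !(Sk phi theta) by trivial; ring.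
Qed.

(** * The tensor Khat *)

Lemma contract_trace_adjust (X : idx -> idx -> R) (u : R) (x : pt) :
  chart x ->
  sum3 (fun c => sum3 (fun d => ginv c d x * (X c d + h0 c d x * u))) =
  sum3 (fun c => sum3 (fun d => ginv c d x * X c d)) + 3 * u.
Proof. intros Hx; rewrite !sum3E; unfold ginv, h0; trig_field x Hx. Qed.

Section Khat.
Variables (sigma : pt -> R) (k h1 : ten2 pt) (h Kh : ten2 pt4).
Hypothesis h_asymptotics : beig_schmidt sigma h1 h.
Hypothesis sigma_reg : reg0 sigma.
Hypothesis sigma_eq : forall x, chart x ->
  box0 (scalar_tensor sigma) [] x + 3 * sigma x = 0.
Hypothesis k_reg : forall a b, reg0 (k a b).
Hypothesis k_sym : symmetric k.
Hypothesis k_trace : trace_free k.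
Hypothesis k_div : div_free k.
Hypothesis k_eq : forall a b x, chart x ->
  box0 (ten2_tensor k) [a; b] x - 3 * k a b x = 0.
Hypothesis h1_eq : forall a b x, chart x ->
  h1 a b x = k a b x + (-2) * (sigma x * h0 a b x).
Hypothesis Kh_spec : is_Khat h Kh.

Let h1r := h1_reg sigma k h1 sigma_reg k_reg h1_eq.
Let h1s := h1_sym sigma k h1 k_sym h1_eq.

(** Written with both coefficients explicit, to match [tt_lin]. *)
Definition psi : ten2 pt := fun a b x => - / 2 * k a b x + 1 * psi0 sigma a b x.

Lemma k_tt : tt_eigentensor k.
Proof.
  repeat split; trivial; intros a b x Hx; now apply k_box.
Qed.

Lemma psi0_tt : tt_eigentensor (psi0 sigma).
Proof.
  split; [now apply psi0_reg|split; [now apply psi0_sym|]].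
  split; [now apply psi0_trace_free|split; [now apply psi0_div_free|]].
  intros a b x Hx; now apply psi0_box.
Qed.

Lemma psi_tt : tt_eigentensor psi.
Proof. apply tt_lin; [exact k_tt|exact psi0_tt]. Qed.

Let E (a b : idx) : pt4 -> R := fun p => Kh a b p - fst p * h0 a b (snd p).

Lemma Kh_remainder_sym (a b : idx) (p : pt4) : E a b p = E b a p.
Proof. unfold E; now rewrite (proj1 Kh_spec), h0_sym. Qed.

Lemma Kh_remainder_reg (a b : idx) : reg (E a b).
Proof.
  assert (H := asympO_reg _ _ (proj1 (proj2 Kh_spec) a b)).
  revert H; apply reg_ext; evx r x Hx Hr; unfold E; simpl; ring.
Qed.

(** The whole remainder serves as a [rho]-dependent first coefficient, since no limit for it is
    available yet. *)
Lemma expands_Kh_leading (a b : idx) : expands 1 (Kh a b) (lift (h0 a b)) (E a b).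
Proof.
  split; [apply reg0_h0|split; [apply Kh_remainder_reg|]].
  exists (fun _ => 0); split; [apply reg_const|].
  evx r x Hx Hr; unfold E; simpl; field; lra.
Qed.

Let trE (p : pt4) := sum3 (fun c => sum3 (fun d => ginv c d (snd p) * E c d p)).
Let trh1 (x : pt) := sum3 (fun c => sum3 (fun d => ginv c d x * h1 c d x)).

(** The quadratic right-hand side linearised at [rho h0]: [3 E + h0 (tr E - tr h1)] from the trace
    term, minus [2 E - h1] from the square, where [h1] enters through the inverse metric. *)
Lemma expands_Khat_equation (a b : idx) :
  expands 0 (fun p => Kh a b p * trace h Kh p
     - sum3 (fun c => mixed h Kh a c p * Kh c b p))
    (lift (fun x => 2 * h0 a b x))
    (fun p => E a b p + h0 a b (snd p) * (trE p - trh1 (snd p))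
              + h1 a b (snd p)).
Proof.
  unfold trace, mixed.
  eapply expands_coef; [exps ltac:(first [apply expands_Kh_leading
    |apply (expands_inv_h sigma h1 h h_asymptotics h1r h1s)])|reflexivity| |].
  - evx r x Hx Hr; destruct a, b; unfold ginv, h0; trig_field x Hx.
  - evx r x Hx Hr; unfold trE, trh1, raise0; cbn [fst snd].
    assert (HE : forall a b, E a b (r, x) = E b a (r, x))
      by (intros; apply Kh_remainder_sym).
    revert HE; generalize (fun a b => E a b (r, x)); intros e HE.
    rewrite !sum3E, !(HE theta tau), !(HE phi tau), !(HE phi theta).
    rewrite !(h1s theta tau x Hx), !(h1s phi tau x Hx), !(h1s phi theta x Hx).
    destruct a, b; rewrite ?(HE theta tau), ?(HE phi tau), ?(HE phi theta),
      ?(h1s theta tau x Hx), ?(h1s phi tau x Hx), ?(h1s phi theta x Hx);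
      unfold ginv, h0; trig_field x Hx.
Qed.

Lemma h1_trace (x : pt) : chart x -> trh1 x = - 6 * sigma x.
Proof.
  intros Hx; unfold trh1.
  rewrite (Sum_ext idxs _ (fun c => sum3 (fun d => ginv c d x *
    (k c d x + h0 c d x * (-2 * sigma x))))).
  - rewrite contract_trace_adjust, k_trace by trivial; ring.
  - intros c; apply Sum_ext; intros d; rewrite h1_eq by trivial; ring.
Qed.

(** Comparing first orders with the Ricci tensor shows that the error [X] of the expected
    coefficient satisfies [X + h0 tr X = O(1/rho)]. The trace of this gives [4 tr X = O(1/rho)],
    hence [X = O(1/rho)]. *)
Lemma expands_Kh (a b : idx) :
  expands 1 (Kh a b) (lift (h0 a b)) (lift (fun x => psi a b x + h1 a b x)).
Proof.
  assert (G : forall a b, reg (fun p => (lift (ric1 h1 a b) p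
    - (E a b p + h0 a b (snd p) * (trE p - trh1 (snd p)) + h1 a b (snd p)))
    * fst p)).
  { clear a b; intros a b.
    eapply expands_unique; [|apply expands_Khat_equation].
    eapply expands_ext; [apply (expands_ricci sigma h1 h h_asymptotics h1r h1s)
      |reflexivity| |evx r x Hx Hr; reflexivity|evx r x Hx Hr; reflexivity].
    generalize (proj2 (proj2 Kh_spec)); apply ev_mono.
    (* [ricci3], built on slices of fixed [rho], is convertible to [ricci] formed with [sp]. *)
    intros r x _ _ A; specialize (A a b); rewrite <- A; reflexivity. }
  set (X := fun a b p => E a b p - (psi a b (snd p) + h1 a b (snd p))).
  assert (G' : forall a b r x, chart x -> lift (ric1 h1 a b) (r, x)
    - (E a b (r, x) + h0 a b x * (trE (r, x) - trh1 x) + h1 a b x)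
    = - (X a b (r, x) + h0 a b x * sum3 (fun c => sum3 (fun d =>
         ginv c d x * X c d (r, x))))).
  { clear a b; intros a b r x Hx; unfold lift; cbn [snd].
    rewrite (linearised_ricci sigma k h1) by trivial.
    assert (T : sum3 (fun c => sum3 (fun d => ginv c d x * X c d (r, x)))
      = trE (r, x) - trh1 x).
    { destruct psi_tt as [_ [_ [Tp _]]]; generalize (Tp x Hx).
      unfold trE, trh1, X; cbn [snd]; rewrite !sum3E; lra. }
    rewrite T, !h1_trace by trivial; unfold X, psi, psi0; cbn [snd].
    rewrite !h1_eq by trivial; field. }
  apply (expands_next _ _ _ _ _ (expands_Kh_leading a b)).
  { apply reg0_plus; [apply psi_tt|apply h1r]. }
  (* The inverse of [X |-> X + h0 tr X], namely [Y |-> Y - h0 tr Y / 4], is applied to the regular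
     quantity from [G]; the signs reflect that [G'] produces [- Y]. *)
  apply (reg_ext (fun p => - ((lift (ric1 h1 a b) p
    - (E a b p + h0 a b (snd p) * (trE p - trh1 (snd p)) + h1 a b (snd p)))
    * fst p) + / 4 * (h0 a b (snd p) * sum3 (fun c => sum3 (fun d =>
      ginv c d (snd p) * ((lift (ric1 h1 c d) p
    - (E c d p + h0 c d (snd p) * (trE p - trh1 (snd p)) + h1 c d (snd p)))
    * fst p)))))).
  - apply ev_intro; intros r x Hx Hr; cbn [fst snd].
    rewrite !G' by trivial.
    set (t := sum3 (fun c => sum3 (fun d => ginv c d x * X c d (r, x)))).
    rewrite (Sum_ext idxs (fun c => sum3 _) (fun c => sum3 (fun d =>
      ginv c d x * ((- r * X c d (r, x)) + h0 c d x * (- r * t))))).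
    2:{ intros c; apply Sum_ext; intros d; rewrite G' by trivial; fold t; ring. }
    rewrite contract_trace_adjust by trivial.
    rewrite (Sum_ext idxs (fun c => sum3 (fun d => ginv c d x * _))
      (fun c => - r * sum3 (fun d => ginv c d x * X c d (r, x)))).
    2:{ intros c; rewrite <- Sum_scal; apply Sum_ext; intros d; ring. }
    rewrite Sum_scal; fold t; unfold X, lift; cbn [snd]; field.
  - apply reg_plus; [now apply reg_opp|apply reg_scal].
    apply (reg_mult (lift (h0 a b))); [apply reg0_h0|].
    apply reg_sum; intros c; apply reg_sum; intros d.
    apply (reg_mult (lift (ginv c d))); [apply reg0_ginv|apply G].
Qed.

End Khat.

(** * The tensors Ltilde and Delta *)

Lemma raise0_sym (k : ten2 pt) (a b : idx) (x : pt) :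
  symmetric k -> chart x -> raise0 k a b x = raise0 k b a x.
Proof.
  intros Hs Hx; unfold raise0; rewrite !sum3E.
  rewrite !(Hs theta tau), !(Hs phi tau), !(Hs phi theta) by trivial; ring.
Qed.

Lemma sum3_contract_assoc (t : idx -> idx -> R)
    (L : idx -> idx -> idx -> idx -> R) (M : idx -> idx -> R) :
  sum3 (fun e => sum3 (fun f =>
    sum3 (fun a => sum3 (fun b => t a b * L a b e f)) * M e f)) =
  sum3 (fun a => sum3 (fun b =>
    t a b * sum3 (fun e => sum3 (fun f => L a b e f * M e f)))).
Proof. rewrite !sum3E; ring. Qed.

Section Expansion.
Variables (h1 ps : ten2 pt) (h Kh : ten2 pt4) (Li : idx -> idx -> ten2 pt4).
Hypothesis h1r : forall a b, reg0 (h1 a b).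
Hypothesis h1s : symmetric h1.
Hypothesis ps_tt : tt_eigentensor ps.
Hypothesis h_sym : forall a b p, h a b p = h b a p.
Hypothesis h_exp : forall a b,
  expands 2 (h a b) (lift (h0 a b)) (lift (h1 a b)).
Hypothesis det_neq : ev (fun p => det h p <> 0).
Hypothesis inv_exp : forall a b,
  expands (-2) (inv h a b) (lift (ginv a b)) (lift (fun x => - raise0 h1 a b x)).
Hypothesis covd_2_exp : forall n T m c a b,
  (forall a b, expands n (T [a; b]) (fun _ => 0) (lift (m [a; b]))) ->
  expands n (covd idxs sp h (inv h) T [c; a; b]) (fun _ => 0)
    (lift (cd0 m [c; a; b])).
Hypothesis covd_3_exp : forall n T m c a b d,
  (forall a b d, expands n (T [a; b; d]) (fun _ => 0) (lift (m [a; b; d]))) ->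
  expands n (covd idxs sp h (inv h) T [c; a; b; d]) (fun _ => 0)
    (lift (cd0 m [c; a; b; d])).
Hypothesis Kh_exp : forall a b,
  expands 1 (Kh a b) (lift (h0 a b)) (lift (fun x => ps a b x + h1 a b x)).
Hypothesis Li_spec : is_Linv h Kh Li.

Let ps_reg : forall a b, reg0 (ps a b) := proj1 ps_tt.
Let ps_sym : symmetric ps := proj1 (proj2 ps_tt).
Let ps_trace : trace_free ps := proj1 (proj2 (proj2 ps_tt)).

(** Solving the trace condition for one component lets [algebra] treat the remaining ones as
    independent. *)
Lemma ps_tau_tau (x : pt) : chart x -> ps tau tau x =
  / cosh (x tau) * / cosh (x tau) * (ps theta theta x
    + / sin (x theta) * / sin (x theta) * ps phi phi x).
Proof.
  intros Hx; generalize (ps_trace x Hx); rewrite !sum3E; unfold ginv; lra.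
Qed.

Ltac algebra x Hx :=
  unfold raise0; rewrite ?sum3E;
  rewrite ?(ps_sym theta tau x Hx), ?(ps_sym phi tau x Hx),
    ?(ps_sym phi theta x Hx), ?(h1s theta tau x Hx), ?(h1s phi tau x Hx),
    ?(h1s phi theta x Hx), ?(ps_tau_tau x Hx);
  unfold ginv, h0, delta; simpl idx_eq_dec; cbv iota; trig_field x Hx.

(** Raising an index removes [h1]: the part [h / rho] of [Khat] becomes a multiple of the identity,
    and only [ps] is left at first order. *)
Lemma expands_mixed (a c : idx) :
  expands (-1) (mixed h Kh a c) (fun _ => delta a c)
    (lift (fun x => sum3 (fun e => ginv c e x * ps a e x))).
Proof.
  unfold mixed.
  eapply expands_coef; [exps ltac:(first [apply Kh_exp|apply inv_exp])
    |reflexivity| |].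
  - evx r x Hx Hr; destruct a, c; algebra x Hx.
  - evx r x Hx Hr; destruct a, c; algebra x Hx.
Qed.

Lemma expands_trace : expands (-1) (trace h Kh) (fun _ => 3) (fun _ => 0).
Proof.
  unfold trace.
  eapply expands_coef; [exps ltac:(first [apply Kh_exp|apply inv_exp])
    |reflexivity| |].
  - evx r x Hx Hr; algebra x Hx.
  - evx r x Hx Hr; algebra x Hx.
Qed.

Lemma expands_raise (a b : idx) :
  expands (-3) (raise h Kh a b) (lift (ginv a b))
    (lift (fun x => raise0 ps a b x - raise0 h1 a b x)).
Proof.
  unfold raise.
  eapply expands_coef; [exps ltac:(first [apply Kh_exp|apply inv_exp])
    |reflexivity| |].
  - evx r x Hx Hr; destruct a, b; algebra x Hx.
  - evx r x Hx Hr; destruct a, b; algebra x Hx.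
Qed.

Lemma expands_Lop (a b c d : idx) :
  expands (-1) (Lop h Kh a b c d)
    (lift (fun x => ginv c d x * h0 a b x
      + / 2 * (delta c a * delta d b + delta c b * delta d a)))
    (lift (fun x => ginv c d x * (ps a b x + h1 a b x)
      - raise0 h1 c d x * h0 a b x
      - / 2 * (delta c a * sum3 (fun e => ginv d e x * ps b e x)
               + delta c b * sum3 (fun e => ginv d e x * ps a e x))
      - / 2 * (delta d a * sum3 (fun e => ginv c e x * ps b e x)
               + delta d b * sum3 (fun e => ginv c e x * ps a e x)))).
Proof.
  unfold Lop, Rdiv.
  eapply expands_coef; [exps ltac:(first [apply Kh_exp|apply inv_exp
    |apply expands_mixed|apply expands_trace])|reflexivity| |].
  - evx r x Hx Hr; unfold delta; destruct (idx_eq_dec c a), (idx_eq_dec c b),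
      (idx_eq_dec d a), (idx_eq_dec d b), (idx_eq_dec b d), (idx_eq_dec a d),
      (idx_eq_dec b c), (idx_eq_dec a c); try congruence; field.
  - evx r x Hx Hr; unfold delta; destruct (idx_eq_dec c a), (idx_eq_dec c b),
      (idx_eq_dec d a), (idx_eq_dec d b); field.
Qed.

(** To this order [h^{ab} L_ab^{cd} = 2 (tr Khat) h^{cd} - 2 Khat^{cd} = (4 / rho) h^{cd} - 2
    ps^{cd}]. Thus [rho / 4] times the inverse metric solves the equation up to a multiple of [ps],
    which the summand with [/ 2] compensates; [- / 4 * raise0 h1] comes from expanding that inverse
    metric. *)
Definition Lt1 : ten2 pt := fun a b x =>
  / 2 * raise0 ps a b x - / 4 * raise0 h1 a b x.

Lemma Lt1_reg (a b : idx) : reg0 (Lt1 a b).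
Proof.
  apply reg0_minus; apply reg0_mult; try apply reg0_const;
    now apply raise0_reg.
Qed.

(* Contracting this with L gives h^{ab} up to relative order rho^-2, and applying
   L^-1 then identifies it with Ltilde to that order. *)
Definition Lt_trial : ten2 pt4 := fun a b p =>
  / fst p * (/ 4 * ginv a b (snd p) + Lt1 a b (snd p) * / fst p).

Lemma expands_Lt_trial (a b : idx) :
  expands (-1) (Lt_trial a b) (lift (fun x => / 4 * ginv a b x)) (lift (Lt1 a b)).
Proof.
  apply (expands_poly (lift (fun x => / 4 * ginv a b x)) (lift (Lt1 a b))).
  - apply (reg0_mult (fun _ => / 4)); [apply reg0_const|apply reg0_ginv].
  - apply Lt1_reg.
Qed.

Lemma Lt_trial_sym (a b : idx) (r : R) (x : pt) : chart x ->
  Lt_trial a b (r, x) = Lt_trial b a (r, x).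
Proof.
  intros Hx; unfold Lt_trial, Lt1; cbn [fst snd].
  now rewrite (ginv_sym a b), (raise0_sym ps a b), (raise0_sym h1 a b).
Qed.

Lemma expands_Lt_trial_Lop (e f : idx) :
  expands (-2) (fun p => sum3 (fun a => sum3 (fun b =>
      Lt_trial a b p * Lop h Kh a b e f p)))
    (lift (ginv e f)) (lift (fun x => - raise0 h1 e f x)).
Proof.
  eapply expands_coef; [exps ltac:(first [apply expands_Lt_trial
    |apply expands_Lop])|reflexivity| |].
  - evx r x Hx Hr; destruct e, f; algebra x Hx.
  - evx r x Hx Hr; unfold Lt1; destruct e, f; algebra x Hx.
Qed.

(** Only the order of [Li] is known, so its rescaling itself is taken as the leading coefficient. *)
Lemma expands_Li (a b c d : idx) :
  expands 1 (Li a b c d) (fun p => powerRZ (fst p) (- 1) * Li a b c d p)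
    (fun _ => 0).
Proof.
  split; [exact (asympO_reg 1 _ (proj1 Li_spec a b c d))|split; [apply reg_const|]].
  exists (fun _ => 0); split; [apply reg_const|].
  evx r x Hx Hr; simpl; field; lra.
Qed.

Lemma expands_Ltilde (c d : idx) :
  expands (-1) (Ltilde h Li c d) (lift (fun x => / 4 * ginv c d x))
    (lift (Lt1 c d)).
Proof.
  (* The defect of the trial solution. Both its coefficients vanish, so after multiplication by
     [Li], of order [rho], it still affects neither coefficient at order [rho^-1]. *)
  set (D := fun e f p => sum3 (fun a => sum3 (fun b =>
      Lt_trial a b p * Lop h Kh a b e f p)) - inv h e f p).
  assert (HD : forall e f, expands (-2) (D e f) (fun _ => 0) (fun _ => 0)).
  { intros e f; eapply expands_coef; [eapply expands_minus;
      [apply expands_Lt_trial_Lop|apply inv_exp|reflexivity|reflexivity]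
      |reflexivity| |]; evx r x Hx Hr; ring. }
  eapply expands_ext with (F := fun p => Lt_trial c d p
    - sum3 (fun e => sum3 (fun f => D e f p * Li e f c d p)));
    [exps ltac:(first [apply expands_Lt_trial|apply HD|apply expands_Li])
    |reflexivity| | |].
  - generalize (proj2 Li_spec); apply ev_mono; intros r x Hx _ A.
    unfold D.
    transitivity (Lt_trial c d (r, x) - (sum3 (fun e => sum3 (fun f =>
      sum3 (fun a => sum3 (fun b => Lt_trial a b (r, x) *
        Lop h Kh a b e f (r, x))) * Li e f c d (r, x)))
      - Ltilde h Li c d (r, x))).
    + unfold Ltilde; rewrite !(sum3E (fun _ => Sum idxs _)), !sum3E; ring.
    + rewrite (sum3_contract_assoc (fun a b => Lt_trial a b (r, x))
        (fun a b e f => Lop h Kh a b e f (r, x))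
        (fun e f => Li e f c d (r, x))).
      rewrite (Sum_ext idxs _ (fun a => sum3 (fun b => Lt_trial a b (r, x) *
        ((delta a c * delta b d + delta a d * delta b c) / 2)))).
      2:{ intros a; apply Sum_ext; intros b; f_equal; apply A. }
      assert (S := Lt_trial_sym).
      rewrite !sum3E; unfold delta; destruct c, d; simpl idx_eq_dec; cbv iota;
        rewrite ?(S theta tau r x Hx), ?(S phi tau r x Hx),
          ?(S phi theta r x Hx); field.
  - evx r x Hx Hr; ring.
  - evx r x Hx Hr; ring.
Qed.

(** * Derivatives of Ltilde and the cancellation in Delta *)

Definition half_ps : ten2 pt := fun a b x => / 2 * ps a b x + 0 * ps a b x.

Lemma half_ps_tt : tt_eigentensor half_ps.
Proof. now apply tt_lin. Qed.

Definition low : ten2 pt4 := lower h (Ltilde h Li).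
(* subtracting a multiple of the metric does not change covariant derivatives
   and leaves no term of leading order *)
Definition low' : ten2 pt4 := fun a b p => low a b p - / 4 * (fst p * h a b p).

Lemma expands_fst : expands 1 (fun p => fst p) (fun _ => 1) (fun _ => 0).
Proof.
  eapply expands_ext; [apply (expands_radius 1)|reflexivity|evx r x Hx Hr
    |evx r x Hx Hr; reflexivity|evx r x Hx Hr; reflexivity].
  simpl; ring.
Qed.

Lemma expands_low' (a b : idx) :
  expands 3 (low' a b) (fun _ => 0) (lift (half_ps a b)).
Proof.
  unfold low', low, lower.
  eapply expands_coef; [exps ltac:(first [apply expands_fst|apply h_exp
    |apply expands_Ltilde])|reflexivity| |].
  - evx r x Hx Hr; destruct a, b; algebra x Hx.
  - evx r x Hx Hr; unfold Lt1, half_ps; destruct a, b; algebra x Hx.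
Qed.

Lemma covd_low (c a b : idx) : ev (fun p =>
  covd idxs sp h (inv h) (ten2_tensor low) [c; a; b] p =
  covd idxs sp h (inv h) (ten2_tensor low') [c; a; b] p).
Proof.
  generalize det_neq (ev_and _ _ (expands_ex _ _ _ _ (h_exp a b))
    (expands_ex _ _ _ _ (expands_low' a b))).
  apply ev_mono2; intros r x Hx Hr Hd [X1 X2].
  specialize (X1 c); specialize (X2 c); unfold ex_pd4 in X1, X2.
  assert (C := covd_metric h c a b (r, x) h_sym Hd).
  rewrite covd_2 in C; rewrite !covd_2.
  assert (P : sp c (low a b) (r, x) =
    sp c (low' a b) (r, x) + / 4 * r * sp c (h a b) (r, x)).
  { unfold sp, pd4; cbn [fst snd] in *.
    rewrite <- pd_scal, <- pd_plus; trivial.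
    - apply pd_ext_loc, filter_forall; intros y; unfold low'; simpl; ring.
    - apply ex_pd_mult; [apply ex_pd_const|exact X1]. }
  assert (Q : forall a b, low a b (r, x) = low' a b (r, x) + / 4 * r * h a b (r, x))
    by (intros; unfold low'; simpl; ring).
  rewrite !ten2_tensor_at in *; rewrite !sum3E in *; rewrite P, !ten2_tensor_at in *.
  rewrite !Q.
  (* At fixed [rho] the factor [/ 4 * r] is constant along dS_3, so [low] and [low'] have
     derivatives differing by this multiple of the derivative of [h], which is zero. *)
  match type of C with ?t = 0 => transitivity
   (sp c (low' a b) (r, x) -
     (christoffel idxs sp h (inv h) tau c a (r, x) * low' tau b (r, x) +
      christoffel idxs sp h (inv h) theta c a (r, x) * low' theta b (r, x) +
      christoffel idxs sp h (inv h) phi c a (r, x) * low' phi b (r, x)) -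
     (christoffel idxs sp h (inv h) tau c b (r, x) * low' a tau (r, x) +
      christoffel idxs sp h (inv h) theta c b (r, x) * low' a theta (r, x) +
      christoffel idxs sp h (inv h) phi c b (r, x) * low' a phi (r, x))
    + / 4 * r * t) end; [ring|rewrite C; ring].
Qed.

Definition DDL (c d e f : idx) : pt4 -> R :=
  covd idxs sp h (inv h) (covd idxs sp h (inv h) (ten2_tensor low)) [c; d; e; f].

Lemma expands_DDL (c d e f : idx) :
  expands 3 (DDL c d e f) (fun _ => 0)
    (lift (cd0 (cd0 (ten2_tensor half_ps)) [c; d; e; f])).
Proof.
  unfold DDL; apply covd_3_exp; clear c d e f; intros c a b.
  eapply expands_ext; [apply (covd_2_exp 3 (ten2_tensor low')
    (ten2_tensor half_ps) c a b)|reflexivity| | |].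
  - intros; apply expands_low'.
  - generalize (covd_low c a b); apply ev_mono; intros r x _ _ A; now symmetry.
  - evx r x Hx Hr; reflexivity.
  - evx r x Hx Hr; reflexivity.
Qed.

Definition Delta4 (a b : idx) : pt4 -> R := fun p =>
  raise h Kh a b p
  - 2 * sum3 (fun c => sum3 (fun d => Ltilde h Li c d p *
          (Kh c d p * raise h Kh a b p - mixed h Kh c a p * mixed h Kh d b p)))
  + sum3 (fun c => sum3 (fun d => sum3 (fun e => sum3 (fun f =>
      inv h c d p * inv h a e p * inv h b f p * DDL c d e f p))))
  + inv h a b p * sum3 (fun c => sum3 (fun d => sum3 (fun e => sum3 (fun f =>
      inv h c e p * inv h d f p * DDL c d e f p))))
  - sum3 (fun d => sum3 (fun c => sum3 (fun e => sum3 (fun f =>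
      inv h d f p * (inv h a c p * inv h b e p + inv h b c p * inv h a e p)
      * DDL d c e f p)))).

(** Holds by conversion because [sp] differentiates at fixed [rho], as do the slices in [Delta]. *)
Lemma Delta_Delta4 (a b : idx) (r : R) (x : pt) :
  Delta h Kh Li r a b x = Delta4 a b (r, x).
Proof. reflexivity. Qed.

Lemma sum3_0 (F : idx -> R) : (forall i, F i = 0) -> sum3 F = 0.
Proof. intros H; rewrite sum3E, !H; ring. Qed.

(** Peels the sums off one by one and compares summands, which avoids expanding all 81 terms of a
    fourfold sum. *)
Ltac sums_ring := cbv beta; repeat (first [apply sum3_0 | apply Sum_ext]; intros ?;
  cbv beta); unfold lift; cbn [fst snd]; ring.

Notation DDh := (cd0 (cd0 (ten2_tensor half_ps))).

Lemma expands_delta_box (a b : idx) :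
  expands (-3) (fun p =>
    sum3 (fun c => sum3 (fun d => sum3 (fun e => sum3 (fun f =>
      inv h c d p * inv h a e p * inv h b f p * DDL c d e f p)))))
    (fun _ => 0)
    (lift (fun x => sum3 (fun c => sum3 (fun d => sum3 (fun e => sum3 (fun f =>
      ginv c d x * ginv a e x * ginv b f x * DDh [c; d; e; f] x)))))).
Proof.
  eapply expands_coef; [exps ltac:(first [apply expands_DDL|apply inv_exp])
    |reflexivity| |]; apply ev_intro; intros r x _ _.
  - sums_ring.
  - sums_ring.
Qed.

Lemma expands_delta_div (a b : idx) :
  expands (-3) (fun p => inv h a b p *
    sum3 (fun c => sum3 (fun d => sum3 (fun e => sum3 (fun f =>
      inv h c e p * inv h d f p * DDL c d e f p)))))
    (fun _ => 0)
    (lift (fun x => ginv a b x *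
    sum3 (fun c => sum3 (fun d => sum3 (fun e => sum3 (fun f =>
      ginv c e x * ginv d f x * DDh [c; d; e; f] x)))))).
Proof.
  assert (X : expands (-1) (fun p =>
    sum3 (fun c => sum3 (fun d => sum3 (fun e => sum3 (fun f =>
      inv h c e p * inv h d f p * DDL c d e f p)))))
    (fun _ => 0)
    (lift (fun x =>
    sum3 (fun c => sum3 (fun d => sum3 (fun e => sum3 (fun f =>
      ginv c e x * ginv d f x * DDh [c; d; e; f] x))))))).
  { eapply expands_coef; [exps ltac:(first [apply expands_DDL|apply inv_exp])
      |reflexivity| |]; apply ev_intro; intros r x _ _; sums_ring. }
  eapply expands_coef; [eapply expands_mult; [apply inv_exp|exact X]
    |reflexivity| |]; apply ev_intro; intros r x _ _; unfold lift;
    cbn [snd]; ring.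
Qed.

Lemma expands_delta_mixed (a b : idx) :
  expands (-3) (fun p =>
    sum3 (fun d => sum3 (fun c => sum3 (fun e => sum3 (fun f =>
      inv h d f p * (inv h a c p * inv h b e p + inv h b c p * inv h a e p)
      * DDL d c e f p)))))
    (fun _ => 0)
    (lift (fun x =>
    sum3 (fun d => sum3 (fun c => sum3 (fun e => sum3 (fun f =>
      ginv d f x * (ginv a c x * ginv b e x + ginv b c x * ginv a e x)
      * DDh [d; c; e; f] x)))))).
Proof.
  eapply expands_coef; [exps ltac:(first [apply expands_DDL|apply inv_exp])
    |reflexivity| |]; apply ev_intro; intros r x _ _; sums_ring.
Qed.

(** The leading part is [1 - 2 (3 - 1) / 4 = 0] times [ginv]. At first order, the terms linear in
    [ps] are [1 - 3 / 2] from those proportional to [Khat^{ab}] and [2] from the product of two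
    mixed tensors with [Ltilde]. *)
Lemma expands_delta_algebraic (a b : idx) :
  expands (-3) (fun p => raise h Kh a b p
  - 2 * sum3 (fun c => sum3 (fun d => Ltilde h Li c d p *
          (Kh c d p * raise h Kh a b p - mixed h Kh c a p * mixed h Kh d b p))))
    (fun _ => 0) (lift (fun x => 3 / 2 * raise0 ps a b x)).
Proof.
  eapply expands_coef; [exps ltac:(first [apply expands_raise
    |apply expands_mixed|apply expands_Ltilde|apply Kh_exp])|reflexivity| |].
  - evx r x Hx Hr; destruct a, b; algebra x Hx.
  - evx r x Hx Hr; unfold Lt1; destruct a, b; algebra x Hx.
Qed.

Lemma expands_Delta (a b : idx) :
  expands (-3) (fun p => Delta h Kh Li (fst p) a b (snd p)) (fun _ => 0)
    (fun _ => 0).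
Proof.
  eapply expands_ext with (F := Delta4 a b);
    [|reflexivity|apply ev_intro; intros r x _ _; symmetry;
      exact (Delta_Delta4 a b r x)| |].
  - eapply expands_minus; [|apply expands_delta_mixed|reflexivity|reflexivity].
    eapply expands_plus; [|apply expands_delta_div|reflexivity|reflexivity].
    eapply expands_plus; [|apply expands_delta_box|reflexivity|reflexivity].
    apply expands_delta_algebraic.
  - apply ev_intro; intros; ring.
  - apply ev_intro; intros r x Hx Hr; unfold lift; cbn [snd].
    assert (A := delta_derivative_terms half_ps a b x half_ps_tt Hx).
    cbv zeta in A.
    assert (B : raise0 half_ps a b x = / 2 * raise0 ps a b x)
      by (unfold raise0, half_ps; rewrite !sum3E; ring).
    (* The derivative terms contribute [- 3] times one half of [ps], cancelling the algebraic
       [3 / 2]. *)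
    rewrite B in A; lra.
Qed.
End Expansion.

(** * The limit of the variation *)

Lemma first_order_facts (sigma : pt -> R) (k : ten2 pt) :
  first_order_data sigma k ->
  reg0 sigma /\
  (forall x, chart x -> box0 (scalar_tensor sigma) [] x + 3 * sigma x = 0) /\
  (forall a b, reg0 (k a b)) /\ symmetric k /\ trace_free k /\ div_free k /\
  (forall a b x, chart x -> box0 (ten2_tensor k) [a; b] x - 3 * k a b x = 0).
Proof.
  intros [Hs [Hk H]].
  split; [exact (smooth_reg0 _ Hs)|].
  split; [intros x Hx; exact (proj1 (proj2 (H x Hx)))|].
  split; [intros a b; exact (smooth_reg0 _ (Hk a b))|].
  split; [intros a b x Hx; exact (proj1 (H x Hx) a b)|].
  split; [|split].
  - intros x Hx; destruct (H x Hx) as [_ [_ [_ [T _]]]].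
    rewrite <- T; unfold trace; apply Sum_ext; intros a; apply Sum_ext; intros b.
    now rewrite inv_h0.
  - intros x d Hx; destruct (H x Hx) as [_ [_ [_ [_ T]]]].
    rewrite <- (T d), Sum_comm; apply Sum_ext; intros a; apply Sum_ext; intros b.
    now rewrite inv_h0, ginv_sym.
  - intros a b x Hx; exact (proj1 (proj2 (proj2 (H x Hx))) a b).
Qed.

Lemma vol_h0 (x : pt) : chart x ->
  vol h0 x = cosh (x tau) * cosh (x tau) * sin (x theta).
Proof.
  intros Hx; unfold vol; rewrite det_h0.
  assert (S : 0 < sin (x theta)) by (apply sin_gt_0; apply Hx).
  replace (- (- cosh (x tau) ^ 4 * sin (x theta) ^ 2)) with
    ((cosh (x tau) * cosh (x tau) * sin (x theta)) *
     (cosh (x tau) * cosh (x tau) * sin (x theta))) by ring.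
  apply sqrt_square, Rmult_le_pos; [apply Rle_0_sqr|lra].
Qed.

Lemma vol_h0_pos (x : pt) : chart x -> 0 < vol h0 x.
Proof.
  intros Hx; rewrite vol_h0 by trivial.
  apply Rmult_lt_0_compat; [|apply sin_gt_0; apply Hx].
  apply (Rsqr_pos_lt _ (cosh_neq _)).
Qed.

Lemma reg0_vol_h0 : reg0 (vol h0).
Proof.
  apply (reg0_ext (fun x => cosh (x tau) * cosh (x tau) * sin (x theta))).
  - intros; now rewrite vol_h0.
  - smooth0.
Qed.

(** No sign of [v * v - t] is assumed. Where it is nonnegative, the difference of squares gives the
    bound; where it is negative, [sqrt] takes the value 0 and [t > v * v] already makes the right
    side exceed [v]. *)
Lemma sqrt_perturbation (v t : R) : 0 < v ->
  Rabs (sqrt (v * v - t) - v) <= Rabs (t * / v).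
Proof.
  intros Hv; set (u := v * v - t).
  assert (Ht : t = (v - u * / v) * v) by (unfold u; field; lra).
  rewrite Rabs_mult, (Rabs_pos_eq (/ v)) by (left; now apply Rinv_0_lt_compat).
  apply (Rmult_le_reg_r v); trivial; rewrite Rmult_assoc, Rinv_l, Rmult_1_r by lra.
  destruct (Rle_or_lt 0 u) as [Hu|Hu].
  - assert (S := sqrt_sqrt u Hu); assert (P := sqrt_pos u).
    replace t with (- ((sqrt u - v) * (sqrt u + v))) by (unfold u in *; lra).
    rewrite Rabs_Ropp, Rabs_mult, (Rabs_pos_eq (sqrt u + v)) by lra.
    apply Rmult_le_compat_l; [apply Rabs_pos|lra].
  - rewrite (sqrt_neg_0 u) by lra.
    replace (0 - v) with (- v) by ring.
    rewrite Rabs_Ropp, (Rabs_pos_eq v), Rabs_pos_eq; unfold u in *; nra.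
Qed.

Lemma bigO_ext (n : Z) (f g : pt4 -> R) :
  ev (fun p => f p = g p) -> bigO n f -> bigO n g.
Proof.
  intros E H x0 Hx; destruct (E x0 Hx) as [r1 L1].
  destruct (H x0 Hx) as [M [r2 L2]]; exists M, (Rmax r1 r2).
  generalize (filter_and _ _ L1 L2); apply filter_imp.
  intros x [A1 A2] r Hr; apply Rmax_Rlt in Hr as [H1 H2].
  rewrite <- A1 by trivial; now apply A2.
Qed.

Lemma bounded_bigO (f : pt4 -> R) :
  bounded (fun p => fst p * f p) -> bigO (-1) f.
Proof.
  intros H x0 Hx; destruct (H x0 Hx) as [M [R0 L]]; exists M, (Rmax R0 1).
  revert L; apply filter_imp; intros x A r Hr.
  apply Rmax_Rlt in Hr as [H1 H2]; specialize (A r H1); cbn [fst] in A.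
  rewrite Rabs_mult, (Rabs_pos_eq r) in A by lra.
  apply (Rmult_le_reg_l r); [lra|]; simpl.
  replace (r * (M * / (r * 1))) with M by (field; lra); exact A.
Qed.

(** The powers [3], [-4] and [1] of the three factors add up to zero. An error [O(1/rho)] only needs
    a Lipschitz-type bound on the volume element, so the square root is never expanded. *)
Lemma density_limit (h dh P : ten2 pt4) (D1 : pt4 -> R) (p1 eta0 : ten2 pt)
    (eta1 : ten2 pt4) :
  expands 6 (det h) (lift (det h0)) D1 ->
  (forall a b, expands (-3) (P a b) (fun _ => 0) (lift (p1 a b))) ->
  (forall a b, expands 1 (dh a b) (lift (eta0 a b)) (eta1 a b)) ->
  bigO (-1) (fun p =>
    vol h p * sum3 (fun a => sum3 (fun b => P a b p * dh a b p))
    - vol h0 (snd p) * sum3 (fun a => sum3 (fun b =>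
        p1 a b (snd p) * eta0 a b (snd p)))).
Proof.
  intros HD HP Hdh.
  set (S := fun p => sum3 (fun a => sum3 (fun b => P a b p * dh a b p))).
  set (q := fun x => sum3 (fun a => sum3 (fun b => p1 a b x * eta0 a b x))).
  assert (HS : expands (-2) S (fun _ => 0) (lift q)).
  { unfold S; eapply expands_coef;
      [exps ltac:(first [apply HP|apply Hdh])|reflexivity| |];
      apply ev_intro; intros r x _ _.
    - rewrite !sum3E; ring.
    - unfold lift, q; cbn [snd]; rewrite !sum3E; ring. }
  destruct HS as [_ [Hq [e [He ES]]]].
  destruct HD as [_ [HD1 [e' [He' ED]]]].
  set (F := fun p => D1 p + e' p * / fst p).
  assert (HI := reg_inv_radius).
  assert (HF : reg F) by (apply reg_plus; [|apply reg_mult]; trivial).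
  assert (Hv := reg0_vol_h0).
  assert (Hiv : reg0 (fun x => / vol h0 x)).
  { apply reg0_inv; trivial; intros x Hx; assert (V := vol_h0_pos x Hx); lra. }
  apply bounded_bigO.
  apply (bounded_combine
    (fun p => F p * lift (fun x => / vol h0 x) p * (lift q p + e p * / fst p))
    (fun p => lift (vol h0) p * e p) _ Rplus).
  2:{ apply reg_bounded; repeat first [assumption|apply reg_mult|apply reg_plus]. }
  2:{ apply reg_bounded; apply reg_mult; assumption. }
  generalize ES ED; apply ev_mono2; intros r x Hx Hr ES' ED' M1 M2 B1 B2.
  unfold lift in *; cbn [fst snd] in *.
  assert (V := vol_h0_pos x Hx); set (v := vol h0 x) in *.
  assert (V2 : v * v = - det h0 x).
  { unfold v, vol; apply sqrt_sqrt; rewrite det_h0.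
    assert (N := pow2_ge_0 (cosh (x tau) ^ 2 * sin (x theta))).
    replace (- (- cosh (x tau) ^ 4 * sin (x theta) ^ 2))
      with ((cosh (x tau) ^ 2 * sin (x theta)) ^ 2) by ring; exact N. }
  set (t := F (r, x) * / r).
  assert (EV : vol h (r, x) = r ^ 3 * sqrt (v * v - t)).
  { unfold vol; rewrite ED', V2; unfold t, F; cbn [fst].
    replace (- (powerRZ r 6 * (det h0 x + D1 (r, x) * / r
       + e' (r, x) * / r * / r))) with ((r ^ 3 * r ^ 3) *
      (- det h0 x - (D1 (r, x) + e' (r, x) * / r) * / r)) by (simpl; ring).
    rewrite sqrt_mult_alt by apply Rle_0_sqr.
    rewrite sqrt_square; trivial; apply pow_le; lra. }
  change (sum3 (fun a => sum3 (fun b => P a b (r, x) * dh a b (r, x))))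
    with (S (r, x)).
  fold (q x); rewrite EV, ES'.
  assert (B := sqrt_perturbation v t V); set (s := sqrt (v * v - t)) in *.
  set (w := q x + e (r, x) * / r) in *.
  (* The error splits into that of the volume element times the contracted tensors, and the unit
     volume element times the remainder of the contraction. *)
  replace (r * (r ^ 3 * s * (powerRZ r (-2) * (0 + q x * / r
     + e (r, x) * / r * / r)) - v * q x)) with
    ((r * (s - v)) * w + v * e (r, x)) by (unfold w; simpl; field; lra).
  eapply Rle_trans; [apply Rabs_triang|apply Rplus_le_compat; trivial].
  eapply Rle_trans; [|exact B1].
  rewrite (Rabs_mult _ w), (Rabs_mult _ w).
  apply Rmult_le_compat_r; [apply Rabs_pos|].
  rewrite Rabs_mult, (Rabs_pos_eq r) by lra.
  replace (F (r, x) * / v) with (r * (t * / v)) by (unfold t; field; lra).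
  rewrite Rabs_mult, (Rabs_pos_eq r) by lra.
  apply Rmult_le_compat_l; [lra|exact B].
Qed.

(** [pi_up h] is linear and both tensors use the same [h], so only the difference enters. Its
    leading part is zero, which keeps [h1] out of the first order, and vanishing trace leaves minus
    the raised tensor. *)
Lemma expands_pi_up_difference (h U V : ten2 pt4) (h1 d : ten2 pt) (a b : idx) :
  (forall a b, expands (-2) (inv h a b) (lift (ginv a b))
     (lift (fun x => - raise0 h1 a b x))) ->
  (forall a b, expands 1 (fun p => U a b p - V a b p) (fun _ => 0)
     (lift (d a b))) ->
  trace_free d ->
  expands (-3) (fun p => pi_up h U a b p - pi_up h V a b p) (fun _ => 0)
    (lift (fun x => - raise0 d a b x)).
Proof.
  intros HI HD Ht.
  eapply expands_ext with (F := fun p =>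
    sum3 (fun c => sum3 (fun e => inv h c e p * (U c e p - V c e p)))
      * inv h a b p
    - sum3 (fun c => sum3 (fun e => inv h a c p * inv h b e p *
        (U c e p - V c e p))));
    [exps ltac:(first [apply HD|apply HI])|reflexivity| | |].
  - apply ev_intro; intros; unfold pi_up, trace, raise; rewrite !sum3E; ring.
  - apply ev_intro; intros; rewrite !sum3E; ring.
  - apply ev_intro; intros r x Hx _; unfold lift; cbn [snd].
    transitivity (sum3 (fun c => sum3 (fun e => ginv c e x * d c e x))
      * ginv a b x - raise0 d a b x).
    + unfold raise0; rewrite !sum3E; ring.
    + rewrite Ht by trivial; ring.
Qed.

(** The current is [D^a sigma dk_ab]. Its divergence is the Hessian contracted with [dk], as the
    other term contains the divergence of [dk]; the [sigma] term of the density vanishes with the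
    trace of [dk]. [V] is spelled as [loc_mult] followed by [loc_contract] produces it. *)
Lemma divergence_identity (sigma : pt -> R) (k : ten2 pt) (x : pt) :
  reg0 sigma -> (forall a b, reg0 (k a b)) -> symmetric k -> trace_free k ->
  div_free k -> chart x ->
  let V := fun l y => sum3 (fun a => sum3 (fun b => inv h0 a b y *
    (cd0 (scalar_tensor sigma) (firstn 1 (a :: b :: l)) y *
     ten2_tensor k (skipn 1 (a :: b :: l)) y))) in
  limit_density sigma k x = vol h0 x * sum3 (fun a => sum3 (fun b =>
    inv h0 a b x * cd0 V [a; b] x)).
Proof.
  intros Hs Hk Ss Tk Dk Hx V; unfold limit_density; f_equal.
  assert (HW := regT_cd0 _ (regT_scalar _ Hs)).
  assert (HK := regT_ten2 _ Hk).
  set (W := cd0 (scalar_tensor sigma)) in *.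
  assert (EV : forall b y, chart y -> V [b] y =
    sum3 (fun c => sum3 (fun e => ginv c e y * (W [c] y * k e b y)))).
  { intros b y Hy; unfold V; apply Sum_ext; intros c; apply Sum_ext; intros e.
    now rewrite inv_h0. }
  (* The uncontracted product, a rank-three tensor to which the contraction and Leibniz rules
     apply. *)
  set (U := fun l y => match l with
    | [c; e; b] => W [c] y * k e b y | _ => 0 end).
  assert (HU : regT U).
  { intros [|c [|e [|b [|? ?]]]]; try apply (reg0_const 0).
    apply reg0_mult; [apply HW|apply Hk]. }
  assert (EC : forall a b, cd0 V [a; b] x =
    sum3 (fun c => sum3 (fun e => ginv c e x * cd0 U [a; c; e; b] x))).
  { intros a b; rewrite cd0_contract_1, cd0_1 by trivial; f_equal.
    - apply pd_ext_chart; trivial; intros; now apply EV.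
    - apply Sum_ext; intros e; now rewrite EV. }
  assert (EU : forall a c e b, cd0 U [a; c; e; b] x =
    hess0 sigma a c x * k e b x + W [c] x * cd0 (ten2_tensor k) [a; e; b] x).
  { intros a c e b; unfold hess0; fold W.
    rewrite cd0_3, cd0_2, cd0_1, !ten2_tensor_at by trivial; unfold U.
    rewrite (pd_mult a (W [c]) (k e b)); [rewrite !sum3E, !ten2_tensor_at; ring| |];
      (apply reg0_ex; [|exact Hx]); [apply HW|apply Hk]. }
  transitivity (
    sum3 (fun a => sum3 (fun b => raise0 (hess0 sigma) a b x * k a b x))
    + sigma x * sum3 (fun a => sum3 (fun b => ginv a b x * k a b x))
    + sum3 (fun c => sum3 (fun e => ginv c e x * W [c] x *
       sum3 (fun a => sum3 (fun b =>
         ginv a b x * cd0 (ten2_tensor k) [a; b; e] x))))).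
  - rewrite Tk by trivial.
    rewrite (Sum_ext idxs (fun c => sum3 (fun e => ginv c e x * W [c] x * _))
      (fun _ => 0)).
    2:{ intros c; rewrite (Sum_ext idxs _ (fun _ => 0)); [rewrite sum3E; ring|].
        intros e; rewrite Dk by trivial; ring. }
    unfold raise, raise0; rewrite !sum3E, !inv_h0 by trivial.
    generalize (Tk x Hx); rewrite !sum3E; intros T.
    match type of T with ?t = 0 =>
      match goal with |- ?l = ?r =>
        replace r with (r + sigma x * t) by (rewrite T; ring) end end.
    ring.
  - rewrite (Sum_ext idxs (fun a => sum3 (fun b => inv h0 a b x * _))
      (fun a => sum3 (fun b => ginv a b x * sum3 (fun c => sum3 (fun e =>
        ginv c e x * (hess0 sigma a c x * k e b x
          + W [c] x * cd0 (ten2_tensor k) [a; b; e] x)))))).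
    2:{ intros a; apply Sum_ext; intros b; rewrite inv_h0, EC by trivial; f_equal.
        apply Sum_ext; intros c; apply Sum_ext; intros e; rewrite EU.
        now rewrite (cd0_sym_2 k a e b). }
    unfold raise0; rewrite Tk, !sum3E by trivial.
    rewrite !(ginv_sym theta tau), !(ginv_sym phi tau), !(ginv_sym phi theta).
    rewrite !(Ss theta tau), !(Ss phi tau), !(Ss phi theta) by trivial.
    rewrite !(hess0_sym sigma Hs theta tau), !(hess0_sym sigma Hs phi tau),
      !(hess0_sym sigma Hs phi theta) by trivial.
    ring.
Qed.

(** The variation of [sigma] is pure trace and pairs to zero with the trace-free [psi0]; this is why
    only [dk] survives in the limit. *)
Lemma limit_density_psi0 (sigma dsigma : pt -> R) (dk : ten2 pt) (x : pt) :
  reg0 sigma ->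
  (forall x, chart x -> box0 (scalar_tensor sigma) [] x + 3 * sigma x = 0) ->
  chart x ->
  vol h0 x * sum3 (fun a => sum3 (fun b => raise0 (psi0 sigma) a b x *
    (- 2 * dsigma x * h0 a b x + dk a b x))) = limit_density sigma dk x.
Proof.
  intros Hs He Hx; unfold limit_density; f_equal.
  transitivity (sum3 (fun a => sum3 (fun b =>
      raise0 (psi0 sigma) a b x * dk a b x))
    + - 2 * dsigma x *
      sum3 (fun a => sum3 (fun b => ginv a b x * psi0 sigma a b x))).
  - unfold raise0; rewrite !sum3E; unfold ginv, h0; trig_field x Hx.
  - rewrite (psi0_trace_free sigma) by trivial.
    rewrite Rmult_0_r, Rplus_0_r.
    apply Sum_ext; intros a; apply Sum_ext; intros b; f_equal.
    unfold raise, raise0, psi0; rewrite !sum3E, !inv_h0 by trivial.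
    destruct a, b; unfold ginv, h0; trig_field x Hx.
Qed.

Section Variation.
Variables (sigma : pt -> R) (k h1 : ten2 pt) (h Kh : ten2 pt4)
  (Li : idx -> idx -> ten2 pt4) (dsigma : pt -> R) (dk : ten2 pt) (dh : ten2 pt4).
Hypothesis h_asymptotics : beig_schmidt sigma h1 h.
Hypothesis data : first_order_data sigma k.
Hypothesis h1_eq : forall a b x, chart x ->
  h1 a b x = k a b x + (-2) * (sigma x * h0 a b x).
Hypothesis Kh_spec : is_Khat h Kh.
Hypothesis Li_spec : is_Linv h Kh Li.
Hypothesis ddata : first_order_data dsigma dk.
Hypothesis dh_spec : forall a b, asympO 0 (fun p =>
     dh a b p - fst p * (- 2 * dsigma (snd p) * h0 a b (snd p)
                         + dk a b (snd p))).

Lemma variation_density_limit :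
  bigO (-1) (fun p => variation_density sigma h Kh Li dh (fst p) (snd p)
                      - limit_density sigma dk (snd p)).
Proof.
  destruct (first_order_facts _ _ data) as [Rs [Es [Rk [Sk [Tk [Dk Bk]]]]]].
  destruct (first_order_facts _ _ ddata) as [Rds [_ [Rdk _]]].
  assert (h1r := h1_reg sigma k h1 Rs Rk h1_eq).
  assert (h1s := h1_sym sigma k h1 Sk h1_eq).
  assert (HK := expands_Kh sigma k h1 h Kh h_asymptotics Rs Es Rk Sk Tk Dk Bk
    h1_eq Kh_spec).
  assert (HT := psi_tt sigma k Rs Es Rk Sk Tk Dk Bk).
  assert (HI := expands_inv_h sigma h1 h h_asymptotics h1r h1s).
  assert (HX := fun a b => expands_extrinsic sigma h1 h h_asymptotics h1r a b Rs).
  assert (HDelta := expands_Delta h1 (psi sigma k) h Kh Li h1r h1s HT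
    (h_sym sigma h1 h h_asymptotics) (expands_h sigma h1 h h_asymptotics h1r)
    (det_h_neq sigma h1 h h_asymptotics h1r h1s) HI
    (expands_covd_2 sigma h1 h h_asymptotics h1r h1s)
    (expands_covd_3 sigma h1 h h_asymptotics h1r h1s) HK Li_spec).
  set (P := fun a b p => pi_up h (extrinsic sigma h) a b p - pi_up h Kh a b p
     + Delta h Kh Li (fst p) a b (snd p)).
  assert (HP : forall a b, expands (-3) (P a b) (fun _ => 0)
    (lift (raise0 (psi0 sigma) a b))).
  { intros a b; eapply expands_coef; [eapply expands_plus;
      [eapply (expands_pi_up_difference h (extrinsic sigma h) Kh h1
         (fun a b x => - psi0 sigma a b x)); [exact HI| |]
      |apply HDelta|reflexivity|reflexivity]|reflexivity| |].
    (* In [K - Khat] the parts [h0] cancel, and after substituting [h1] the terms in [k] and [sigma]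
       do too, leaving [- psi0]. *)
    - intros c e; eapply expands_coef; [eapply expands_minus;
        [apply HX|apply HK|reflexivity|reflexivity]|reflexivity| |];
        evx r x Hx Hr; [ring|].
      unfold psi; rewrite h1_eq by trivial; field.
    - intros x Hx; assert (T := psi0_trace_free sigma Es x Hx).
      rewrite !sum3E in *; lra.
    - evx r x Hx Hr; ring.
    - evx r x Hx Hr; unfold raise0; rewrite !sum3E; ring. }
  assert (Hdh : forall a b, expands 1 (dh a b)
    (lift (fun x => - 2 * dsigma x * h0 a b x + dk a b x))
    (fun p => dh a b p - fst p * (- 2 * dsigma (snd p) * h0 a b (snd p)
                         + dk a b (snd p)))).
  { intros a b; split; [|split].
    - apply (reg0_plus (fun x => - 2 * dsigma x * h0 a b x) (dk a b)); trivial.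
      repeat apply reg0_mult; trivial; [apply reg0_const|apply reg0_h0].
    - generalize (asympO_reg _ _ (dh_spec a b)); apply reg_ext.
      apply ev_intro; intros; simpl; ring.
    - exists (fun _ => 0); split; [apply reg_const|].
      evx r x Hx Hr; simpl; field; lra. }
  assert (L := density_limit h dh P _ _ _ _
    (expands_det sigma h1 h h_asymptotics h1r h1s) HP Hdh).
  revert L; apply bigO_ext; apply ev_intro; intros r x Hx Hr; cbn [fst snd].
  rewrite (limit_density_psi0 sigma dsigma dk x) by trivial; reflexivity.
Qed.

End Variation.

Theorem mainTheorem2
  (G : R) (hG : 0 < G)
  (sigma : R -> pt -> R) (h1 : R -> ten2 pt) (h Kh : R -> ten2 pt4)
  (Li : idx -> idx -> ten2 pt4)
  (dsigma : pt -> R) (dk : ten2 pt) (dh : ten2 pt4)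
  (int : (pt -> R) -> R) (bulk : R -> (pt4 -> R) -> R)
  (hflat : ricci_flat (sigma 0) (h 0))
  (hvar : class_variation sigma h1 h dsigma dk dh)
  (hKh : locally 0 (fun s => is_Khat (h s) (Kh s)))
  (hLi : is_Linv (h 0) (Kh 0) Li)
  (hint : integral_dS3
            (field_set (sigma 0) (k_of (sigma 0) (h1 0)) dsigma dk) int)
  (hbulk : integral_bulk int bulk)
  (hformula : first_variation_formula G bulk int sigma h Kh Li dh)
  (hterm : integrates_termwise int
             (variation_density (sigma 0) (h 0) (Kh 0) Li dh)) :
  is_lim
    (fun r => 16 * PI * G *
       Derive (fun s => MM_action G bulk int (sigma s) (h s) (Kh s) r) 0)
    p_infty (int (limit_density (sigma 0) dk)) /\
  int (limit_density (sigma 0) dk) = 0.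
Proof.
  destruct hvar as [hloc [_ [_ [hddata hdh]]]].
  destruct (locally_singleton _ _ hloc) as [hBS hdata].
  assert (hK0 := locally_singleton _ _ hKh).
  split.
  - destruct hformula as [R0 hf].
    apply (is_lim_ext_loc
      (fun r => int (variation_density (sigma 0) (h 0) (Kh 0) Li dh r))).
    + exists R0; intros r Hr.
      transitivity (16 * PI * G * (/ (16 * PI * G) *
        int (variation_density (sigma 0) (h 0) (Kh 0) Li dh r))).
      * field; generalize PI_RGT_0; lra.
      * f_equal; symmetry; exact (is_derive_unique _ _ _ (hf r Hr)).
    (* The pointwise limit with a locally uniform error [O(1/rho)] is the premise for passing to the
       limit under [int]. *)
    + apply hterm.
      apply (variation_density_limit (sigma 0) (k_of (sigma 0) (h1 0)) (h1 0)
        (h 0) (Kh 0) Li dsigma dk dh); trivial.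
      intros a b x _; unfold k_of; ring.
  - destruct (first_order_facts _ _ hdata) as [Rs _].
    destruct (first_order_facts _ _ hddata) as [_ [_ [Rk [Sk [Tk [Dk _]]]]]].
    destruct hint as [hext [_ [_ hdiv]]].
    rewrite (hext _ _ (fun x Hx =>
      divergence_identity (sigma 0) dk x Rs Rk Sk Tk Dk Hx)).
    apply hdiv.
    (* The current of [divergence_identity] as a contraction of the product of the gradient of
       [sigma], rank 1, with [dk], rank 2. *)
    apply (loc_contract _ 1 (fun l x => cd0 (scalar_tensor (sigma 0))
      (firstn 1 l) x * ten2_tensor dk (skipn 1 l) x)).
    apply (loc_mult _ 1 2).
    + apply (loc_covd _ 0), loc_field, fs_sigma.
    + apply loc_field, fs_dk.
Qed.
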